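(* Let $g\in\{2,3\}$ and let $H\le \mathrm{U}(g)$ be one of the groups $\mathrm{U}(1)$, $H_g$, $H'_{g,4}$, $H_{g,4}$ (defined in the context). Then for every integer $m\ge 1$, $$\int_{H}\prod_{i=1}^m\det(I+x_i\gamma)\,d\gamma=\sum_{\lambda\trianglelefteq(g^m)}\mathfrak m_{\lambda'}(H)\,S^{\mathrm{U}(m)}_\lambda(x_1,\dots,x_m),$$ where $d\gamma$ is the probability Haar measure on $H$ and $\mathfrak m_{\lambda'}(H)$ is the multiplicity of the trivial representation of $H$ in the restriction to $H$ of the irreducible representation of $\mathrm{U}(g)$ with highest weight $\lambda'$. These multiplicities are given explicitly as follows. (1) $g=2$, $\lambda'=(a,b)$ with $m\ge a\ge b\ge 0$: $\mathfrak m_{(a,b)}(\mathrm{U}(1))=\delta(a\equiv_2 b)$, $\ \mathfrak m_{(a,b)}(H_2)=\delta(a\equiv_4 b)$, $\ \mathfrak m_{(a,b)}(H'_{2,4})=\delta(a+b\equiv_4 0)$, $\ \mathfrak m_{(a,b)}(H_{2,4})=\delta(a+b\equiv_4 0)\,\delta(a-b\equiv_4 0)$. (2) $g=3$, $H=\mathrm{U}(1)$ or $H_3$, $\lambda'=(a+k,b+k,k)$ with $a\ge b\ge 0$, $k\ge 0$, and $z:=a-b$: $$\mathfrak m_{\lambda'}(\mathrm{U}(1))=\left\lceil\tfrac{(z+1)(b+1)}{2}\right\rceil,\qquad \mathfrak m_{\lambda'}(H_3)=\tfrac12\left(\left\lceil\tfrac{(z+1)(b+1)}{2}\right\rceil+\tau(z,b)\right).$$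 (3) $g=3$, $H=H'_{3,4}$ or $H_{3,4}$, $\lambda'=(a+2k,b+2k,\epsilon+2k)$ with $k\ge0$, $\epsilon\in\{0,1\}$, $a\ge b\ge\epsilon$, and $z:=a-b$, $b':=b-\epsilon$: $$\mathfrak m_{\lambda'}(H'_{3,4})=\frac{(z+1)(b'+1)+\kappa_\epsilon(z,b')}{4},\qquad \mathfrak m_{\lambda'}(H_{3,4})=\frac{b'z+\eta_\epsilon(z,b')\cdot(b',z)+\xi_\epsilon(z,b')}{8}.$$ The functions $\tau,\kappa_\epsilon,\eta_\epsilon,\xi_\epsilon$ are given by the tables in the context.
   Context: For a statement $P$, $\delta(P)=1$ if $P$ is true and $0$ otherwise; $m\equiv_k m'$ means $k\mid m-m'$. A partition is a non-increasing finite sequence of non-negative integers (trailing zeros allowed); $\lambda\trianglelefteq\mu$ means containment of Young diagrams (the length of $\lambda$ is at most that of $\mu$ and $\lambda_i\le\mu_i$ for all $i$); $\lambda'$ is the transpose of $\lambda$; $(g^m)$ is the partition with $m$ parts equal to $g$. $S^{\mathrm{U}(m)}_\lambda$ is the Schur polynomial in $m$ variables, i.e. the irreducible character of $\mathrm{U}(m)$ with highest weight $\lambda$. Groups. $\mathrm{U}(1)$ is embedded in $\mathrm{U}(2)$ as $\{\mathrm{diag}(t,t^{-1}):|t|=1\}$ and in $\mathrm{U}(3)$ as $\{\mathrm{diag}(t,t^{-1},1):|t|=1\}$. Let $$J_2=\begin{pmatrix}0&1\\-1&0\end{pmatrix},\quad \zeta_{2,4}=\mathrm{diag}(\sqrt{-1},\sqrt{-1}),\quad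 J_3=\begin{pmatrix}0&1&0\\-1&0&0\\0&0&1\end{pmatrix},\quad \zeta_{3,4}=\mathrm{diag}(\sqrt{-1},\sqrt{-1},1).$$ For $g=2,3$: $H_g=\langle \mathrm{U}(1),J_g\rangle$, $H'_{g,4}=\langle \mathrm{U}(1),\zeta_{g,4}\rangle$, $H_{g,4}=\langle \mathrm{U}(1),J_g,\zeta_{g,4}\rangle$, subgroups of $\mathrm{U}(g)$. Tables. Each function below depends on the residues of its two arguments; the matrix entry in row $r$ and column $s$ (rows and columns numbered from $0$) is the value when the first argument is $\equiv r$ and the second is $\equiv s$, modulo $4$ for $4\times4$ matrices and modulo $2$ for $2\times2$ matrices. For pairs, $(x,y)\cdot(b',z)=xb'+yz$. $$\tau=\begin{pmatrix}1&1&0&0\\1&0&-1&0\\0&-1&-1&0\\0&0&0&0\end{pmatrix},\quad \kappa_0=\begin{pmatrix}3&-2&1&0\\2&-4&2&0\\1&-2&3&0\\0&0&0&0\end{pmatrix},\quad \kappa_1=\begin{pmatrix}-1&2&1&0\\-2&4&-2&0\\1&2&-1&0\\0&0&0&0\end{pmatrix},$$ $$\eta_0=\begin{pmatrix}(2,2)&(0,1)\\(1,2)&(1,1)\end{pmatrix},\quad \eta_1=\begin{pmatrix}(0,0)&(2,1)\\(1,0)&(1,1)\end{pmatrix},$$ $$\xi_0=\begin{pmatrix}8&0&4&0\\6&-3&2&1\\4&-4&4&0\\2&1&2&1\end{pmatrix},\quad \xi_1=\begin{pmatrix}0&6&0&2\\0&5&-4&1\\0&2&-4&2\\0&1&0&1\end{pmatrix}.$$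 *)

(* Defs.v *)
From HB Require Import structures.
From mathcomp Require Import all_boot all_order all_algebra.
From mathcomp Require Import complex.
From mathcomp Require Import all_classical all_reals all_analysis.

Set Implicit Arguments.
Unset Strict Implicit.
Unset Printing Implicit Defensive.

Import Order.TTheory GRing.Theory Num.Theory.
Import numFieldNormedType.Exports.

Local Open Scope classical_set_scope.
Local Open Scope ring_scope.

(* R[i] packed as a numClosedFieldType: matrices over it then inherit the
   topology that MathComp-Analysis puts on every such field. *)
Definition Cx (R : realType) : numClosedFieldType := R[i].

(** * The groups *)

Definition unitary_group (R : realType) (g : nat) : set 'M[Cx R]_g :=
  [set A | A \is unitarymx].

Inductive generated_by (R : realType) (g : nat) (S : set 'M[Cx R]_g) :
    set 'M[Cx R]_g :=
  | generated_in A of S A : generated_by S A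
  | generated_1 : generated_by S 1%:M
  | generated_mul A B of generated_by S A & generated_by S B : generated_by S (A *m B)
  | generated_inv A of generated_by S A : generated_by S (invmx A).

(* The next three definitions are used for g = 2 and g = 3 only: the entries
   with an index i >= 2 are those of the trailing 1 that occurs when g = 3. *)
Definition U1_in (R : realType) (g : nat) : set 'M[Cx R]_g :=
  [set A | exists2 t : Cx R, `|t| = 1 &
     A = diag_mx (\row_(i < g) if (i == 0 :> nat)%N then t
                               else if (i == 1 :> nat)%N then t^-1 else 1)].

Definition Jmx (R : realType) (g : nat) : 'M[Cx R]_g :=
  \matrix_(i < g, j < g)
    if ((i == 0 :> nat) && (j == 1 :> nat))%N then 1
    else if ((i == 1 :> nat) && (j == 0 :> nat))%N then -1
    else ((i == j) && (2 <= i)%N)%:R.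

Definition zeta4 (R : realType) (g : nat) : 'M[Cx R]_g :=
  diag_mx (\row_(i < g) if (i < 2)%N then 'i else 1).

Inductive subgroup_kind := KU1 | KH | KH'4 | KH4.

Definition subgroup_of (R : realType) (g : nat) (K : subgroup_kind) :
    set 'M[Cx R]_g :=
  match K with
  | KU1 => @U1_in R g
  | KH => generated_by (@U1_in R g `|` [set Jmx R g])
  | KH'4 => generated_by (@U1_in R g `|` [set zeta4 R g])
  | KH4 => generated_by (@U1_in R g `|` [set Jmx R g] `|` [set zeta4 R g])
  end.

(** * Haar measure and integration *)

Definition borel_mx (R : realType) (g : nat) :=
  g_sigma_algebraType (@open 'M[Cx R]_g).

(* The probability Haar measure of a compact matrix group H, seen as a Borel
   probability measure on matrices that is carried by H. *)
Definition is_haar_probability (R : realType) (g : nat) (H : set 'M[Cx R]_g)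
    (P : probability (borel_mx R g) R) : Prop :=
  P H = 1%E /\
  forall (h : 'M[Cx R]_g) (A : set (borel_mx R g)), H h -> measurable A ->
    P [set h *m a | a in (A : set 'M[Cx R]_g)] = P A.

Definition cintegral (R : realType) (g : nat)
    (P : probability (borel_mx R g) R) (D : set 'M[Cx R]_g)
    (f : 'M[Cx R]_g -> Cx R) : Cx R :=
  Complex (Rintegral P (D : set (borel_mx R g)) (fun A => complex.Re (f A)))
          (Rintegral P (D : set (borel_mx R g)) (fun A => complex.Im (f A))).

(** * Representations of U(g) *)

(* Only the values of rho on U(g) matter; rho A acts on column vectors. *)
Definition is_rep (R : realType) (g n : nat)
    (rho : 'M[Cx R]_g -> 'M[Cx R]_n) : Prop :=
  [/\ rho 1%:M = 1%:M,
      forall A B, unitary_group A -> unitary_group B ->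
        rho (A *m B) = rho A *m rho B
    & {within @unitary_group R g, continuous rho}].

Definition is_irreducible (R : realType) (g n : nat)
    (rho : 'M[Cx R]_g -> 'M[Cx R]_n) : Prop :=
  (0 < n)%N /\
  forall W : {vspace 'cV[Cx R]_n},
    (forall A v, unitary_group A -> v \in W -> rho A *m v \in W) ->
    W = 0%VS \/ W = fullv.

Definition is_weight (R : realType) (g n : nat)
    (rho : 'M[Cx R]_g -> 'M[Cx R]_n) (nu : 'I_g -> int) : Prop :=
  exists2 v : 'cV[Cx R]_n, v != 0 &
    forall t : 'rV[Cx R]_g, (forall i, `|t 0 i| = 1) ->
      rho (diag_mx t) *m v = (\prod_(i < g) t 0 i ^ nu i) *: v.

(* mu - nu is a nonnegative integer combination of the positive roots
   e_i - e_j, i < j *)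
Definition weight_le (g : nat) (nu mu : 'I_g -> int) : Prop :=
  exists c : 'I_g -> 'I_g -> nat, forall k : 'I_g,
    mu k - nu k = \sum_(i < g) \sum_(j < g | (i < j)%N)
                    (c i j)%:Z * ((i == k)%:Z - (j == k)%:Z).

Definition is_highest_weight (R : realType) (g n : nat)
    (rho : 'M[Cx R]_g -> 'M[Cx R]_n) (mu : 'I_g -> int) : Prop :=
  is_weight rho mu /\ forall nu, is_weight rho nu -> weight_le nu mu.

(* k = dim V^H = dim Hom_H(1, V) *)
Definition dim_invariants (R : realType) (g n : nat)
    (rho : 'M[Cx R]_g -> 'M[Cx R]_n) (H : set 'M[Cx R]_g) (k : nat) : Prop :=
  exists2 W : {vspace 'cV[Cx R]_n}, \dim W = k &
    forall v, (v \in W) <-> (forall A, H A -> rho A *m v = v).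

(* k is the multiplicity of the trivial representation of H in the irreducible
   representation of U(g) with highest weight mu.  That representation is
   determined up to isomorphism by mu, hence so is k. *)
Definition trivial_multiplicity (R : realType) (g : nat)
    (H : set 'M[Cx R]_g) (mu : seq nat) (k : nat) : Prop :=
  exists n : nat, exists rho : 'M[Cx R]_g -> 'M[Cx R]_n,
    [/\ is_rep rho, is_irreducible rho,
        is_highest_weight rho (fun i : 'I_g => (nth 0%N mu i)%:Z)
      & dim_invariants rho H k].

(** * Partitions and Schur polynomials *)

(* Partitions contained in (g^m) are the non-increasing lam : 'I_m -> 'I_g.+1,
   padded with zeros to length m. *)
Definition is_partition (m g : nat) (lam : {ffun 'I_m -> 'I_g.+1}) : bool :=
  [forall i : 'I_m, forall j : 'I_m, (i <= j)%N ==> (lam j <= lam i)%N].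

(* the transpose, padded with zeros to length g *)
Definition transposed_part (m g : nat) (lam : {ffun 'I_m -> 'I_g.+1}) : seq nat :=
  mkseq (fun j => #|[set i : 'I_m | (j < lam i)%N]|) g.

(* The cells of the diagram of lam are the pairs Tagged _ (j : 'I_(lam i)) of a
   row i and a column j. *)
Definition is_ssyt (m : nat) (lam : 'I_m -> nat)
    (T : {ffun {i : 'I_m & 'I_(lam i)} -> 'I_m}) : bool :=
  [forall c : {i : 'I_m & 'I_(lam i)}, forall d : {i : 'I_m & 'I_(lam i)},
     (((tag c == tag d) && (tagged c <= tagged d)%N) ==> (T c <= T d)%N) &&
     (((tag c < tag d)%N && (tagged c == tagged d :> nat)) ==> (T c < T d)%N)].

Definition schur (R : realType) (m : nat) (lam : 'I_m -> nat)
    (x : 'I_m -> Cx R) : Cx R :=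
  \sum_(T : {ffun {i : 'I_m & 'I_(lam i)} -> 'I_m} | is_ssyt T)
    \prod_(c : {i : 'I_m & 'I_(lam i)}) x (T c).

(** * Tables *)

(* M is a square matrix given by its rows; its entries are read modulo its
   size. *)
Definition lookup (T : Type) (x0 : T) (M : seq (seq T)) (r s : nat) : T :=
  nth x0 (nth [::] M (r %% size M)) (s %% size M).

Definition tau_tab : nat -> nat -> int := lookup 0
  [:: [:: 1;  1;  0; 0];
      [:: 1;  0; -1; 0];
      [:: 0; -1; -1; 0];
      [:: 0;  0;  0; 0]].

Definition kappa_tab (eps : bool) : nat -> nat -> int := lookup 0
  (if eps then
  [:: [:: -1; 2;  1; 0];
      [:: -2; 4; -2; 0];
      [::  1; 2; -1; 0];
      [::  0; 0;  0; 0]]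
   else
  [:: [:: 3; -2; 1; 0];
      [:: 2; -4; 2; 0];
      [:: 1; -2; 3; 0];
      [:: 0;  0; 0; 0]]).

Definition eta_tab (eps : bool) : nat -> nat -> nat * nat := lookup (0, 0)%N
  (if eps then
  [:: [:: (0, 0); (2, 1)];
      [:: (1, 0); (1, 1)]]%N
   else
  [:: [:: (2, 2); (0, 1)];
      [:: (1, 2); (1, 1)]]%N).

Definition xi_tab (eps : bool) : nat -> nat -> int := lookup 0
  (if eps then
  [:: [:: 0; 6;  0; 2];
      [:: 0; 5; -4; 1];
      [:: 0; 2; -4; 2];
      [:: 0; 1;  0; 1]]
   else
  [:: [:: 8;  0; 4; 0];
      [:: 6; -3; 2; 1];
      [:: 4; -4; 4; 0];
      [:: 2;  1; 2; 1]]).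

Definition pair_dot (p q : nat * nat) : nat := (p.1 * q.1 + p.2 * q.2)%N.

(* Main.v *)
(* U(1) is the torus of H and H / U(1) has exponent 2, so the multiplicity of the
   trivial representation is a short average of characters over cosets.

   The irreducible representation of highest weight (a, b, c) is realised on the
   functions of X in U(3) spanned by the monomials of degree a - b in the first
   column u of X and of degree b - c in the conjugate y of its last column, times
   det(X)^b (for U(2): b = c).  The only relation, u . y = 0, leaves the monomials
   without u_0 y_0 as a basis; it is indexed by Gelfand-Tsetlin patterns, which
   are also its weights, so the character is the sum over patterns and satisfies
   the bialternant formula.  Irreducibility follows from the reproducing kernel:
   the top coordinate of the vector of X^* Y is the inner product of the tensors
   of X and Y.

   By branching along the rows of the patterns, a multiplicity for U(3) is the
   sum, over the rows (v, w) interlacing (a, b, c), of the multiplicities for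
   U(2) at (v, w); these are congruence conditions modulo 4, and lattice points
   of a rectangle are counted by residue.

   The integral: a unitary matrix is diagonalisable, so the product of the
   determinants is expanded by the dual Cauchy identity, proved by induction on m
   from the branching rule of tableaux and the Pieri rule of alternants; and the
   Haar average of a representation projects onto its invariants, so the integral
   of its character is their dimension. *)

Require Import Defs.
From HB Require Import structures.
From mathcomp Require Import all_boot all_order all_algebra perm.
From mathcomp Require Import ring lra zify.
From mathcomp Require Import complex.
From mathcomp Require Import all_classical all_reals all_analysis measurable_realfun.

Set Implicit Arguments.
Unset Strict Implicit.
Unset Printing Implicit Defensive.

Import Order.TTheory GRing.Theory Num.Theory.
Import numFieldNormedType.Exports.

Local Open Scope ring_scope.

Local Notation "A ^H" := ((A ^t*)%sesqui) (at level 30).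

(** * Branching of semistandard tableaux *)

(** After transposition, the horizontal strips removed by the branching rule are subsets of ['I_g].
    These match the subsets of exponents that are raised when an alternant is multiplied by the
    product of the [1 + x * t j]. The representations are built from the vectors [phi X] of values
    of standard monomials at X: they span the space, and [phi 1] is the top basis vector. Tensors
    are indexed by words, not exponents, because repeated words supply the multinomial weights that
    turn the inner product of two tensors into a product of powers of matrix entries and a
    determinant. Haar measure enters only through its mass on H and its left invariance. The
    explicit coset average and the entrywise Haar average of a representation both take values in
    the invariants and fix them, so both have the dimension of the invariants as trace. The
    determinant is 1 on U(1) and [H_3], whereas zeta has determinant -1. Hence highest weights may
    be shifted by any k in the first case but only by 2k in the second, which is the origin of
    epsilon. *)

Definition ssyt_sum (C : comNzRingType) (m : nat) (lam : 'I_m -> nat)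
    (x : 'I_m -> C) : C :=
  \sum_(T : {ffun {i : 'I_m & 'I_(lam i)} -> 'I_m} | is_ssyt T)
    \prod_(c : {i : 'I_m & 'I_(lam i)}) x (T c).

Definition cell (m : nat) (lam : 'I_m -> nat) (i : 'I_m) (j : nat)
  (h : (j < lam i)%N) : {i : 'I_m & 'I_(lam i)} :=
  Tagged (fun i => 'I_(lam i)) (Ordinal h).

Lemma cellE (m : nat) (lam : 'I_m -> nat) (c : {i : 'I_m & 'I_(lam i)}) :
  exists i j (h : (j < lam i)%N), c = cell h.
Proof. by case: c => i [j h]; exists i, j, h. Qed.

Lemma is_ssytP (m : nat) (lam : 'I_m -> nat)
    (T : {ffun {i : 'I_m & 'I_(lam i)} -> 'I_m}) :
  reflect ((forall i j j' (h : (j < lam i)%N) (h' : (j' < lam i)%N),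
              (j <= j')%N -> (T (cell h) <= T (cell h'))%N) /\
           (forall (i i' : 'I_m) j (h : (j < lam i)%N) (h' : (j < lam i')%N),
              (i < i')%N -> (T (cell h) < T (cell h'))%N))
    (is_ssyt T).
Proof.
apply: (iffP forallP) => [H|[H1 H2] c].
  split=> [i j j' h h' jj'|i i' j h h' ii'].
    by have /forallP/(_ (cell h'))/andP[/implyP + _] := H (cell h);
       apply; rewrite /= eqxx.
  by have /forallP/(_ (cell h'))/andP[_ /implyP] := H (cell h);
     apply; rewrite /= ii' eqxx.
apply/forallP => d; have [i [j [h ->]]] := cellE c; have [i' [j' [h' ->]]] := cellE d.
apply/andP; split; apply/implyP => /andP[/=].
  by move/eqP => e; move: h' ; rewrite -e => h' jj'; exact: H1.
by move=> ii' /eqP e; move: h'; rewrite -e => h'; exact: H2.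
Qed.

Section Branching.
Variables (m : nat) (lam : 'I_m.+1 -> nat).
Hypothesis lam_dec : forall i j : 'I_m.+1, (i <= j)%N -> (lam j <= lam i)%N.

Let w (i : 'I_m) : 'I_m.+1 := widen_ord (leqnSn m) i.

Definition interlaced (nu : 'I_m -> nat) :=
  [forall i : 'I_m, (lam (lift ord0 i) <= nu i)%N && (nu i <= lam (w i))%N].

(** Inverse of deleting the largest letter: the cells of [lam] outside [nu] receive [ord_max]. *)
Definition extend_tableau (nu : 'I_m -> nat)
    (T : {ffun {i : 'I_m & 'I_(nu i)} -> 'I_m}) :
  {ffun {i : 'I_m.+1 & 'I_(lam i)} -> 'I_m.+1} :=
  [ffun c => if (insub (nat_of_ord (tag c)) : option 'I_m) is Some i then
     if (insub (nat_of_ord (tagged c)) : option 'I_(nu i)) is Some j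
     then w (T (Tagged (fun i => 'I_(nu i)) j)) else ord_max
   else ord_max].

(** The defaults [tag c] only provide an element of ['I_m]; they are not reached when [nu] is the
    inner shape of a semistandard tableau. *)
Definition restrict_tableau (nu : 'I_m -> nat)
    (T : {ffun {i : 'I_m.+1 & 'I_(lam i)} -> 'I_m.+1}) :
  {ffun {i : 'I_m & 'I_(nu i)} -> 'I_m} :=
  [ffun c => if (insub (nat_of_ord (tagged c)) : option 'I_(lam (w (tag c)))) is Some j
     then insubd (tag c) (nat_of_ord (T (Tagged (fun i => 'I_(lam i)) j)))
     else tag c].

Lemma extend_in nu T (i : 'I_m) j (h : (j < nu i)%N) (h' : (j < lam (w i))%N) :
  @extend_tableau nu T (cell h') = w (T (cell h)).
Proof.
rewrite ffunE /=; case: insubP => [i' _ ei|]; last by rewrite ltn_ord.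
have ? : i' = i by apply: val_inj.
subst i'; case: insubP => [j' _ ej|]; last by rewrite h.
by congr (w (T _)); rewrite /cell; congr (Tagged _ _); apply: val_inj.
Qed.

Lemma extend_out nu T (i : 'I_m) j (h' : (j < lam (w i))%N) :
  (nu i <= j)%N -> @extend_tableau nu T (cell h') = ord_max.
Proof.
move=> le; rewrite ffunE /=; case: insubP => [i' _ ei|//].
have ? : i' = i by apply: val_inj.
by subst i'; case: insubP => [j' + _|//]; rewrite ltnNge le.
Qed.

Lemma extend_last nu T j (h' : (j < lam ord_max)%N) :
  @extend_tableau nu T (cell h') = ord_max.
Proof. by rewrite ffunE /=; case: insubP => // i' /=; rewrite ltnn. Qed.

Lemma restrict_in nu (T : {ffun {i : 'I_m.+1 & 'I_(lam i)} -> 'I_m.+1}) (i : 'I_m) j (h : (j < nu i)%N) (h' : (j < lam (w i))%N) :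
  (T (cell h') < m)%N -> @restrict_tableau nu T (cell h) = T (cell h') :> nat.
Proof.
move=> lt; rewrite ffunE /=; case: insubP => [j' _ ej|]; last by rewrite h'.
have e : Tagged (fun i => 'I_(lam i)) j' = cell h'.
  by rewrite /cell; congr (Tagged _ _); apply: val_inj.
by rewrite e val_insubd lt.
Qed.

Lemma ordS_cases (i : 'I_m.+1) : i = ord_max \/ exists i', i = w i'.
Proof.
have [lt|ge] := ltnP i m; first by right; exists (Ordinal lt); apply: val_inj.
by left; apply: val_inj; apply/eqP; rewrite eqn_leq ge -ltnS ltn_ord.
Qed.

Definition inner_shape (T : {ffun {i : 'I_m.+1 & 'I_(lam i)} -> 'I_m.+1})
  (i : 'I_m) : nat :=
  #|[set j : 'I_(lam (w i)) | (T (Tagged (fun i => 'I_(lam i)) j) < m)%N]|.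

Lemma card_prefix n (P : pred 'I_n) (k : nat) : (k <= n)%N ->
  (forall j : 'I_n, P j = (j < k)%N) -> #|[set j | P j]| = k.
Proof.
move=> kn H.
have inj : injective (widen_ord kn) by move=> i j /(congr1 val) /= ?; apply: val_inj.
rewrite -[RHS]card_ord -(card_imset _ inj).
apply: eq_card => j; rewrite !inE H; apply/idP/imsetP => [lt|[j' _ ->]].
  by exists (Ordinal lt) => //; apply: val_inj.
exact: (ltn_ord j').
Qed.

(** Lengths of rows and columns are defined as cardinals; this turns them back into initial
    segments. *)
Lemma prefix_card n (P : pred 'I_n) :
  (forall i j : 'I_n, (i <= j)%N -> P j -> P i) ->
  forall j : 'I_n, P j = (j < #|[set j | P j]|)%N.
Proof.
move=> H.
have [k kn Hk] : exists2 k, (k <= n)%N & forall j : 'I_n, P j = (j < k)%N.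
  have ex : exists k, [forall j : 'I_n, P j ==> (j < k)%N].
    by exists n; apply/forallP => j; apply/implyP.
  exists (ex_minn ex).
    case: ex_minnP => k _; apply; apply/forallP => j; exact/implyP.
  case: ex_minnP => k /forallP Hk min j; apply/idP/idP; first exact/implyP.
  move=> lt; case: (boolP (P j)) => // nP.
  suff : (k <= j)%N by rewrite leqNgt lt.
  apply: min; apply/forallP => i; apply/implyP => Pi; rewrite ltnNge.
  by apply/negP => ij; move/negP: nP; apply; exact: H Pi.
by move=> j; rewrite (card_prefix kn Hk).
Qed.

Lemma inner_shapeP T : is_ssyt T -> forall (i : 'I_m) j (h : (j < lam (w i))%N),
  (T (cell h) < m)%N = (j < inner_shape T i)%N.
Proof.
move=> /is_ssytP[H1 _] i j h.
rewrite /inner_shape.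
rewrite -(@prefix_card _ (fun j => T (Tagged (fun i => 'I_(lam i)) j) < m)%N _ (Ordinal h)) //.
move=> [a ha] [b hb] /= ab; apply: leq_ltn_trans; exact: H1.
Qed.

(** Column strictness gains at least one per row, and [lam_dec] supplies the cells above. In
    particular the last row holds only [ord_max], so an inner shape needs only m rows. *)
Lemma ssyt_row_ge T : is_ssyt T -> forall (i : 'I_m.+1) j (h : (j < lam i)%N),
  (i <= T (cell h))%N.
Proof.
move=> /is_ssytP[_ H2] [i hi]; elim: i hi => [//|i IH] hi j h.
have hi' : (i < m.+1)%N by exact: ltnW.
have h' : (j < lam (Ordinal hi'))%N by apply: leq_trans h _; exact: lam_dec.
by apply: leq_ltn_trans (IH hi' j h') _; exact: H2.
Qed.

(** The first cell of row i outside the inner shape holds the largest letter, so column strictness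
    forbids a cell below it. *)
Lemma inner_shape_interlaced T : is_ssyt T -> interlaced (inner_shape T).
Proof.
move=> HT; apply/forallP => i; apply/andP; split; last first.
  by rewrite /inner_shape -[leqRHS]card_ord max_card.
rewrite leqNgt; apply/negP => lt.
have h : (inner_shape T i < lam (w i))%N.
  by apply: leq_trans lt _; apply: lam_dec; rewrite /= /bump leqnSn.
have := inner_shapeP HT h; rewrite ltnn => /negbT/negP; apply.
have /is_ssytP[_ /(_ _ _ _ h lt)] := HT.
rewrite /= /bump => /(_ (ltnSn _)) lt'.
by apply: leq_trans lt' _; rewrite -ltnS ltn_ord.
Qed.

Lemma extend_ssyt nu T : interlaced nu ->
  is_ssyt (@extend_tableau nu T) = is_ssyt T.
Proof.
move=> /forallP I; apply/is_ssytP/is_ssytP => [[H1 H2]|[H1 H2]]; split.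
- move=> i j j' h h' jj'; have /andP[_ le] := I i.
  have := H1 _ _ _ (leq_trans h le) (leq_trans h' le) jj'.
  by rewrite (extend_in _ h) (extend_in _ h').
- move=> i i' j h h' ii'; have /andP[_ le] := I i; have /andP[_ le'] := I i'.
  have := H2 (w i) (w i') _ (leq_trans h le) (leq_trans h' le') ii'.
  by rewrite (extend_in _ h) (extend_in _ h').
- move=> i j j' h h' jj'; have [?|[i' ?]] := ordS_cases i; subst i.
    by rewrite !extend_last.
  have [h1|h1] := ltnP j' (nu i'); last by rewrite (extend_out _ h' h1) -ltnS ltn_ord.
  have h2 := leq_ltn_trans jj' h1.
  by rewrite (extend_in _ h1) (extend_in _ h2); exact: H1.
move=> i i' j h h' ii'; have [?|[i1 ?]] := ordS_cases i; subst i.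
  by have := leq_ltn_trans ii' (ltn_ord i'); rewrite ltnn.
(* A cell with another one below it lies in [nu], since [lam] at the next row is at most [nu i1];
   its entry is therefore below [ord_max]. *)
have h1 : (j < nu i1)%N.
  have /andP[le _] := I i1; apply: leq_trans le; apply: leq_trans h' _.
  by apply: lam_dec.
rewrite (extend_in _ h1).
have [?|[i2 ?]] := ordS_cases i'; subst i'; first by rewrite extend_last /= ltn_ord.
have [h2|h2] := ltnP j (nu i2); last by rewrite (extend_out _ h' h2) /= ltn_ord.
by rewrite (extend_in _ h2); exact: H2.
Qed.

Lemma extend_inner_shape nu T : interlaced nu ->
  forall i, inner_shape (@extend_tableau nu T) i = nu i.
Proof.
move=> /forallP I i; have /andP[_ le] := I i.
apply: (card_prefix le) => -[j h] /=.
have [h1|h1] := ltnP j (nu i); first by rewrite (extend_in _ h1) /= ltn_ord.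
by rewrite (extend_out _ h h1) ltnn.
Qed.

Lemma extendK nu : interlaced nu ->
  cancel (@extend_tableau nu) (@restrict_tableau nu).
Proof.
move=> /forallP I T; apply/ffunP => c; have [i [j [h ->]]] := cellE c.
apply: val_inj; have /andP[_ le] := I i; have h' := leq_trans h le.
rewrite /= (@restrict_in _ _ _ _ h h') (extend_in _ h) //= ltn_ord //.
Qed.

Lemma restrictK nu T : is_ssyt T -> inner_shape T =1 nu ->
  extend_tableau (restrict_tableau nu T) = T.
Proof.
move=> HT E; apply/ffunP => c; have [i [j [h ->]]] := cellE c.
have [?|[i' ?]] := ordS_cases i; subst i.
  rewrite extend_last; apply: val_inj; apply/eqP; rewrite eqn_leq /=.
  by rewrite -[X in _ && X]ltnS ltn_ord andbT (ssyt_row_ge HT h).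
have [h1|h1] := ltnP j (nu i').
  rewrite (extend_in _ h1); apply: val_inj => /=; rewrite (@restrict_in _ _ _ _ h1 h) //.
  by rewrite (inner_shapeP HT) E.
rewrite (extend_out _ h h1); apply: val_inj; apply/eqP; rewrite eqn_leq /=.
by rewrite -[X in _ && X]ltnS ltn_ord andbT leqNgt (inner_shapeP HT) E -leqNgt.
Qed.

Lemma prod_cells (C : comNzRingType) n (mu : 'I_n -> nat) (F : {i : 'I_n & 'I_(mu i)} -> C) :
  \prod_(c : {i : 'I_n & 'I_(mu i)}) F c =
  \prod_(i < n) \prod_(j < mu i) F (Tagged (fun i => 'I_(mu i)) j).
Proof.
rewrite (sig_big_dep _ (fun=> predT) (fun i j => F (Tagged (fun i => 'I_(mu i)) j))) /=.
by apply: eq_big => // -[].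
Qed.

Lemma prod_extend (C : comNzRingType) nu T (x : 'I_m.+1 -> C) : interlaced nu ->
  \prod_c x (@extend_tableau nu T c) =
  (\prod_c x (w (T c))) * x ord_max ^+ (\sum_i lam i - \sum_i nu i).
Proof.
move=> /forallP I.
have -> : (\sum_i lam i - \sum_i nu i)%N =
   (\sum_(i < m) (lam (w i) - nu i) + lam ord_max)%N.
  rewrite big_ord_recr /= sumnB => [|i _]; last by have /andP[] := I i.
  rewrite addnBAC // leq_sum // => i _; by have /andP[] := I i.
rewrite exprD !prod_cells big_ord_recr /= mulrA; congr (_ * _); last first.
  rewrite -[in RHS](card_ord (lam ord_max)) -prodr_const; apply: eq_bigr => j _.
  by case: j => j h; rewrite -[Tagged _ _]/(cell h) extend_last.
rewrite expr_sum -big_split /=; apply: eq_bigr => i _.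
have /andP[_ le] := I i.
rewrite (bigID (fun j : 'I_(lam (w i)) => (j < nu i)%N)) /=; congr (_ * _).
  rewrite (big_ord_narrow le) /=; apply: eq_bigr => -[j h] _.
  rewrite (_ : Tagged _ (widen_ord le _) = cell (leq_trans h le)) ?(extend_in _ h) //.
  by rewrite /cell; congr (Tagged _ _); apply: val_inj.
transitivity (\prod_(j < lam (w i) | ~~ (j < nu i)%N) x ord_max).
  apply: eq_bigr => -[j h] /= ; rewrite -leqNgt => le1.
  by rewrite -[Tagged _ _]/(cell h) extend_out.
rewrite prodr_const; congr (_ ^+ _).
rewrite -[X in (X - _)%N](card_ord (lam (w i))).
rewrite -(@cardC 'I_(lam (w i)) (fun j => (j < nu i)%N)).
have -> : #|[pred j : 'I_(lam (w i)) | (j < nu i)%N]| = nu i.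
  by rewrite -[RHS](card_prefix (P := fun j => (j < nu i)%N) le) // cardsE.
by rewrite addKn; apply: eq_card.
Qed.

(** Tableaux are sorted by the shape left after deleting the largest letter; on each class
    [extend_tableau] and [restrict_tableau] are inverse to each other. *)
Theorem ssyt_branching (C : comNzRingType) (g : nat) (x : 'I_m.+1 -> C) :
  (forall i, lam i <= g)%N ->
  ssyt_sum lam x =
  \sum_(nu : {ffun 'I_m -> 'I_g.+1} | interlaced (fun i => nu i))
     ssyt_sum (fun i => nu i) (fun i => x (w i)) *
     x ord_max ^+ (\sum_i lam i - \sum_i nu i).
Proof.
move=> Hg; rewrite /ssyt_sum.
pose sh (T : {ffun {i : 'I_m.+1 & 'I_(lam i)} -> 'I_m.+1}) : {ffun 'I_m -> 'I_g.+1} :=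
  [ffun i => inord (inner_shape T i)].
have shE T i : sh T i = inner_shape T i :> nat.
  rewrite ffunE inordK // ltnS; apply: leq_trans (Hg (w i)).
  by rewrite /inner_shape -[leqRHS]card_ord max_card.
rewrite (partition_big sh (fun nu => interlaced (fun i => nu i))) => [|T HT]; last first.
  apply/forallP => i; rewrite shE.
  by have /forallP/(_ i) := inner_shape_interlaced HT.
apply: eq_bigr => nu I; rewrite mulr_suml.
rewrite (reindex_onto (@extend_tableau (fun i => nu i)) (restrict_tableau (fun i => nu i))) /=.
  apply: eq_big => T.
    rewrite extend_ssyt // extendK // eqxx andbT.
    rewrite (_ : sh _ == nu) ?andbT //; apply/eqP/ffunP => i; apply: val_inj.
    by rewrite /= shE extend_inner_shape.
  by move=> _; rewrite prod_extend.
move=> T /andP[HT /eqP E]; apply: restrictK => // i.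
by rewrite -E shE.
Qed.
End Branching.

(** * The dual Cauchy identity *)

Definition nonincr (n : nat) (mu : {ffun 'I_n -> nat}) : bool :=
  [forall i : 'I_n, forall j : 'I_n, (i <= j)%N ==> (mu j <= mu i)%N].

Lemma nonincrP n (mu : {ffun 'I_n -> nat}) :
  reflect (forall i j : 'I_n, (i <= j)%N -> (mu j <= mu i)%N) (nonincr mu).
Proof.
apply: (iffP forallP) => H i; first by move=> j; have /forallP/(_ j)/implyP := H i.
by apply/forallP => j; apply/implyP; exact: H.
Qed.

Lemma is_partitionP m g (lam : {ffun 'I_m -> 'I_g.+1}) :
  reflect (forall i j : 'I_m, (i <= j)%N -> (lam j <= lam i)%N) (is_partition lam).
Proof.
apply: (iffP forallP) => H i; first by move=> j; have /forallP/(_ j)/implyP := H i.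
by apply/forallP => j; apply/implyP; exact: H.
Qed.

Definition conj_part (m g : nat) (lam : {ffun 'I_m -> 'I_g.+1}) : {ffun 'I_g -> nat} :=
  [ffun j : 'I_g => #|[set i : 'I_m | (j < lam i)%N]|].

Definition part_of_conj (m g : nat) (mu : {ffun 'I_g -> nat}) : {ffun 'I_m -> 'I_g.+1} :=
  [ffun i : 'I_m => inord #|[set j : 'I_g | (i < mu j)%N]|].

Definition add_strip (g : nat) (mu : {ffun 'I_g -> nat}) (S : {set 'I_g}) : {ffun 'I_g -> nat} :=
  [ffun j => (mu j + (j \in S))%N].

Lemma add_stripE g (mu : {ffun 'I_g -> nat}) S j : add_strip mu S j = (mu j + (j \in S))%N.
Proof. by rewrite ffunE. Qed.

Lemma conj_partP m g (lam : {ffun 'I_m -> 'I_g.+1}) : is_partition lam ->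
  forall (i : 'I_m) (j : 'I_g), (i < conj_part lam j)%N = (j < lam i)%N.
Proof.
move=> /is_partitionP H i j; rewrite ffunE.
rewrite -(@prefix_card _ (fun i => (j < lam i)%N)) // => a b ab lt.
exact: leq_trans lt (H _ _ ab).
Qed.

Lemma conj_part_le m g (lam : {ffun 'I_m -> 'I_g.+1}) j : (conj_part lam j <= m)%N.
Proof. by rewrite ffunE -[leqRHS]card_ord max_card. Qed.

Lemma conj_part_nonincr m g (lam : {ffun 'I_m -> 'I_g.+1}) : nonincr (conj_part lam).
Proof.
apply/nonincrP => i j ij; rewrite !ffunE; apply: subset_leq_card.
by apply/fintype.subsetP => k; rewrite !inE; exact: leq_ltn_trans.
Qed.

Lemma part_of_conjP m g (mu : {ffun 'I_g -> nat}) : nonincr mu ->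
  forall (i : 'I_m) (j : 'I_g), (j < part_of_conj m mu i)%N = (i < mu j)%N.
Proof.
move=> /nonincrP H i j; rewrite ffunE inordK; last first.
  by rewrite ltnS -[leqRHS]card_ord max_card.
rewrite -(@prefix_card _ (fun j => (i < mu j)%N)) // => a b ab lt.
exact: leq_trans lt (H _ _ ab).
Qed.

Lemma ltn_forall_leq g (a b : 'I_g.+1) :
  (forall j : 'I_g, (j < a)%N -> (j < b)%N) -> (a <= b)%N.
Proof.
move=> H; rewrite leqNgt; apply/negP => lt.
have hb : (b < g)%N by apply: leq_trans lt _; rewrite -ltnS.
by have := H (Ordinal hb) lt; rewrite /= ltnn.
Qed.

Lemma ltn_forall_leq_nat m (a b : nat) : (a <= m)%N ->
  (forall j : 'I_m, (j < a)%N -> (j < b)%N) -> (a <= b)%N.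
Proof.
move=> am H; rewrite leqNgt; apply/negP => lt.
by have := H (Ordinal (leq_trans lt am)) lt; rewrite /= ltnn.
Qed.

Lemma part_of_conj_partition m g (mu : {ffun 'I_g -> nat}) : nonincr mu ->
  is_partition (part_of_conj m mu).
Proof.
move=> H; apply/is_partitionP => i j ij; apply: ltn_forall_leq => k.
by rewrite !part_of_conjP //; exact: leq_ltn_trans.
Qed.

Lemma part_of_conjK m g (mu : {ffun 'I_g -> nat}) : nonincr mu ->
  (forall j, mu j <= m)%N -> conj_part (part_of_conj m mu) = mu.
Proof.
move=> H le; apply/ffunP => j; rewrite ffunE; apply: (card_prefix (le j)) => i.
exact: part_of_conjP.
Qed.

Lemma conj_partK m g (lam : {ffun 'I_m -> 'I_g.+1}) : is_partition lam ->
  part_of_conj m (conj_part lam) = lam.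
Proof.
move=> H; apply/ffunP => i; apply: val_inj; apply/eqP; rewrite eqn_leq.
by apply/andP; split; apply: ltn_forall_leq => j;
   rewrite part_of_conjP ?conj_part_nonincr // conj_partP.
Qed.

Lemma sum_conj_part m g (lam : {ffun 'I_m -> 'I_g.+1}) :
  (\sum_j conj_part lam j = \sum_i lam i)%N.
Proof.
transitivity (\sum_(j < g) \sum_(i < m) (j < lam i)%N)%N.
  apply: eq_bigr => j _; rewrite ffunE -sum1_card big_mkcond /=.
  by apply: eq_bigr => i _; rewrite inE; case: ifP.
rewrite exchange_big; apply: eq_bigr => i _.
rewrite -[RHS](@card_prefix g (fun j => (j < lam i)%N) (lam i)) //; last first.
  by rewrite -ltnS.
by rewrite -sum1_card [RHS]big_mkcond; apply: eq_bigr => j _; rewrite inE; case: ifP.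
Qed.

Section Strip.
Variables (m g : nat) (nu : {ffun 'I_m -> 'I_g.+1}).
Hypothesis nu_part : is_partition nu.
Let itl (lam : {ffun 'I_m.+1 -> 'I_g.+1}) :=
  is_partition lam && interlaced (fun i => lam i) (fun i => nu i).
Let strip (lam : {ffun 'I_m.+1 -> 'I_g.+1}) : {set 'I_g} :=
  [set j | (conj_part nu j < conj_part lam j)%N].

(** The two halves of interlacing bound each column: [nu i <= lam i] says that no column shrinks,
    and [lam (i+1) <= nu i] that it grows by at most one cell. *)
Lemma conj_part_interlaced lam : itl lam ->
  conj_part lam = add_strip (conj_part nu) (strip lam).
Proof.
move=> /andP[Hl /forallP I]; apply/ffunP => j; rewrite add_stripE inE.
suff /andP[h1 h2] : (conj_part nu j <= conj_part lam j <= (conj_part nu j).+1)%N.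
  by case: (boolP (conj_part nu j < conj_part lam j)%N) => /=; lia.
apply/andP; split.
  apply: (ltn_forall_leq_nat (conj_part_le nu j)) => i; rewrite conj_partP // => h.
  have := conj_partP Hl (widen_ord (leqnSn m) i) j => /= ->.
  by have /andP[_] := I i; apply: leq_trans.
case E : (conj_part lam j) => [//|k]; rewrite ltnS.
have km : (k <= m)%N by rewrite -ltnS -E conj_part_le.
apply: (ltn_forall_leq_nat km) => i ik; rewrite conj_partP //.
have /andP[+ _] := I i; apply: leq_trans.
by rewrite -conj_partP // lift0 E.
Qed.

Lemma add_strip_le S j : (add_strip (conj_part nu) S j <= m.+1)%N.
Proof. by rewrite add_stripE; have := conj_part_le nu j; case: (j \in S); lia. Qed.

Lemma strip_interlaced S : nonincr (add_strip (conj_part nu) S) ->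
  itl (part_of_conj m.+1 (add_strip (conj_part nu) S)).
Proof.
move=> H; rewrite /itl part_of_conj_partition //=; apply/forallP => i; apply/andP; split.
  apply: ltn_forall_leq => j; rewrite part_of_conjP // lift0 -conj_partP // add_stripE.
  by case: (j \in S); lia.
apply: ltn_forall_leq => j; rewrite part_of_conjP // -conj_partP // add_stripE /=.
by case: (j \in S); lia.
Qed.

(** The set S of growing columns determines [lam], and one cell is added in each of them. *)
Lemma sum_interlaced (C : comNzRingType) (x : C) (ch : {ffun 'I_g -> nat} -> C) :
  \sum_(lam | itl lam) x ^+ (\sum_i lam i - \sum_i nu i) * ch (conj_part lam) =
  \sum_(S : {set 'I_g} | nonincr (add_strip (conj_part nu) S))
     x ^+ #|S| * ch (add_strip (conj_part nu) S).
Proof.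
rewrite (reindex_onto (fun S => part_of_conj m.+1 (add_strip (conj_part nu) S)) strip).
  have K S : nonincr (add_strip (conj_part nu) S) ->
      strip (part_of_conj m.+1 (add_strip (conj_part nu) S)) = S.
    move=> H; apply/setP => j; rewrite inE part_of_conjK //; last exact: add_strip_le.
    by rewrite add_stripE; case: (j \in S); lia.
  apply: eq_big => S.
    apply/andP/idP => [[Hl /eqP E]|H].
      by rewrite -E -(conj_part_interlaced Hl) conj_part_nonincr.
    by split; [exact: strip_interlaced | rewrite K].
  move=> /andP[Hl /eqP E].
  have H : nonincr (add_strip (conj_part nu) S).
    by rewrite -E -(conj_part_interlaced Hl) conj_part_nonincr.
  rewrite -!sum_conj_part part_of_conjK //; last exact: add_strip_le.
  congr (x ^+ _ * _); rewrite -sumnB => [|j _]; last by rewrite add_stripE leq_addr.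
  rewrite -sum1_card [RHS]big_mkcond; apply: eq_bigr => j _; rewrite add_stripE addKn.
  by case: (j \in S).
move=> lam H; rewrite -(conj_part_interlaced H).
by apply: conj_partK; case/andP: H.
Qed.
End Strip.

Lemma interlaced_partition m g (lam : {ffun 'I_m.+1 -> 'I_g.+1}) (nu : {ffun 'I_m -> 'I_g.+1}) :
  is_partition lam -> interlaced (fun i => lam i) (fun i => nu i) -> is_partition nu.
Proof.
move=> /is_partitionP H /forallP I; apply/is_partitionP => i j.
rewrite leq_eqVlt => /orP[/eqP/val_inj->//|ij].
have /andP[le _] := I i; have /andP[_ le'] := I j.
apply: leq_trans le' (leq_trans _ le); apply: H; by rewrite lift0.
Qed.

(** Generating function in [x] of the Pieri rule for the elementary symmetric polynomials of [t]:
    each S adds a vertical strip to [mu]. *)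
Definition satisfies_pieri (C : comNzRingType) g (t : 'I_g -> C)
    (ch : {ffun 'I_g -> nat} -> C) :=
  forall (x : C) (mu : {ffun 'I_g -> nat}), nonincr mu ->
   (\prod_j (1 + x * t j)) * ch mu =
   \sum_(S : {set 'I_g} | nonincr (add_strip mu S)) x ^+ #|S| * ch (add_strip mu S).

Theorem dual_cauchy (C : comNzRingType) g (t : 'I_g -> C)
    (ch : {ffun 'I_g -> nat} -> C) :
  ch [ffun=> 0%N] = 1 -> satisfies_pieri t ch ->
  forall m (x : 'I_m -> C),
  \prod_(i < m) \prod_(j < g) (1 + x i * t j) =
  \sum_(lam : {ffun 'I_m -> 'I_g.+1} | is_partition lam)
     ssyt_sum (fun i => lam i) x * ch (conj_part lam).
Proof.
move=> ch0 pieri; elim=> [|m IH] x.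
  rewrite big_ord0 (big_pred1 [ffun=> ord0]) => [|lam]; last first.
    rewrite /= (_ : is_partition lam); last by apply/is_partitionP => -[].
    by symmetry; apply/eqP/ffunP => -[].
  rewrite (_ : conj_part _ = [ffun=> 0%N]) ?ch0 ?mulr1; last first.
    by apply/ffunP => j; rewrite !ffunE; apply/eqP; rewrite cards_eq0; apply/eqP/setP => -[].
  rewrite /ssyt_sum.
  have F : {i : 'I_0 & 'I_(([ffun=> ord0] : {ffun 'I_0 -> 'I_g.+1}) i)} -> False by case=> -[].
  rewrite (big_pred1 [ffun c => False_rect _ (F c)]) => [|T].
    by rewrite big1 // => c; case: (F c).
  have -> : is_ssyt T by apply/forallP => c; case: (F c).
  by symmetry; apply/eqP/ffunP => c; case: (F c).
rewrite big_ord_recr /= (IH (fun i => x (widen_ord (leqnSn m) i))) mulr_suml.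
transitivity (\sum_(lam : {ffun 'I_m.+1 -> 'I_g.+1} | is_partition lam)
   \sum_(nu : {ffun 'I_m -> 'I_g.+1} | is_partition nu && interlaced (fun i => lam i) (fun i => nu i))
    ssyt_sum (fun i => nu i) (fun i => x (widen_ord (leqnSn m) i)) *
     x ord_max ^+ (\sum_i lam i - \sum_i nu i) * ch (conj_part lam)); last first.
  apply: eq_bigr => lam Hl; have := Hl => /is_partitionP Hl'.
  rewrite (ssyt_branching Hl' (g := g)) => [|i]; last by rewrite -ltnS.
  rewrite mulr_suml; apply: eq_bigl => nu.
  apply/andP/idP => [[]//|I]; split=> //; exact: interlaced_partition I.
(* For fixed [nu], the sum over the shapes [lam] above it is the Pieri expansion of the last factor
   at [conj_part nu]. *)
rewrite (exchange_big_dep (@is_partition m g)) /=; last by move=> lam nu _ /andP[].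
apply: eq_bigr => nu Hnu.
rewrite -mulrA [X in _ * X]mulrC pieri ?conj_part_nonincr // -(sum_interlaced Hnu).
rewrite mulr_sumr Hnu /=; apply: eq_bigr => lam _; exact: mulrA.
Qed.

(** * Alternants and the characters given by patterns *)

Section Bialternant.
Variables (C : idomainType) (g : nat) (t : 'I_g -> C).

Definition alternant (l : 'I_g -> nat) : C := \det (\matrix_(i, j) t j ^+ l i).

(** In each term of the Leibniz expansion the product, reindexed by the permutation, distributes
    over the set S of factors that contribute [x * t j]. *)
Lemma alternant_mul (x : C) l :
  (\prod_j (1 + x * t j)) * alternant l =
  \sum_(S : {set 'I_g}) x ^+ #|S| * alternant (fun i => (l i + (i \in S))%N).
Proof.
rewrite /alternant /determinant mulr_sumr.
under [RHS]eq_bigr do rewrite mulr_sumr.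
rewrite [RHS]exchange_big /=; apply: eq_bigr => s _.
under [RHS]eq_bigr do rewrite mulrCA.
rewrite mulrCA -mulr_sumr; congr (_ * _).
rewrite (reindex_inj (@perm_inj _ s)) -big_split /=.
under eq_bigr do rewrite mxE mulrDl mul1r addrC.
rewrite bigA_distr; apply: eq_bigr => S _.
rewrite -prodr_const [X in _ = X * _]big_mkcond -big_split /=; apply: eq_bigr => i _.
rewrite mxE; case: (i \in S); last by rewrite addn0 mul1r.
by rewrite addn1 exprS mulrA.
Qed.

(** The exponents [mu + rho] of the bialternant formula. *)
Definition staircase (mu : {ffun 'I_g -> nat}) (i : 'I_g) : nat := (mu i + (g - i.+1))%N.

Lemma alternant_eq0 (l : 'I_g -> nat) i j : i != j -> l i = l j -> alternant l = 0.
Proof.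
by move=> ij e; apply: (determinant_alternate ij) => k; rewrite !mxE e.
Qed.

(** A failure of monotonicity forces [mu i = mu j] with i outside S and j in S. Between i and j
    there is an adjacent pair of this kind, found by induction on the distance; its two staircase
    exponents agree, so the determinant has two equal rows. *)
Lemma alternant_strip_eq0 mu S : nonincr mu -> ~~ nonincr (add_strip mu S) ->
  alternant (staircase (add_strip mu S)) = 0.
Proof.
move=> /nonincrP H; rewrite /nonincr => /fintype.forallPn[i /fintype.forallPn[j]].
rewrite negb_imply -ltnNge !add_stripE => /andP[ij] lt.
have {lt} [e [iS jS]] : mu i = mu j /\ i \notin S /\ j \in S.
  have := H _ _ ij; case: (i \in S) lt; case: (j \in S) => /= lt le; lia.
have [n En] : exists n, n = (j - i)%N by exists (j - i)%N.
elim: n i ij e iS En => [|n IH] i ij e iS En.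
  have ? : i = j by apply: val_inj => /=; lia.
  by subst i; rewrite jS in iS.
have hk : (i.+1 < g)%N by have := ltn_ord j; lia.
pose k := Ordinal hk.
have ek : mu k = mu j.
  have kj : (k <= j)%N by move: ij En => /=; lia.
  by apply/eqP; rewrite eqn_leq (H _ _ kj) -e H /=.
case: (boolP (k \in S)) => kS; last by apply: (IH k) => //=; lia.
apply: (@alternant_eq0 _ i k); first by rewrite -val_eqE /=; lia.
rewrite /staircase !add_stripE (negbTE iS) kS e ek /=; lia.
Qed.

(** [D] stands for the Vandermonde product: it is cancelled in the domain, and the sets S that
    destroy monotonicity contribute vanishing alternants. *)
Lemma pieri_of_alternant (ch : {ffun 'I_g -> nat} -> C) (D : C) : D != 0 ->
  (forall mu, nonincr mu -> D * ch mu = alternant (staircase mu)) ->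
  satisfies_pieri t ch.
Proof.
move=> D0 H x mu Hmu; apply: (mulfI D0).
rewrite mulrCA H // alternant_mul mulr_sumr.
rewrite (bigID (fun S => nonincr (add_strip mu S))) /= [X in _ + X]big1 ?addr0 => [|S nS].
  apply: eq_bigr => S HS; rewrite mulrCA H //; congr (_ * \det _).
  by apply/matrixP => i j; rewrite !mxE /staircase add_stripE addnAC.
rewrite -[RHS](mulr0 (x ^+ #|S|)) -(alternant_strip_eq0 Hmu nS); congr (_ * \det _).
by apply/matrixP => i j; rewrite !mxE /staircase add_stripE addnAC.
Qed.
End Bialternant.

(* A pattern ((v, w), j) is a row (v, w), interlacing mu when g = 3 and equal to mu
   when g = 2, together with an entry j between w and v. *)
Definition gt_rows (mu : seq nat) : seq (nat * nat) :=
  match mu with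
  | [:: a; b] => [:: (a, b)]
  | [:: a; b; c] => [seq (v, w) | v <- iota b (a - b).+1, w <- iota c (b - c).+1]
  | _ => [::]
  end.

Definition gt_patterns (mu : seq nat) : seq ((nat * nat) * nat) :=
  [seq (v, j) | v <- gt_rows mu, j <- iota v.2 (v.1 - v.2).+1].

Definition gt_weight (mu : seq nat) (p : (nat * nat) * nat) (i : nat) : nat :=
  match i with
  | 0 => p.2
  | 1 => p.1.1 + p.1.2 - p.2
  | _ => sumn mu - (p.1.1 + p.1.2)
  end.

Definition gt_char (C : comNzRingType) g (t : 'I_g -> C) (mu : seq nat) : C :=
  \sum_(p <- gt_patterns mu) \prod_(i < g) t i ^+ gt_weight mu p i.

(** Homogeneous geometric series starting at [b]; the bound on [b + k] keeps the truncated
    subtractions exact. Besides the characters, it later sums the powers of ['i] and -1 along a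
    row. *)
Lemma geometric_sum (C : comNzRingType) (x y : C) (b k s : nat) : (b + k <= s.+1)%N ->
  (x - y) * (\sum_(j <- iota b k) x ^+ j * y ^+ (s - j)) =
  x ^+ (b + k) * y ^+ (s.+1 - (b + k)) - x ^+ b * y ^+ (s.+1 - b).
Proof.
elim: k => [|k IH] le; first by rewrite big_nil mulr0 addn0 subrr.
rewrite -addn1 iotaD big_cat /= big_seq1 mulrDr IH; last by lia.
have -> : (s.+1 - (b + k) = (s - (b + k)).+1)%N by lia.
have -> : (s.+1 - (b + (k + 1)) = s - (b + k))%N by lia.
by rewrite addn1 addnS !exprS; ring.
Qed.

Lemma det2E (C : comNzRingType) (A : 'M[C]_2) :
  \det A = A 0 0 * A 1 1 - A 0 1 * A 1 0.
Proof.
rewrite (expand_det_row _ 0) big_ord_recl big_ord1 /cofactor !det_mx11 !mxE /=.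
have e01 : lift 0 0 = 1 :> 'I_2 by apply: val_inj.
have e10 : lift 1 0 = 0 :> 'I_2 by apply: val_inj.
by rewrite !e01 !e10; ring.
Qed.

Lemma prod2E (C : comNzRingType) (F : 'I_2 -> C) : \prod_(i < 2) F i = F 0 * F 1.
Proof. by rewrite !big_ord_recl big_ord0 mulr1; congr (_ * F _); apply: val_inj. Qed.

Lemma prod3E (C : comNzRingType) (F : 'I_3 -> C) : \prod_(i < 3) F i = F 0 * F 1 * F 2.
Proof.
by rewrite !big_ord_recl big_ord0 mulr1 mulrA; congr (_ * F _ * F _); apply: val_inj.
Qed.

Lemma sum3E (C : nmodType) (F : 'I_3 -> C) : \sum_(i < 3) F i = F 0 + F 1 + F 2.
Proof.
by rewrite !big_ord_recl big_ord0 addr0 addrA; congr (_ + F _ + F _); apply: val_inj.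
Qed.

Lemma det3E (C : comNzRingType) (A : 'M[C]_3) :
  \det A = A 0 0 * (A 1 1 * A 2 2 - A 1 2 * A 2 1)
         - A 0 1 * (A 1 0 * A 2 2 - A 1 2 * A 2 0)
         + A 0 2 * (A 1 0 * A 2 1 - A 1 1 * A 2 0).
Proof.
rewrite (expand_det_row _ 0) sum3E /cofactor !det2E !mxE /=.
have e01 : lift 0 0 = 1 :> 'I_3 by apply: val_inj.
have e02 : lift 0 1 = 2 :> 'I_3 by apply: val_inj.
have e10 : lift 1 0 = 0 :> 'I_3 by apply: val_inj.
have e11 : lift 1 1 = 2 :> 'I_3 by apply: val_inj.
have e20 : lift 2 0 = 0 :> 'I_3 by apply: val_inj.
have e21 : lift 2 1 = 1 :> 'I_3 by apply: val_inj.
rewrite ?e01 ?e02 ?e10 ?e11 ?e20 ?e21 /=. ring.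
Qed.

Lemma gt_char2E (C : comNzRingType) (t : 'I_2 -> C) a b : 
  gt_char t [:: a; b] = \sum_(j <- iota b (a - b).+1) t 0 ^+ j * t 1 ^+ (a + b - j).
Proof.
rewrite /gt_char /gt_patterns big_allpairs_dep big_seq1; apply: eq_bigr => j _.
by rewrite prod2E.
Qed.

Lemma gt_char3E (C : comNzRingType) (t : 'I_3 -> C) a b c : 
  gt_char t [:: a; b; c] =
  \sum_(v <- iota b (a - b).+1) \sum_(w <- iota c (b - c).+1)
   (\sum_(j <- iota w (v - w).+1) t 0 ^+ j * t 1 ^+ (v + w - j)) * t 2 ^+ (a + b + c - (v + w)).
Proof.
rewrite /gt_char /gt_patterns big_allpairs_dep big_allpairs_dep.
apply: eq_bigr => v _; apply: eq_bigr => w _; rewrite mulr_suml.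
apply: eq_bigr => j _; rewrite prod3E /=; congr (_ * _ ^+ (_ - _)).
by rewrite addn0 addnA.
Qed.

Lemma alternant_gt_char2 (C : idomainType) (t : 'I_2 -> C) (mu : {ffun 'I_2 -> nat}) :
  nonincr mu ->
  (t 0 - t 1) * gt_char t (codom mu) = alternant t (staircase mu).
Proof.
move=> /nonincrP H; have le := H 0 1 isT.
have -> : codom mu = [:: mu 0; mu 1].
  by rewrite codomE enum_ordSl enum_ordSl enum_ord0 /=; congr [:: _; mu _]; apply: val_inj.
rewrite gt_char2E geometric_sum; last by lia.
rewrite /alternant det2E !mxE /staircase /=.
set a := mu 0 in le *; set b := mu 1 in le *.
have -> : (b + (a - b).+1 = a.+1)%N by lia.
have -> : ((a + b).+1 - a.+1 = b)%N by lia.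
have -> : ((a + b).+1 - b = a.+1)%N by lia.
by rewrite addn1 addn0; ring.
Qed.

(** Each Vandermonde factor telescopes one of the three nested sums: [x - y] the sum over j, after
    which the sums over v and w separate and are telescoped by [x - z] and [y - z]. *)
Lemma alternant_gt_char3 (C : idomainType) (t : 'I_3 -> C) (mu : {ffun 'I_3 -> nat}) :
  nonincr mu ->
  (t 0 - t 1) * (t 0 - t 2) * (t 1 - t 2) * gt_char t (codom mu) = alternant t (staircase mu).
Proof.
move=> /nonincrP H; have le := H 0 1 isT; have le' := H 1 2 isT.
have -> : codom mu = [:: mu 0; mu 1; mu 2].
  by rewrite codomE !enum_ordSl enum_ord0 /=; congr [:: _; mu _; mu _]; apply: val_inj.
rewrite gt_char3E /alternant det3E !mxE /staircase /=.
set a := mu 0 in le *; set b := mu 1 in le le' *; set c := mu 2 in le' *.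
set x := t 0; set y := t 1; set z := t 2.
have -> : (x - y) * (x - z) * (y - z) *
   (\sum_(v <- iota b (a - b).+1) \sum_(w <- iota c (b - c).+1)
   (\sum_(j <- iota w (v - w).+1) x ^+ j * y ^+ (v + w - j)) * z ^+ (a + b + c - (v + w))) =
   (x - z) * (y - z) * 
    (\sum_(v <- iota b (a - b).+1) \sum_(w <- iota c (b - c).+1)
     (x * (x ^+ v * z ^+ (a - v)) * (y ^+ w * z ^+ (b + c - w)) -
      y * (y ^+ v * z ^+ (a - v)) * (x ^+ w * z ^+ (b + c - w)))).
  rewrite (_ : forall S : C, (x - y) * (x - z) * (y - z) * S = (x - z) * (y - z) * ((x - y) * S));
    last by move=> S; ring.
  congr (_ * _).
  rewrite mulr_sumr; apply: eq_big_seq => v; rewrite mem_iota => /andP[bv va].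
  rewrite mulr_sumr; apply: eq_big_seq => w; rewrite mem_iota => /andP[cw wb].
  rewrite mulrA geometric_sum; last by lia.
  have -> : (w + (v - w).+1 = v.+1)%N by lia.
  have -> : ((v + w).+1 - v.+1 = w)%N by lia.
  have -> : ((v + w).+1 - w = v.+1)%N by lia.
  have -> : (a + b + c - (v + w) = (a - v) + (b + c - w))%N by lia.
  by rewrite !exprS exprD; ring.
have S1 (u : C) : (u - z) * (\sum_(v <- iota b (a - b).+1) u ^+ v * z ^+ (a - v)) =
   u ^+ a.+1 - u ^+ b * z ^+ (a.+1 - b).
  rewrite geometric_sum; last by lia.
  have -> : (b + (a - b).+1 = a.+1)%N by lia.
  by rewrite subnn mulr1.
have S2 (u : C) : (u - z) * (\sum_(w <- iota c (b - c).+1) u ^+ w * z ^+ (b + c - w)) =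
   u ^+ b.+1 * z ^+ c - u ^+ c * z ^+ b.+1.
  rewrite geometric_sum; last by lia.
  have -> : (c + (b - c).+1 = b.+1)%N by lia.
  by congr (_ * _ ^+ _ - _ * _ ^+ _); lia.
have -> : (x - z) * (y - z) * 
    (\sum_(v <- iota b (a - b).+1) \sum_(w <- iota c (b - c).+1)
     (x * (x ^+ v * z ^+ (a - v)) * (y ^+ w * z ^+ (b + c - w)) -
      y * (y ^+ v * z ^+ (a - v)) * (x ^+ w * z ^+ (b + c - w)))) =
   x * (x ^+ a.+1 - x ^+ b * z ^+ (a.+1 - b)) * (y ^+ b.+1 * z ^+ c - y ^+ c * z ^+ b.+1) -
   y * (y ^+ a.+1 - y ^+ b * z ^+ (a.+1 - b)) * (x ^+ b.+1 * z ^+ c - x ^+ c * z ^+ b.+1).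
  rewrite -!S1 -!S2.
  under eq_bigr => v _ do rewrite sumrB -!mulr_sumr.
  rewrite sumrB -!mulr_suml -!mulr_sumr.
  by ring.
(* Exponents are rewritten over [a - b], [b] and [c], so that [ring] sees independent powers. *)
have -> : z ^+ (a.+1 - b) = z ^+ (a - b) * z by rewrite -exprSr; congr (_ ^+ _); lia.
have e u : u ^+ (a + 2) = u ^+ (a - b) * u ^+ b * u * u :> C.
  by rewrite -!exprD -!exprSr; congr (_ ^+ _); lia.
have e' u : u ^+ a.+1 = u ^+ (a - b) * u ^+ b * u :> C.
  by rewrite -!exprD -!exprSr; congr (_ ^+ _); lia.
rewrite !addn1 !addn0 !e !e' !exprSr; ring.
Qed.

Lemma horner_gt_char (C : comNzRingType) g (T : 'I_g -> {poly C}) mu (s : C) :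
  (gt_char T mu).[s] = gt_char (fun i => (T i).[s]) mu.
Proof.
rewrite /gt_char horner_sum; apply: eq_bigr => p _.
by rewrite horner_prod; apply: eq_bigr => i _; rewrite horner_exp.
Qed.

Lemma eq_gt_char (C : comNzRingType) g (t t' : 'I_g -> C) mu :
  t =1 t' -> gt_char t mu = gt_char t' mu.
Proof.
by move=> e; apply: eq_bigr => p _; apply: eq_bigr => i _; rewrite e.
Qed.

(* The bialternant formula only determines the character where the t i are
   distinct, so it is applied to the distinct polynomials t i + X^(i+1) and then
   specialised at X = 0. *)
Theorem gt_char_pieri (C : fieldType) g (t : 'I_g -> C) : g = 2%N \/ g = 3%N ->
  satisfies_pieri t (fun mu => gt_char t (codom mu)).
Proof.
move=> hg; pose T i : {poly C} := (t i)%:P + 'X^(i.+1).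
have T0 i j : i != j -> T i - T j != 0.
  move=> ij; apply/eqP => /(congr1 (fun p : {poly C} => p`_i.+1)).
  rewrite !coefE /= eqxx eqSS (inj_eq val_inj) (negbTE ij) !add0r subr0 => /eqP.
  by rewrite oner_eq0.
have P : satisfies_pieri T (fun mu => gt_char T (codom mu)).
  case: hg => ?; subst g.
    apply: (@pieri_of_alternant _ _ _ _ (T 0 - T 1)); first exact: T0.
    exact: alternant_gt_char2.
  apply: (@pieri_of_alternant _ _ _ _ ((T 0 - T 1) * (T 0 - T 2) * (T 1 - T 2))).
    by rewrite !mulf_neq0 ?T0.
  exact: alternant_gt_char3.
have hT i : (T i).[0] = t i by rewrite /T hornerD hornerC hornerXn expr0n addr0.
have e mu : (gt_char T mu).[0] = gt_char t mu.
  by rewrite horner_gt_char; apply: eq_gt_char.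
move=> x mu Hmu; have /(congr1 (horner_eval 0)) := P x%:P mu Hmu.
rewrite /horner_eval hornerM horner_prod e horner_sum.
have -> : \prod_(i < g) (1 + x%:P * T i).[0] = \prod_j (1 + x * t j).
  by apply: eq_bigr => i _; rewrite hornerD hornerM !hornerC hT.
move->; apply: eq_bigr => S _.
by rewrite hornerM horner_exp hornerC e.
Qed.

Lemma gt_char0 (C : comNzRingType) g (t : 'I_g -> C) : g = 2%N \/ g = 3%N ->
  gt_char t (codom [ffun i : 'I_g => 0%N]) = 1.
Proof.
case=> ?; subst g; rewrite codomE !enum_ordSl enum_ord0 /= !ffunE.
  by rewrite gt_char2E /= big_seq1 mulr1.
by rewrite gt_char3E /= !big_seq1 !mulr1.
Qed.

Lemma transposed_part_codom m g (lam : {ffun 'I_m -> 'I_g.+1}) :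
  transposed_part lam = codom (conj_part lam).
Proof.
apply: (@eq_from_nth _ 0%N); first by rewrite size_mkseq size_codom card_ord.
move=> i; rewrite size_mkseq => hi; rewrite nth_mkseq //.
rewrite codomE (nth_map (Ordinal hi)) ?size_enum_ord // ffunE.
rewrite nth_enum_ord //; apply: eq_card => k; rewrite [RHS]inE.
(* [transposed_part] counts a classical set, [conj_part] a finite set. *)
by apply/idP/idP => h; [move: h; rewrite in_setE | rewrite in_setE].
Qed.

Theorem dual_cauchy_gt (C : fieldType) g (t : 'I_g -> C) m (x : 'I_m -> C) :
  g = 2%N \/ g = 3%N ->
  \prod_(i < m) \prod_(j < g) (1 + x i * t j) =
  \sum_(lam : {ffun 'I_m -> 'I_g.+1} | is_partition lam)
     ssyt_sum (fun i => lam i) x * gt_char t (transposed_part lam).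
Proof.
move=> hg; rewrite (dual_cauchy (gt_char0 t hg) (gt_char_pieri t hg)).
by apply: eq_bigr => lam _; rewrite transposed_part_codom.
Qed.

(** * Counting lattice points by residue *)

(* The multiplicity for U(2), hence the contribution of one row of the patterns. *)
Definition row_mult (K : subgroup_kind) (v w : nat) : nat :=
  match K with
  | KU1 => v == w %[mod 2]
  | KH => v == w %[mod 4]
  | KH'4 => v + w == 0 %[mod 4]
  | KH4 => (v + w == 0 %[mod 4]) * (v == w %[mod 4])
  end.

Definition mult (K : subgroup_kind) (mu : seq nat) : nat :=
  sumn [seq row_mult K v.1 v.2 | v <- gt_rows mu].

Definition interval_sum (F : nat -> nat) (s n : nat) : nat := sumn [seq F i | i <- iota s n].

Lemma interval_sumD F s n n' :
  interval_sum F s (n + n') = (interval_sum F s n + interval_sum F (s + n) n')%N.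
Proof. by rewrite /interval_sum iotaD map_cat sumn_cat. Qed.

Lemma interval_sum_shift F k s n :
  interval_sum F (s + k) n = interval_sum (fun i => F (i + k)%N) s n.
Proof. by rewrite /interval_sum addnC iotaDl -map_comp; congr sumn; apply: eq_map => i /=; rewrite addnC. Qed.

Lemma eq_interval_sum F G s n : F =1 G -> interval_sum F s n = interval_sum G s n.
Proof. by move=> e; congr sumn; apply: eq_map. Qed.

Section Periodic.
Variables (F : nat -> nat).
Hypothesis F4 : forall i, F (i + 4)%N = F i.

Lemma interval_sum_start B s n : interval_sum F (4 * B + s) n = interval_sum F s n.
Proof.
elim: B => [//|B IH]; rewrite -IH (_ : (4 * B.+1 + s = 4 * B + s + 4)%N); last by lia.
by rewrite interval_sum_shift; apply: eq_interval_sum.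
Qed.

Lemma interval_sum_period s : interval_sum F s 4 = interval_sum F 0 4.
Proof.
elim: s => [//|s <-]; rewrite (interval_sumD F s 1 3) (interval_sumD F s.+1 3 1).
rewrite /interval_sum /= !addn0 addn1 addnC; congr (_ + _)%N.
by rewrite addSnnS F4.
Qed.

Lemma interval_sum_long B s n :
  interval_sum F s (4 * B + n) = (B * interval_sum F 0 4 + interval_sum F s n)%N.
Proof.
elim: B s => [//|B IH] s; rewrite (_ : (4 * B.+1 + n = 4 + (4 * B + n))%N); last by lia.
by rewrite interval_sumD interval_sum_period IH -[(s + 4)%N]addnC (interval_sum_start 1) mulSn addnA.
Qed.
End Periodic.

Lemma row_mult_shiftl K v w : row_mult K (v + 4) w = row_mult K v w.
Proof.
case: K => /=; rewrite ?[(v + 4 + w)%N]addnAC ?(modnDr _ 4) //.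
by rewrite (modnMDr 2 v 2) || rewrite -(modnMDl 2 v 2) [(2 * 2 + v)%N]addnC.
Qed.

Lemma row_mult_shiftr K v w : row_mult K v (w + 4) = row_mult K v w.
Proof.
case: K => /=; rewrite ?addnA ?(modnDr _ 4) //.
by rewrite (modnMDr 2 w 2) || rewrite -(modnMDl 2 w 2) [(2 * 2 + w)%N]addnC.
Qed.

Definition rect_sum K b n c k :=
  interval_sum (fun v => interval_sum (fun w => row_mult K v w) c k) b n.

Lemma mult2E K a b : mult K [:: a; b] = row_mult K a b.
Proof. by rewrite /mult /= addn0. Qed.

Lemma mult3E K a b c : mult K [:: a; b; c] = rect_sum K b (a - b).+1 c (b - c).+1.
Proof.
rewrite /mult /gt_rows /rect_sum /interval_sum.
move: (iota b _) (iota c _) => s r.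
elim: s => [//|v s IH]; rewrite allpairs_cons map_cat sumn_cat IH /=; congr (_ + _)%N.
by rewrite -map_comp.
Qed.

(** Cutting the rectangle into 4 by 4 blocks leaves an expression bilinear in the block counts [Z]
    and [B], whose coefficients depend only on residues. The start in v and the length in w share
    [B] because v starts where the range of w ends. *)
Lemma rect_sum_reduce K B b0 Z z0 c b1 :
  rect_sum K (4 * B + b0) (4 * Z + z0) c (4 * B + b1) =
  (Z * (B * rect_sum K 0 4 0 4 + rect_sum K 0 4 c b1) + 
   (B * rect_sum K b0 z0 0 4 + rect_sum K b0 z0 c b1))%N.
Proof.
have D G H m s n : interval_sum (fun v => m * G v + H v)%N s n =
    (m * interval_sum G s n + interval_sum H s n)%N.
  rewrite /interval_sum; elim: (iota s n) => [|v l /= ->]; first by rewrite muln0.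
  by rewrite !mulnDr -!addnA; congr (_ + _)%N; rewrite addnCA.
rewrite /rect_sum.
have per s n v : interval_sum [eta row_mult K (v + 4)] s n = interval_sum [eta row_mult K v] s n.
  by apply: eq_interval_sum => w; exact: row_mult_shiftl.
rewrite interval_sum_start // interval_sum_long //.
have E v : interval_sum (row_mult K v) c (4 * B + b1) =
  (B * interval_sum (row_mult K v) 0 4 + interval_sum (row_mult K v) c b1)%N.
  by rewrite interval_sum_long // => w; exact: row_mult_shiftr.
by rewrite !(eq_interval_sum _ _ E) !D.
Qed.

Lemma lookup_mod T (x0 : T) M m Z z0 B b0 : (size M %| m)%N ->
  lookup x0 M (m * Z + z0) (m * B + b0) = lookup x0 M z0 b0.
Proof.
move=> /dvdnP[d ->]; rewrite /lookup.
by rewrite -!mulnA ![(size M * _)%N]mulnC !mulnA !modnMDl.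
Qed.

Lemma divn4E n : exists Z z0, [/\ n = (4 * Z + z0)%N & (z0 < 4)%N].
Proof.
exists (n %/ 4)%N, (n %% 4)%N; split; last by rewrite ltn_mod.
by rewrite mulnC -divn_eq.
Qed.

(** Reflects the twist by an even power of the determinant, trivial on these groups because zeta has
    determinant -1. *)
Lemma rect_sum_shift2 K b n c k j : K = KH'4 \/ K = KH4 ->
  rect_sum K (b + 2 * j) n (c + 2 * j) k = rect_sum K b n c k.
Proof.
move=> hK; rewrite /rect_sum interval_sum_shift; apply: eq_interval_sum => v.
rewrite interval_sum_shift; apply: eq_interval_sum => w.
have e : (v + 2 * j + (w + 2 * j) = j * 4 + (v + w))%N by lia.
by case: hK => -> /=; rewrite e modnMDl ?eqn_modDr.
Qed.

(** Reflects the twist by any power of the determinant, which is 1 on U(1) and on J. *)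
Lemma rect_sum_shift1 K b n c k j : K = KU1 \/ K = KH ->
  rect_sum K (b + j) n (c + j) k = rect_sum K b n c k.
Proof.
move=> hK; rewrite /rect_sum interval_sum_shift; apply: eq_interval_sum => v.
rewrite interval_sum_shift; apply: eq_interval_sum => w.
by case: hK => -> /=; rewrite eqn_modDr.
Qed.

Section Count.
Variables (z b' : nat) (eps : bool).
Let N K := rect_sum K (b' + eps) z.+1 eps b'.+1.

Lemma rect_sum_KH'4 :
  4 * (N KH'4)%:Z = (z.+1 * b'.+1)%N%:Z + kappa_tab eps z b'.
Proof.
rewrite /N; have [Z [z0 [-> hz]]] := divn4E z; have [B [b0 [-> hb]]] := divn4E b'.
rewrite -[(4 * B + b0 + _)%N]addnA -!addnS rect_sum_reduce /kappa_tab.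
rewrite lookup_mod; last by case: eps.
case: eps; move: z0 b0 hz hb => [|[|[|[|//]]]] [|[|[|[|//]]]] _ _.
(* Sixteen residue pairs for each [eps]: the block sums are numerals, and an identity in [Z], [B]
   and their product remains. *)
all: set t := rect_sum; vm_compute in t; rewrite /t /lookup /=; lia.
Qed.

Lemma rect_sum_KH4 :
  8 * (N KH4)%:Z = (b' * z)%N%:Z + (pair_dot (eta_tab eps z b') (b', z))%:Z + xi_tab eps z b'.
Proof.
rewrite /N; have [Z [z0 [-> hz]]] := divn4E z; have [B [b0 [-> hb]]] := divn4E b'.
rewrite -[(4 * B + b0 + _)%N]addnA -!addnS rect_sum_reduce /xi_tab /eta_tab.
rewrite ![lookup _ _ (4 * Z + z0) (4 * B + b0)]lookup_mod; try by case: eps.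
case: eps; move: z0 b0 hz hb => [|[|[|[|//]]]] [|[|[|[|//]]]] _ _.
all: set t := rect_sum; vm_compute in t; rewrite /t /lookup /pair_dot /=; lia.
Qed.
End Count.

Lemma rect_sum_KU1 z b : rect_sum KU1 b z.+1 0 b.+1 = ((z.+1 * b.+1).+1 %/ 2)%N.
Proof.
have [Z [z0 [-> hz]]] := divn4E z; have [B [b0 [-> hb]]] := divn4E b.
rewrite -!addnS rect_sum_reduce.
move: z0 b0 hz hb => [|[|[|[|//]]]] [|[|[|[|//]]]] _ _.
all: set t := rect_sum; vm_compute in t; rewrite /t /lookup /=; lia.
Qed.

Lemma rect_sum_KH z b :
  2 * (rect_sum KH b z.+1 0 b.+1)%:Z = (rect_sum KU1 b z.+1 0 b.+1)%:Z + tau_tab z b.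
Proof.
have [Z [z0 [-> hz]]] := divn4E z; have [B [b0 [-> hb]]] := divn4E b.
rewrite -!addnS !rect_sum_reduce /tau_tab lookup_mod //.
move: z0 b0 hz hb => [|[|[|[|//]]]] [|[|[|[|//]]]] _ _.
all: set t := rect_sum; vm_compute in t; rewrite /t /lookup /=; lia.
Qed.

Lemma ceil_half (n : nat) : Num.ceil (n%:R / 2 : rat) = (n.+1 %/ 2)%N%:Z.
Proof.
apply: ceil_def; have := divn_eq n.+1 2; have : (n.+1 %% 2 < 2)%N by rewrite ltn_mod.
move: (n.+1 %/ 2)%N (n.+1 %% 2)%N => q r hr e.
have {e} : n%:R = q%:R * 2 + r%:R - 1 :> rat.
  by rewrite -natrM -natrD -e -natr1 addrK.
move=> ->; rewrite intrD rmorphN /= -!pmulrn.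
by case: r hr => [|[|//]] _ /=; lra.
Qed.

Lemma mult_formula2 K (a b k : nat) : (b <= a)%N ->
  let z := (a - b)%N in
  let c := Num.ceil (((z + 1) * (b + 1))%N%:R / 2 : rat) in
  (K = KU1 -> (mult K [:: a + k; b + k; k]%N)%:Z = c) /\
  (K = KH -> (mult K [:: a + k; b + k; k]%N)%:R
                     = 1 / 2 * (c%:~R + (tau_tab z b)%:~R) :> rat).
Proof.
move=> ba z c; have cE : c = (rect_sum KU1 b z.+1 0 b.+1)%:Z.
  by rewrite /c ceil_half rect_sum_KU1 !addn1.
have E : (K = KU1 \/ K = KH) -> mult K [:: a + k; b + k; k]%N = rect_sum K b z.+1 0 b.+1.
  move=> hK; rewrite mult3E -(rect_sum_shift1 b z.+1 0 b.+1 k hK) add0n.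
  by congr rect_sum; rewrite /z; lia.
split=> hK; rewrite E; try (by [left|right]); rewrite hK //.
move/(congr1 (fun i : int => i%:~R : rat)): (rect_sum_KH z b).
by rewrite -cE intrM intrD -!pmulrn => e; lra.
Qed.

Lemma mult_formula3 K (a b k : nat) (eps : bool) : (eps <= b <= a)%N ->
  let z := (a - b)%N in
  let b' := (b - eps)%N in
  let mu := [:: a + 2 * k; b + 2 * k; eps + 2 * k]%N in
  (K = KH'4 -> (mult K mu)%:R
           = (((z + 1) * (b' + 1))%N%:R + (kappa_tab eps z b')%:~R) / 4 :> rat) /\
  (K = KH4 -> (mult K mu)%:R
           = ((b' * z)%N%:R + (pair_dot (eta_tab eps z b') (b', z))%:R
              + (xi_tab eps z b')%:~R) / 8 :> rat).
Proof.
move=> /andP[eb ba] z b' mu.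
have E : (K = KH'4 \/ K = KH4) -> mult K mu = rect_sum K (b' + eps) z.+1 eps b'.+1.
  move=> hK; rewrite /mu mult3E -(rect_sum_shift2 _ z.+1 _ b'.+1 k hK).
  by congr rect_sum; rewrite /z /b'; lia.
split=> hK; rewrite E; try (by [left|right]); rewrite hK.
  move/(congr1 (fun i : int => i%:~R : rat)): (rect_sum_KH'4 z b' eps).
  by rewrite intrM intrD -!pmulrn !addn1 => e; lra.
move/(congr1 (fun i : int => i%:~R : rat)): (rect_sum_KH4 z b' eps).
by rewrite intrM !intrD -!pmulrn => e; lra.
Qed.

(** * Irreducible representations *)

(** The witness is a root of -1 of degree the absolute value of [d]. It is what makes different
    integer weights give different characters. *)
Lemma unit_norm_power_neq1 (C : numClosedFieldType) (d : int) : d != 0 ->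
  exists2 z : C, `|z| = 1 & z ^ d != 1.
Proof.
move=> d0; have d0' : (0 < `|d|)%N by rewrite absz_gt0.
exists (`|d|%N.-root (-1)).
  apply/eqP; rewrite -(@pexpr_eq1 _ _ `|d|%N) ?normr_ge0 // -normrX rootCK //.
  by rewrite normrN1.
have e : (`|d|%N.-root (-1) : C) ^+ `|d|%N = -1 by rewrite rootCK.
have ne : (-1 != 1 :> C) by rewrite eq_sym -subr_eq0 opprK (_ : 1 + 1 = 2%:R) ?pnatr_eq0.
by case: (intP d) d0 e => // n _; rewrite ?abszN absz_nat => e;
  rewrite -?exprnN ?exprz_inv -?exprnP e // invrN1.
Qed.

Section UnitaryFacts.
Variables (C : numClosedFieldType) (g : nat).

Definition is_torus (t : 'rV[C]_g) := forall i, `|t 0 i| = 1.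

Lemma diag_unitary (t : 'rV[C]_g) : is_torus t -> diag_mx t \is unitarymx.
Proof.
move=> ht; apply/unitarymxP/matrixP => i j.
rewrite mul_diag_mx !mxE [j == i]eq_sym; case: (eqVneq i j) => [->|ne].
  by rewrite !mulr1n -normCK ht expr1n.
by rewrite !mulr0n rmorph0 mulr0.
Qed.

Lemma unitary1 : (1%:M : 'M[C]_g) \is unitarymx.
Proof. by apply/unitarymxP; rewrite trmx1 map_mx1 mulmx1. Qed.

Lemma unitaryV (A : 'M[C]_g) : A \is unitarymx -> A ^H *m A = 1%:M.
Proof. by move=> hA; rewrite -(invmx_unitary hA) mulVmx // unitarymx_unit. Qed.

Definition torus_char (k : 'I_g -> int) (t : 'rV[C]_g) : C := \prod_(i < g) t 0 i ^ k i.

Lemma torus_char_neq (k l : 'I_g -> int) : ~ (k =1 l) ->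
  exists2 t, is_torus t & torus_char k t != torus_char l t.
Proof.
move=> ne; have [i hi] : exists i, k i != l i.
  apply/fintype.existsP; rewrite -negb_forall; apply/negP => /forallP H.
  by apply: ne => i; apply/eqP; exact: H.
rewrite -subr_eq0 in hi.
have [z hz nz] := unit_norm_power_neq1 C hi.
have z0 : z != 0 by rewrite -normr_gt0 hz ltr01.
exists (\row_j if j == i then z else 1) => [j|].
  by rewrite mxE; case: ifP; rewrite ?normr1.
have E m : torus_char m (\row_j if j == i then z else 1) = z ^ m i.
  rewrite /torus_char (bigD1 i) //= mxE eqxx big1 ?mulr1 // => j ji.
  by rewrite mxE (negbTE ji) exp1rz.
by apply: contra nz; rewrite !E expfzDr // => /eqP ->; rewrite -expfzDr // subrr expr0z.
Qed.

Lemma torus_char_inj (k l : 'I_g -> int) :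
  (forall t, is_torus t -> torus_char k t = torus_char l t) -> k =1 l.
Proof.
move=> H i; apply/eqP; apply: contraT => /eqP ne.
have [t ht /eqP[]] : exists2 t, is_torus t & torus_char k t != torus_char l t.
  by apply: torus_char_neq => e; apply: ne.
exact: H.
Qed.

End UnitaryFacts.

(** * Representations spanned by an orbit *)

Section OrbitRep.
Variables (C : numClosedFieldType) (g n N : nat).
Variables (Phi : 'M[C]_g -> 'cV[C]_N) (T : 'M[C]_g -> 'M[C]_N).
Variables (sigma : 'M[C]_(n, N)) (iota : 'M[C]_(N, n)).
Variables (wt : 'I_n -> 'I_g -> int) (top : 'I_n).
Let phi X := sigma *m Phi X.
Hypothesis Phi_mul : forall A X, Phi (A *m X) = T A *m Phi X.
Hypothesis Phi_iota : forall X, X \is unitarymx -> Phi X = iota *m phi X.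
Hypothesis phi_free : forall v : 'rV[C]_n,
  (forall X, X \is unitarymx -> v *m phi X = 0) -> v = 0.
Hypothesis phi_weight : forall t X b, is_torus t -> X \is unitarymx ->
  phi (diag_mx t *m X) b 0 = torus_char (wt b) t * phi X b 0.
Hypothesis phi_1 : phi 1%:M = delta_mx top 0.
Hypothesis phi_kernel : forall X Y, X \is unitarymx -> Y \is unitarymx ->
  ((Phi X) ^H *m Phi Y) 0 0 = phi (X ^H *m Y) top 0.
Hypothesis top_unique : forall b, wt b =1 wt top -> b = top.

(** [sigma] reads the standard coordinates off a tensor and [iota] recovers all coordinates from
    them by straightening, so this is the action of [T A] in standard coordinates. *)
Definition orbit_rep (A : 'M[C]_g) : 'M[C]_n := sigma *m T A *m iota.
Let M := orbit_rep.

(** The vectors [phi X] span, so a matrix is determined by its effect on them; the matrix identities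
    below are checked on this orbit. *)
Lemma phi_free_mx k (F : 'M[C]_(k, n)) :
  (forall X, X \is unitarymx -> F *m phi X = 0) -> F = 0.
Proof.
move=> H; apply/row_matrixP => i; rewrite row0; apply: phi_free => X hX.
by rewrite -row_mul H // row0.
Qed.

Lemma orbit_rep_phi A X : X \is unitarymx -> M A *m phi X = phi (A *m X).
Proof. by move=> hX; rewrite /M /orbit_rep -mulmxA -Phi_iota // -mulmxA -Phi_mul. Qed.

Lemma orbit_rep1 : M 1%:M = 1%:M.
Proof.
apply/eqP; rewrite -subr_eq0; apply/eqP/phi_free_mx => X hX.
by rewrite mulmxBl orbit_rep_phi // !mul1mx subrr.
Qed.

Lemma orbit_repM A B : B \is unitarymx -> M (A *m B) = M A *m M B.
Proof.
move=> hB; apply/eqP; rewrite -subr_eq0; apply/eqP/phi_free_mx => X hX.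
rewrite mulmxBl -(mulmxA (M A)) !orbit_rep_phi //; last exact: mul_unitarymx.
by rewrite mulmxA subrr.
Qed.

Lemma orbit_rep_diag t : is_torus t ->
  M (diag_mx t) = diag_mx (\row_b torus_char (wt b) t).
Proof.
move=> ht; apply/eqP; rewrite -subr_eq0; apply/eqP/phi_free_mx => X hX.
rewrite mulmxBl orbit_rep_phi //; apply/matrixP => b j.
by rewrite (ord1 j) [LHS]mxE [X in _ + X]mxE phi_weight // mul_diag_mx !mxE subrr.
Qed.

(** By the kernel hypothesis, row [top] of [M (Y ^H)] is the linear form [(Phi Y) ^H *m iota]. If
    all these forms kill w, then [iota *m w] is orthogonal to every [Phi Y], hence to the image of
    [iota] and to itself. *)
Lemma orbit_rep_top (w : 'cV_n) : (forall A, A \is unitarymx -> (M A *m w) top 0 = 0) -> w = 0.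
Proof.
move=> H.
have K Y : Y \is unitarymx -> row top (M (Y ^H)) = (Phi Y) ^H *m iota.
  move=> hY; apply/eqP; rewrite -subr_eq0; apply/eqP/phi_free_mx => X hX.
  rewrite mulmxBl -row_mul orbit_rep_phi // -mulmxA -Phi_iota //.
  by apply/matrixP => i j; rewrite !ord1 [LHS]mxE [X in _ + X]mxE [X in X - _]mxE phi_kernel // subrr mxE.
have S : (iota *m w) ^H *m iota = 0.
  apply: phi_free_mx => Y hY; rewrite -mulmxA -Phi_iota //.
  have : (Phi Y) ^H *m (iota *m w) = 0.
    rewrite mulmxA -K // -row_mul; apply/matrixP => i j; rewrite !ord1 mxE H ?mxE //.
    by rewrite trmxC_unitary.
  move=> /(congr1 (fun A => A ^H)).
  by rewrite trmx_mul map_mxM trmxCK trmx0 map_mx0.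
have Z : iota *m w = 0.
  have /(congr1 (fun A : 'M[C]_1 => A 0 0)) : (iota *m w) ^H *m (iota *m w) = 0.
    by rewrite mulmxA S mul0mx.
  rewrite !mxE => /eqP; rewrite psumr_eq0 => [/allP H0|k _].
    apply/matrixP => k j; rewrite ord1 [RHS]mxE; apply/eqP.
    have := H0 k (mem_index_enum k).
    by rewrite !mxE mulrC -normCK /= expf_eq0 /= normr_eq0.
  by rewrite !mxE mulrC -normCK exprn_ge0.
have si : sigma *m iota = 1%:M.
  apply/eqP; rewrite -subr_eq0; apply/eqP/phi_free_mx => X hX.
  by rewrite mulmxBl -mulmxA -Phi_iota // mul1mx subrr.
by rewrite -[w]mul1mx -si -mulmxA Z mulmx0.
Qed.

Section Invariant.
Variable W : {vspace 'cV[C]_n}.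
Hypothesis WM : forall A v, A \is unitarymx -> v \in W -> M A *m v \in W.

(** The vector [delta_mx top 0] is [phi 1], so W contains the whole orbit; the matrix of
    [1 - projv W] kills the orbit and is therefore zero. *)
Lemma invariant_full : delta_mx top 0 \in W -> W = fullv.
Proof.
move=> H.
have hphi X : X \is unitarymx -> phi X \in W.
  by move=> hX; rewrite -[X]mulmx1 -orbit_rep_phi ?unitary1 // phi_1 WM.
pose f (v : 'cV[C]_n) := v - projv W v.
pose F : 'M[C]_n := \matrix_(i, j) f (delta_mx j 0) i 0.
have FE v : F *m v = f v.
  have -> : f v = \sum_j v j 0 *: f (delta_mx j 0).
    rewrite {1}(_ : v = \sum_j v j 0 *: delta_mx j 0); last first.
      rewrite [LHS]matrix_sum_delta; apply: eq_bigr => i _.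
      by rewrite big_ord1.
    rewrite /f linear_sum -sumrB; apply: eq_bigr => j _.
    by rewrite linearZ /= -scalerBr.
  apply/matrixP => i k; rewrite (ord1 k) !mxE summxE; apply: eq_bigr => j _.
  by rewrite !mxE mulrC.
have F0 : F = 0.
  apply: phi_free_mx => X hX; rewrite FE /f projv_id ?subrr //; exact: hphi.
apply/vspaceP => v; rewrite memvf.
have /eqP : f v = 0 by rewrite -FE F0 mul0mx.
by rewrite subr_eq0 => /eqP ->; rewrite memv_proj.
Qed.

(** The weight of [top] has multiplicity one, so any other coordinate is cleared by some
    [M (diag_mx t)] minus a scalar, while the top coordinate stays nonzero. *)
Lemma invariant_top (w : 'cV_n) : w \in W -> w top 0 != 0 -> delta_mx top 0 \in W.
Proof.
move=> wW w0.
have step (s : seq 'I_n) : top \notin s ->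
   exists2 v, v \in W & v top 0 != 0 /\ forall b, b \in s -> v b 0 = 0.
  elim: s => [|b s IH]; first by exists w.
  rewrite inE negb_or => /andP[tb ts]; have [v vW [v0 vs]] := IH ts.
  have ne : ~ (wt b =1 wt top) by move=> /top_unique e; move: tb; rewrite e eqxx.
  have [t ht tn] := torus_char_neq C ne.
  exists (M (diag_mx t) *m v - torus_char (wt b) t *: v).
    by rewrite memvB ?memvZ // WM // diag_unitary.
  have E c : (M (diag_mx t) *m v - torus_char (wt b) t *: v) c 0 =
     (torus_char (wt c) t - torus_char (wt b) t) * v c 0.
    by rewrite orbit_rep_diag // mul_diag_mx !mxE mulrBl.
  split=> [|c]; first by rewrite E mulf_neq0 // subr_eq0 eq_sym.
  by rewrite inE E => /orP[/eqP->|/vs->]; rewrite ?subrr ?mul0r ?mulr0.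
have [|v vW [v0 vs]] := step [seq b <- enum 'I_n | b != top].
  by rewrite mem_filter eqxx.
have -> : delta_mx top 0 = (v top 0)^-1 *: v.
  apply/matrixP => b j; rewrite (ord1 j) !mxE andbT.
  case: eqP => [->|/eqP ne]; first by rewrite mulVf.
  have bs : b \in [seq b <- enum 'I_n | b != top] by rewrite mem_filter ne mem_enum.
  by rewrite (vs _ bs) mulr0.
by rewrite memvZ.
Qed.

Lemma orbit_rep_irreducible : W = 0%VS \/ W = fullv.
Proof.
have [->|W0] := eqVneq W 0%VS; [by left | right].
apply: invariant_full; apply: contraNT W0 => ntop; rewrite -subv0.
apply/subvP => w wW; rewrite memv0; apply/eqP/orbit_rep_top => A hA.
apply: contraNeq ntop; exact/invariant_top/WM.
Qed.
End Invariant.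
End OrbitRep.

(** * Tensors and monomials in the columns of a matrix *)

Definition tensor_index (g p q : nat) : finType :=
  ({ffun 'I_p -> 'I_g} * {ffun 'I_q -> 'I_g})%type.

Section Tensor.
Variables (C : numClosedFieldType) (g p q e : nat) (i0 l0 : 'I_g).

Definition tensor_entry (X : 'M[C]_g) (k : tensor_index g p q) : C :=
  (\prod_s X (k.1 s) i0) * (\prod_s (X (k.2 s) l0)^*) * \det X ^+ e.

Definition tensor_vec (X : 'M[C]_g) : 'cV[C]_#|tensor_index g p q| :=
  \col_k tensor_entry X (enum_val k).

(** Matrix of A on the tensor product of p copies of the standard representation, q copies of its
    conjugate, and the determinant to the power e. *)
Definition tensor_mx_entry (A : 'M[C]_g) (k l : tensor_index g p q) : C :=
  (\prod_s A (k.1 s) (l.1 s)) * (\prod_s (A (k.2 s) (l.2 s))^*) * \det A ^+ e.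

Definition tensor_mx (A : 'M[C]_g) : 'M[C]_#|tensor_index g p q| :=
  \matrix_(k, l) tensor_mx_entry A (enum_val k) (enum_val l).

Lemma tensor_entryM A X k :
  tensor_entry (A *m X) k = \sum_l tensor_mx_entry A k l * tensor_entry X l.
Proof.
rewrite /tensor_entry det_mulmx exprMn.
have -> : \prod_s (A *m X) (k.1 s) i0 =
   \sum_(f : {ffun 'I_p -> 'I_g}) (\prod_s A (k.1 s) (f s)) * (\prod_s X (f s) i0).
  under eq_bigr do rewrite mxE.
  by rewrite bigA_distr_bigA; apply: eq_bigr => f _; rewrite big_split.
have -> : \prod_s ((A *m X) (k.2 s) l0)^* =
   \sum_(f : {ffun 'I_q -> 'I_g}) (\prod_s (A (k.2 s) (f s))^*) * (\prod_s (X (f s) l0)^*).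
  under eq_bigr do rewrite mxE rmorph_sum.
  rewrite bigA_distr_bigA; apply: eq_bigr => f _; rewrite -big_split.
  by apply: eq_bigr => s _; rewrite rmorphM.
rewrite big_distrlr /= pair_big mulr_suml; apply: eq_bigr => -[f h] _ /=.
by rewrite /tensor_mx_entry /=; ring.
Qed.

Lemma tensor_vecM A X : tensor_vec (A *m X) = tensor_mx A *m tensor_vec X.
Proof.
apply/matrixP => k j; rewrite !mxE tensor_entryM (reindex_onto enum_val enum_rank) /=.
  by apply: eq_big => [l|l _]; rewrite ?enum_valK ?eqxx // !mxE.
by move=> l _; rewrite enum_rankK.
Qed.

(** The row of [tensor_mx (X ^H)] at the constant words is the conjugate of the tensor of X;
    multiplicativity does the rest. *)
Lemma tensor_kernel X Y :
  ((tensor_vec X) ^H *m tensor_vec Y) 0 0 =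
  tensor_entry (X ^H *m Y) ([ffun=> i0], [ffun=> l0]).
Proof.
rewrite tensor_entryM mxE [RHS](reindex_onto enum_val enum_rank) /=; last first.
  by move=> l _; rewrite enum_rankK.
apply: eq_big => [l|l _]; first by rewrite enum_valK eqxx.
rewrite !mxE; congr (_ * _); rewrite /tensor_entry /tensor_mx_entry !rmorphM rmorphXn !rmorph_prod.
rewrite det_map_mx det_tr; congr (_ * _ * _).
- by apply: eq_bigr => s _; rewrite !mxE ffunE.
- by apply: eq_bigr => s _; rewrite !mxE ffunE.
Qed.

Definition monomial (a b : 'I_g -> nat) (X : 'M[C]_g) : C :=
  (\prod_i X i i0 ^+ a i) * (\prod_i (X i l0)^* ^+ b i) * \det X ^+ e.

Lemma word_of_exponents r (a : 'I_g -> nat) : (\sum_i a i)%N = r ->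
  exists f : {ffun 'I_r -> 'I_g}, forall F : 'I_g -> C, \prod_s F (f s) = \prod_i F i ^+ a i.
Proof.
move=> <-; pose w := flatten [seq nseq (a i) i | i <- enum 'I_g].
have sw : size w = (\sum_i a i)%N.
  rewrite /w size_flatten /shape -map_comp sumnE big_map big_enum /=.
  by apply: eq_bigr => i _; rewrite size_nseq.
exists [ffun s => tnth (in_tuple w) (cast_ord (esym sw) s)] => F.
transitivity (\prod_(i <- w) F i).
  rewrite (big_tnth _ _ w) (reindex (cast_ord (esym sw))) /=; last first.
    by exists (cast_ord sw) => s _; rewrite (cast_ordK, cast_ordKV).
  by apply: eq_bigr => s _; rewrite ffunE.
rewrite /w big_flatten big_map big_enum /=; apply: eq_bigr => i _.
by elim: (a i) => [|n IH]; rewrite ?big_nil ?big_cons // IH exprS.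
Qed.

Lemma monomial_tensor a b : (\sum_i a i)%N = p -> (\sum_i b i)%N = q ->
  exists k, forall X, monomial a b X = tensor_entry X k.
Proof.
move=> /word_of_exponents[f Hf] /word_of_exponents[h Hh].
exists (f, h) => X; rewrite /monomial /tensor_entry /=.
by rewrite (Hf (fun i => X i i0)) (Hh (fun i => (X i l0)^*)).
Qed.

Lemma tensor_monomial k : exists a b, [/\ (\sum_i a i)%N = p, (\sum_i b i)%N = q &
  forall X, tensor_entry X k = monomial a b X].
Proof.
have W r (f : {ffun 'I_r -> 'I_g}) : exists a : 'I_g -> nat, (\sum_i a i)%N = r /\
    forall F : 'I_g -> C, \prod_s F (f s) = \prod_i F i ^+ a i.
  exists (fun i => \sum_(s < r | f s == i) 1)%N; split.
    rewrite -[RHS]card_ord -sum1_card (partition_big f predT) //=.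
  move=> F; rewrite (partition_big f predT) //=; apply: eq_bigr => i _.
  by rewrite sum1_card -prodr_const; apply: eq_bigr => s /eqP ->.
have [a [sa Ha]] := W _ k.1; have [b [sb Hb]] := W _ k.2.
exists a, b; split=> // X; rewrite /monomial /tensor_entry.
by rewrite (Ha (fun i => X i i0)) (Hb (fun i => (X i l0)^*)).
Qed.

(** On the unit circle conjugation is inversion, so the conjugated column contributes negative
    exponents. *)
Lemma monomial_diag a b t (X : 'M[C]_g) : is_torus t ->
  monomial a b (diag_mx t *m X) =
  torus_char (fun i => (a i)%:Z - (b i)%:Z + e%:Z) t * monomial a b X.
Proof.
move=> ht; rewrite /monomial det_mulmx det_diag exprMn.
have -> : torus_char (fun i => (a i)%:Z - (b i)%:Z + e%:Z) t =
  (\prod_i t 0 i ^+ a i) * (\prod_i (t 0 i)^* ^+ b i) * (\prod_i t 0 i) ^+ e.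
  rewrite -prodrXl -!big_split /=; apply: eq_bigr => i _.
  have t0 : t 0 i != 0 by rewrite -normr_gt0 ht ltr01.
  rewrite !expfzDr // -!exprnP; congr (_ * _ * _).
  by rewrite -exprz_inv -exprnP; congr (_ ^+ _); rewrite invC_norm ht expr1n invr1 mul1r.
have -> : \prod_i (diag_mx t *m X) i i0 ^+ a i = (\prod_i t 0 i ^+ a i) * \prod_i X i i0 ^+ a i.
  by rewrite -big_split; apply: eq_bigr => i _; rewrite mul_diag_mx mxE exprMn.
have -> : \prod_i ((diag_mx t *m X) i l0)^* ^+ b i =
   (\prod_i (t 0 i)^* ^+ b i) * \prod_i (X i l0)^* ^+ b i.
  by rewrite -big_split; apply: eq_bigr => i _; rewrite mul_diag_mx mxE rmorphM exprMn.
by ring.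
Qed.

Lemma unitary_relation (X : 'M[C]_g) : X \is unitarymx -> i0 != l0 ->
  \sum_i X i i0 * (X i l0)^* = 0.
Proof.
move=> hX ne; have := congr1 (fun A : 'M[C]_g => A l0 i0) (unitaryV hX).
rewrite !mxE eq_sym (negbTE ne) => H; rewrite -[RHS]H.
by apply: eq_bigr => i _; rewrite !mxE mulrC.
Qed.
End Tensor.

(** The last clause exhibits the entries of [M A] as polynomials in the entries of A and their
    conjugates; the continuity and boundedness needed for integration are read off from it. *)
Definition irrep_data (C : numClosedFieldType) (g n : nat) (M : 'M[C]_g -> 'M[C]_n)
    (wt : 'I_n -> 'I_g -> nat) (top : 'I_n) : Prop :=
  [/\ M 1%:M = 1%:M,
      forall A B, B \is unitarymx -> M (A *m B) = M A *m M B,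
      forall t, is_torus t -> M (diag_mx t) = diag_mx (\row_b \prod_i t 0 i ^+ wt b i),
      forall W : {vspace 'cV[C]_n},
        (forall A v, A \is unitarymx -> v \in W -> M A *m v \in W) ->
        W = 0%VS \/ W = fullv
    & exists p q e, exists (sigma : 'M[C]_(n, _)) (iota : 'M[C]_(_, n)),
        forall A, M A = sigma *m @tensor_mx C g p q e A *m iota].

Section StandardMonomials.
Variables (C : numClosedFieldType) (g p q e n : nat) (i0 l0 : 'I_g).
Variables (alpha beta wt : 'I_n -> 'I_g -> nat) (top : 'I_n).
Let std b X : C := monomial e i0 l0 (alpha b) (beta b) X.
Hypothesis sum_alpha : forall b, (\sum_i alpha b i)%N = p.
Hypothesis sum_beta : forall b, (\sum_i beta b i)%N = q.
Hypothesis straighten : forall a' b' : 'I_g -> nat,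
  (\sum_i a' i)%N = p -> (\sum_i b' i)%N = q ->
  exists r : 'rV[C]_n, forall X, X \is unitarymx ->
    monomial e i0 l0 a' b' X = \sum_b r 0 b * std b X.
Hypothesis std_free : forall v : 'rV[C]_n,
  (forall X, X \is unitarymx -> \sum_b v 0 b * std b X = 0) -> v = 0.
Hypothesis std_1 : forall b, std b 1%:M = (b == top)%:R.
Hypothesis alpha_top : forall i, alpha top i = if i == i0 then p else 0%N.
Hypothesis beta_top : forall i, beta top i = if i == l0 then q else 0%N.
Hypothesis wtE : forall b i, (wt b i + beta b i = alpha b i + e)%N.
Hypothesis top_unique : forall b, wt b =1 wt top -> b = top.

(** The word pair [k b] realises the standard monomial b; [sigma] selects these words, and the rows
    of [iota] are the straightening coefficients. *)
Theorem standard_irrep : exists M : 'M[C]_g -> 'M[C]_n, irrep_data M wt top.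
Proof.
have [k Hk] : exists k : 'I_n -> tensor_index g p q,
   forall b X, std b X = tensor_entry e i0 l0 X (k b).
  have /fin_all_exists[k Hk] : forall b, exists k : tensor_index g p q,
      forall X, std b X = tensor_entry e i0 l0 X k.
    by move=> b; exact: monomial_tensor.
  by exists k.
pose Phi X := @tensor_vec C g p q e i0 l0 X.
pose sigma : 'M[C]_(n, _) := \matrix_(b, l) (l == enum_rank (k b))%:R.
have phiE b X : (sigma *m Phi X) b 0 = std b X.
  rewrite mxE (bigD1 (enum_rank (k b))) //= big1 ?addr0 => [|l ne].
    by rewrite !mxE eqxx mul1r enum_rankK Hk.
  by rewrite !mxE (negbTE ne) mul0r.
have [iota Hi] : exists iota : 'M[C]_(_, n), forall X, X \is unitarymx ->
    Phi X = iota *m (sigma *m Phi X).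
  have /fin_all_exists[r Hr] : forall l : 'I_#|tensor_index g p q|,
     exists r : 'rV[C]_n, forall X, X \is unitarymx ->
        tensor_entry e i0 l0 X (enum_val l) = \sum_b r 0 b * std b X.
    move=> l; have [a' [b' [sa sb H]]] := tensor_monomial C e i0 l0 (enum_val l).
    have [r Hr] := straighten sa sb; exists r => X hX; rewrite H; exact: Hr.
  exists (\matrix_l r l) => X hX; apply/matrixP => l j; rewrite (ord1 j) [LHS]mxE Hr //.
  have E b : (\matrix_l' r l') l b * (sigma *m Phi X) b 0 = r l 0 b * std b X.
    by rewrite phiE !mxE.
  by rewrite [RHS]mxE (eq_bigr _ (fun b _ => E b)).
have phiW t X b : is_torus t -> X \is unitarymx ->
  (sigma *m Phi (diag_mx t *m X)) b 0 =
    torus_char (fun i => (wt b i)%:Z) t * (sigma *m Phi X) b 0.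
  move=> ht _; rewrite !phiE /std monomial_diag //; congr (_ * _).
  by rewrite /torus_char; apply: eq_bigr => i _; congr (_ ^ _); have := wtE b i; lia.
have free (v : 'rV[C]_n) : (forall X, X \is unitarymx -> v *m (sigma *m Phi X) = 0) -> v = 0.
  move=> H; apply: std_free => X hX.
  transitivity ((v *m (sigma *m Phi X)) 0 0); last by rewrite H // mxE.
  by rewrite mxE; apply: eq_bigr => b _; rewrite phiE.
have phi1 : sigma *m Phi 1%:M = delta_mx top 0.
  by apply/matrixP => b j; rewrite (ord1 j) phiE std_1 mxE andbT.
(* The monomial at [top] involves only the entries at [(i0, i0)] and [(l0, l0)] and the determinant,
   so it is the coordinate at the constant words. *)
have ker X Y : X \is unitarymx -> Y \is unitarymx ->
  ((Phi X) ^H *m Phi Y) 0 0 = (sigma *m Phi (X ^H *m Y)) top 0.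
  move=> _ _; rewrite tensor_kernel phiE /std /monomial /tensor_entry.
  congr (_ * _ * _).
    rewrite [RHS](bigD1 i0) //= alpha_top eqxx.
    rewrite [X in _ = _ * X]big1 ?mulr1; last by move=> i ne; rewrite alpha_top (negbTE ne).
    rewrite -[in RHS](card_ord p) -prodr_const.
    by apply: eq_bigr => s _; rewrite ffunE.
  rewrite [RHS](bigD1 l0) //= beta_top eqxx.
  rewrite [X in _ = _ * X]big1 ?mulr1; last by move=> i ne; rewrite beta_top (negbTE ne).
  rewrite -[in RHS](card_ord q) -prodr_const.
  by apply: eq_bigr => s _; rewrite ffunE.
have uniq_top b : (fun i => (wt b i)%:Z) =1 (fun i => (wt top i)%:Z) -> b = top.
  by move=> H; apply: top_unique => i; have [] := H i.
have mul := @tensor_vecM C g p q e i0 l0.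
exists (orbit_rep (@tensor_mx C g p q e) sigma iota); split.
- exact: (orbit_rep1 mul Hi free).
- by move=> A B hB; exact: (orbit_repM mul Hi free).
- by move=> t ht; rewrite (orbit_rep_diag mul Hi free phiW ht).
- by move=> W HW; apply: (orbit_rep_irreducible mul Hi free phiW phi1 ker uniq_top HW).
- by exists p, q, e, sigma, iota.
Qed.
End StandardMonomials.

(** Grouped by exponent, the [c i] are the coefficients of a polynomial with infinitely many roots.
    The freeness proofs use it to separate one parameter at a time. *)
Lemma power_sum_vanish (C : numClosedFieldType) n (c : 'I_n -> C) (d : 'I_n -> nat) :
  (forall x : nat, (0 < x)%N -> \sum_i c i * x%:R ^+ d i = 0) ->
  forall k, \sum_(i | d i == k) c i = 0.
Proof.
move=> H k; pose P : {poly C} := \sum_i c i *: 'X^(d i).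
have P0 : P = 0.
  pose rs : seq C := [seq (i.+1)%:R | i <- iota 0 (size P)].
  apply: (@roots_geq_poly_eq0 _ _ rs); last by rewrite size_map size_iota.
    apply/allP => z /mapP[i _ ->]; apply/rootP; rewrite horner_sum -[RHS](H i.+1) //.
    by apply: eq_bigr => j _; rewrite hornerZ hornerXn.
  rewrite map_inj_uniq ?iota_uniq // => i j /eqP; rewrite eqr_nat => /eqP; lia.
transitivity (P`_k); last by rewrite P0 coef0.
rewrite coef_sum big_mkcond; apply: eq_bigr => i _; rewrite coefZ coefXn eq_sym.
by case: eqP; rewrite ?mulr1 ?mulr0.
Qed.

Definition gt_pattern (mu : seq nat) (b : 'I_(size (gt_patterns mu))) : nat * nat * nat :=
  tnth (in_tuple (gt_patterns mu)) b.

Definition gt_wt (mu : seq nat) g (b : 'I_(size (gt_patterns mu))) (i : 'I_g) : nat :=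
  gt_weight mu (gt_pattern b) i.

Lemma gt_pattern_mem mu (b : 'I_(size (gt_patterns mu))) : gt_pattern b \in gt_patterns mu.
Proof. exact: mem_tnth. Qed.

Lemma gt_patternP mu p : p \in gt_patterns mu ->
  exists b : 'I_(size (gt_patterns mu)), gt_pattern b = p.
Proof. by move=> /seq_tnthP[b ->]; exists b. Qed.

Lemma mem_gt_patterns2 a b v w j : (b <= a)%N ->
  (((v, w), j) \in gt_patterns [:: a; b]) = [&& v == a, w == b & b <= j <= a]%N.
Proof.
move=> ba; apply/allpairsPdep/idP => [[x [y []]]|/and3P[/eqP-> /eqP-> h]].
  by rewrite inE mem_iota => /eqP -> h [-> -> ->]; move: h => /=; lia.
by exists (a, b), j; rewrite inE eqxx mem_iota /=; split=> //; lia.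
Qed.

Lemma mem_gt_patterns3 a b c v w j : (c <= b <= a)%N ->
  (((v, w), j) \in gt_patterns [:: a; b; c]) = [&& b <= v <= a, c <= w <= b & w <= j <= v]%N.
Proof.
move=> cba; apply/allpairsPdep/idP => [[x [y [/allpairsP[[x1 x2] []]]]]|h].
  by rewrite !mem_iota => h1 h2 -> h3 [-> -> ->]; move: h1 h2 h3 => /=; lia.
exists (v, w), j; split=> //; last by rewrite mem_iota /=; lia.
by apply/allpairsP; exists (v, w); split=> //; rewrite mem_iota /=; lia.
Qed.

Lemma gt_patterns_uniq mu : uniq (gt_rows mu) -> uniq (gt_patterns mu).
Proof.
move=> h; apply: allpairs_uniq_dep => // [x _|]; first exact: iota_uniq.
by move=> [x y] [x' y'] _ _ /= [e1 e2]; move: e1 e2; case: x y => ? ? y; case: x' y' => ? ? y' /= [-> ->] ->.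
Qed.

Lemma gt_rows_uniq mu : uniq (gt_rows mu).
Proof.
case: mu => [|a [|b [|c [|? ?]]]] //.
apply: allpairs_uniq; rewrite ?iota_uniq // => -[? ?] [? ?] _ _ /= [-> ->] //.
Qed.

Lemma gt_pattern_inj mu : injective (@gt_pattern mu).
Proof.
move=> b b' e; apply/eqP; rewrite -val_eqE -(@nth_uniq _ ((0, 0), 0)%N (gt_patterns mu)) ?ltn_ord ?gt_patterns_uniq ?gt_rows_uniq //.
by move: e; rewrite /gt_pattern !(tnth_nth ((0, 0), 0)%N) /= => ->.
Qed.

(** * Standard monomials for U(3) *)

Section Rank3.
Variables (C : numClosedFieldType) (a b c : nat).
Hypothesis cba : (c <= b <= a)%N.
Let mu := [:: a; b; c].
Let n := size (gt_patterns mu).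

(* The exponents of u and y attached to the pattern ((v, w), j).  Since the
   subtractions are truncated, one of the exponents of u_0 and y_0 is 0. *)
Definition std_alpha3 (p : nat * nat * nat) (i : 'I_3) : nat :=
  match i : nat with
  | 0 => p.2 - b | 1 => p.1.1 - maxn p.2 b | _ => a - p.1.1 end.

Definition std_beta3 (p : nat * nat * nat) (i : 'I_3) : nat :=
  match i : nat with
  | 0 => b - p.2 | 1 => minn p.2 b - p.1.2 | _ => p.1.2 - c end.

Let std (x : 'I_n) (X : 'M[C]_3) : C :=
  monomial b 0 2 (std_alpha3 (gt_pattern x)) (std_beta3 (gt_pattern x)) X.

Lemma monomial3E e (al be : 'I_3 -> nat) (X : 'M[C]_3) :
  monomial e 0 2 al be X =
  (X 0 0 ^+ al 0 * X 1 0 ^+ al 1 * X 2 0 ^+ al 2) *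
  ((X 0 2)^* ^+ be 0 * (X 1 2)^* ^+ be 1 * (X 2 2)^* ^+ be 2) * \det X ^+ e.
Proof. by rewrite /monomial !prod3E. Qed.

Lemma pattern3P (x : 'I_n) : exists v w j, gt_pattern x = ((v, w), j) /\
   [&& b <= v <= a, c <= w <= b & w <= j <= v]%N.
Proof.
have := gt_pattern_mem x; case: (gt_pattern x) => -[v w] j.
by rewrite mem_gt_patterns3 // => h; exists v, w, j.
Qed.

(** Induction on the exponent of [u_0]: as long as [u_0 y_0] divides the monomial, the relation
    [u . y = 0] trades it for [- u_1 y_1 - u_2 y_2], which lowers both exponents. *)
Lemma straighten3 (a0 a1 a2 b0 b1 b2 : nat) : (a0 + a1 + a2 = a - b)%N ->
  (b0 + b1 + b2 = b - c)%N ->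
  exists r : 'rV[C]_n, forall X, X \is unitarymx ->
   (X 0 0 ^+ a0 * X 1 0 ^+ a1 * X 2 0 ^+ a2) *
   ((X 0 2)^* ^+ b0 * (X 1 2)^* ^+ b1 * (X 2 2)^* ^+ b2) * \det X ^+ b
   = \sum_x r 0 x * std x X.
Proof.
have std_case a0' a1' a2' b0' b1' b2' : a0' = 0%N \/ b0' = 0%N ->
  (a0' + a1' + a2' = a - b)%N -> (b0' + b1' + b2' = b - c)%N ->
  exists r : 'rV[C]_n, forall X, X \is unitarymx ->
   (X 0 0 ^+ a0' * X 1 0 ^+ a1' * X 2 0 ^+ a2') *
   ((X 0 2)^* ^+ b0' * (X 1 2)^* ^+ b1' * (X 2 2)^* ^+ b2') * \det X ^+ b
   = \sum_x r 0 x * std x X.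
  move=> h0 ha hb.
  (* The pattern solves [std_alpha3] and [std_beta3] for v, w and j; as one of [a0'] and [b0'] is 0,
     the single entry [b + a0' - b0'] encodes both. *)
  have [|x ex] := @gt_patternP mu ((a - a2', c + b2'), b + a0' - b0')%N.
    by rewrite mem_gt_patterns3 //; case: h0; lia.
  exists (delta_mx 0 x) => X _.
  rewrite (bigD1 x) //= big1 ?addr0 => [|y ne]; last by rewrite mxE (negbTE ne) mul0r.
  rewrite mxE !eqxx mul1r /std ex monomial3E /std_alpha3 /std_beta3 /=.
  have -> : (b + a0' - b0' - b = a0')%N by case: h0; lia.
  have -> : (a - a2' - maxn (b + a0' - b0') b = a1')%N by case: h0; lia.
  have -> : (a - (a - a2') = a2')%N by case: h0; lia.
  have -> : (b - (b + a0' - b0') = b0')%N by case: h0; lia.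
  have -> : (minn (b + a0' - b0') b - (c + b2') = b1')%N by case: h0; lia.
  by have -> : (c + b2' - c = b2')%N by case: h0; lia.
elim: a0 a1 a2 b0 b1 b2 => [|a0 IH] a1 a2 b0 b1 b2 ha hb; first by apply: std_case => //; left.
case: b0 hb => [|b0] hb; first by apply: std_case => //; right.
have [r1 H1] : exists r : 'rV[C]_n, _ := IH a1.+1 a2 b0 b1.+1 b2 ltac:(lia) ltac:(lia).
have [r2 H2] : exists r : 'rV[C]_n, _ := IH a1 a2.+1 b0 b1 b2.+1 ltac:(lia) ltac:(lia).
exists (- r1 - r2) => X hX.
under eq_bigr do rewrite !mxE mulrDl !mulNr.
rewrite big_split /= !sumrN -H1 // -H2 //.
have := @unitary_relation C 3 0 2 X hX isT; rewrite sum3E => /eqP.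
rewrite -addrA addr_eq0 => /eqP e.
transitivity (X 0 0 * (X 0 2)^* * (X 0 0 ^+ a0 * X 1 0 ^+ a1 * X 2 0 ^+ a2 *
  ((X 0 2)^* ^+ b0 * (X 1 2)^* ^+ b1 * (X 2 2)^* ^+ b2) * \det X ^+ b)).
  by rewrite !exprS; ring.
by rewrite e !exprS; ring.
Qed.

(* Up to the scalars iu, iy the first column is (x, 1, s), the last one is
   (-(1 + s r), x, x r), and the middle one is their cross product.  At this matrix
   the standard monomials become x^(j-c) s^(a-v) r^(w-c) (-(1 + s r))^(b-j), up to a
   common factor, which separates the patterns. *)
Definition frame3 (iu iy x s r : C) : 'M[C]_3 := \matrix_(i, k)
  match (i : nat), (k : nat) with
  | 0, 0 => x * iu | 1, 0 => iu | _, 0 => s * iu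
  | 0, 1 => (x * r - s * x) * (iu * iy)
  | 1, 1 => (- s * (1 + s * r) - x * (x * r)) * (iu * iy)
  | _, 1 => (x * x + (1 + s * r)) * (iu * iy)
  | 0, _ => - (1 + s * r) * iy | 1, _ => x * iy | _, _ => x * r * iy
  end.

Lemma frame3_unitary (iu iy x s r : C) :
  [/\ iu \is Num.real, iy \is Num.real, x \is Num.real, s \is Num.real & r \is Num.real] ->
  iu ^+ 2 * (x ^+ 2 + 1 + s ^+ 2) = 1 ->
  iy ^+ 2 * ((1 + s * r) ^+ 2 + x ^+ 2 + (x * r) ^+ 2) = 1 ->
  frame3 iu iy x s r \is unitarymx.
Proof.
move=> [riu riy rx rs rr] hu hy.
have real i j : frame3 iu iy x s r i j \is Num.real.
  rewrite mxE; case: i => [[|[|[|//]]] ?]; case: j => [[|[|[|//]]] ?] /=;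
  by rewrite ?(rpredM, rpredD, rpredB, rpredN, rpred1).
rewrite -trmxC_unitary; apply/unitarymxP; rewrite trmxCK.
have -> : (frame3 iu iy x s r) ^H = (frame3 iu iy x s r)^T.
  by apply/matrixP => i j; rewrite !mxE conj_Creal //; have := real j i; rewrite mxE.
apply/matrixP => i j; rewrite !mxE sum3E !mxE.
case: i => [[|[|[|//]]] ?]; case: j => [[|[|[|//]]] ?] /=; rewrite ?mulr0n ?mulr1n.
all: try by ring.
- by rewrite -[RHS]hu; ring.
(* The middle column is the cross product of two orthogonal vectors, so its squared norm is the
   product of theirs. *)
- rewrite -[RHS]mulr1 -[X in _ = X * _]hu -[X in _ = _ * X]hy; ring.
- by rewrite -[RHS]hy; ring.
Qed.

Lemma std3_frame (x : 'I_n) (iu iy : C) (t s r : nat) : 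
  iu \is Num.real -> iy \is Num.real ->
  std x (frame3 iu iy t%:R s%:R r%:R) =
  (iu ^+ (a - b) * iy ^+ (b - c) * \det (frame3 iu iy t%:R s%:R r%:R) ^+ b) *
  (t%:R ^+ ((gt_pattern x).2 - c) * s%:R ^+ (a - (gt_pattern x).1.1) *
   r%:R ^+ ((gt_pattern x).1.2 - c) * (- (1 + s%:R * r%:R)) ^+ (b - (gt_pattern x).2)).
Proof.
move=> riu riy; rewrite /std monomial3E.
set D := \det _ ^+ b; rewrite !mxE /=.
rewrite !conj_Creal ?(rpredM, rpredD, rpredN, rpred1, realn) //.
have [v [w [j [-> h]]]] := pattern3P x; rewrite /std_alpha3 /std_beta3 /=.
have -> : (a - b = (j - b) + (v - maxn j b) + (a - v))%N by lia.
have -> : (b - c = (b - j) + (minn j b - w) + (w - c))%N by lia.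
have -> : (j - c = (j - b) + (minn j b - w) + (w - c))%N by lia.
by rewrite !exprMn !exprD; ring.
Qed.

(** At the matrices [frame3] with natural parameters t, s, r a linear relation becomes polynomial.
    Powers of t separate the entries j, then powers of s separate v, and powers of r separate w. *)
Lemma std3_free (v : 'rV[C]_n) :
  (forall X, X \is unitarymx -> \sum_x v 0 x * std x X = 0) -> v = 0.
Proof.
move=> H.
have H1 (t s r : nat) : (0 < t)%N -> \sum_x v 0 x *
   (t%:R ^+ ((gt_pattern x).2 - c) * s%:R ^+ (a - (gt_pattern x).1.1) *
   r%:R ^+ ((gt_pattern x).1.2 - c) * (- (1 + s%:R * r%:R)) ^+ (b - (gt_pattern x).2)) = 0.
  move=> t0.
  (* The squared norms of the first and last columns of [frame3] before scaling. *)
  pose U : nat := (t ^ 2 + 1 + s ^ 2)%N; pose Y : nat := ((1 + s * r) ^ 2 + t ^ 2 + (t * r) ^ 2)%N.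
  have U0 : (0 < U)%N by rewrite /U; lia.
  have Y0 : (0 < Y)%N by rewrite /Y; lia.
  pose iu : C := (sqrtC U%:R)^-1; pose iy : C := (sqrtC Y%:R)^-1.
  have riu : iu \is Num.real by rewrite realV ger0_real // sqrtC_ge0 ler0n.
  have riy : iy \is Num.real by rewrite realV ger0_real // sqrtC_ge0 ler0n.
  have iu2 : iu ^+ 2 * U%:R = 1 by rewrite exprVn sqrtCK mulVf // pnatr_eq0 -lt0n.
  have iy2 : iy ^+ 2 * Y%:R = 1 by rewrite exprVn sqrtCK mulVf // pnatr_eq0 -lt0n.
  have hX : frame3 iu iy t%:R s%:R r%:R \is unitarymx.
    apply: frame3_unitary; first by rewrite riu riy !realn.
      by rewrite -[RHS]iu2 /U !natrD !natrX.
    by rewrite -[RHS]iy2 /Y !natrD !natrX !natrD !natrM.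
  have := H _ hX; under eq_bigr do rewrite std3_frame // mulrCA.
  rewrite -mulr_sumr => /eqP; rewrite mulf_eq0 => /orP[|/eqP//].
  rewrite mulf_eq0 => /orP[|/eqP e].
    have nz (z : C) (k : nat) : z ^+ 2 * k%:R = 1 -> z != 0.
      by move=> e; apply: contra_eq_neq e => ->; rewrite expr0n mul0r eq_sym oner_neq0.
    by rewrite mulf_eq0 !expf_eq0 (negbTE (nz _ _ iu2)) (negbTE (nz _ _ iy2)) !andbF.
  have : \det (frame3 iu iy t%:R s%:R r%:R) != 0.
    by rewrite -unitfE; exact: (unitarymx_unit hX).
  by move=> d0; have := expf_neq0 b d0; rewrite e eqxx.
apply/rowP => y; rewrite [RHS]mxE.
pose d (x : 'I_n) := ((gt_pattern x).2 - c)%N.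
(* With j fixed, the power of [- (1 + s * r)] is common to all terms and nonzero; it is divided out
   before s serves as a variable. *)
have H2 (s r : nat) : \sum_(x | d x == d y) v 0 x * 
   (s%:R ^+ (a - (gt_pattern x).1.1) * r%:R ^+ ((gt_pattern x).1.2 - c)) = 0.
  pose cf (x : 'I_n) := v 0 x * (s%:R ^+ (a - (gt_pattern x).1.1) *
     r%:R ^+ ((gt_pattern x).1.2 - c) * (- (1 + s%:R * r%:R)) ^+ (b - (gt_pattern x).2)).
  have : forall t : nat, (0 < t)%N -> \sum_x cf x * t%:R ^+ d x = 0.
    move=> t t0; rewrite -[RHS](H1 t s r t0); apply: eq_bigr => x _.
    by rewrite /cf /d; ring.
  move=> /power_sum_vanish/(_ (d y)).
  have e x : d x = d y -> (b - (gt_pattern x).2 = b - (gt_pattern y).2)%N.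
    rewrite /d; have [v1 [w1 [j1 [-> h1]]]] := pattern3P x.
    by have [v2 [w2 [j2 [-> h2]]]] := pattern3P y; move=> /=; lia.
  rewrite (eq_bigr (fun x => (- (1 + s%:R * r%:R)) ^+ (b - (gt_pattern y).2) * (v 0 x *
     (s%:R ^+ (a - (gt_pattern x).1.1) * r%:R ^+ ((gt_pattern x).1.2 - c))))); last first.
    by move=> x /eqP ex; rewrite /cf (e x ex); ring.
  rewrite -mulr_sumr => /eqP; rewrite mulf_eq0 => /orP[|/eqP//].
  by rewrite expf_eq0 oppr_eq0 -natrM -[1]/(1%:R) -natrD pnatr_eq0 andbF.
have H3 (r : nat) : \sum_(x | (d x == d y) && (a - (gt_pattern x).1.1 == a - (gt_pattern y).1.1)%N)
   v 0 x * r%:R ^+ ((gt_pattern x).1.2 - c) = 0.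
  have : forall s : nat, (0 < s)%N -> \sum_x
     (if d x == d y then v 0 x * r%:R ^+ ((gt_pattern x).1.2 - c) else 0) * s%:R ^+ (a - (gt_pattern x).1.1) = 0.
    move=> s s0; rewrite -[RHS](H2 s r) [RHS]big_mkcond; apply: eq_bigr => x _.
    by case: ifP => _; ring.
  move=> /power_sum_vanish/(_ (a - (gt_pattern y).1.1)%N) e.
  by rewrite -[RHS]e -big_mkcondr; apply: eq_bigl => x; rewrite andbC.
have : forall r : nat, (0 < r)%N -> \sum_x
     (if (d x == d y) && (a - (gt_pattern x).1.1 == a - (gt_pattern y).1.1)%N then v 0 x else 0)
      * r%:R ^+ ((gt_pattern x).1.2 - c) = 0.
  move=> r r0; rewrite -[RHS](H3 r) [RHS]big_mkcond; apply: eq_bigr => x _.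
  by case: ifP => _; ring.
move=> /power_sum_vanish/(_ ((gt_pattern y).1.2 - c)%N).
rewrite (bigD1 y) //= !eqxx /= big1 ?addr0 // => x /andP[/eqP e1 ne].
case: ifP => // /andP[/eqP e2 /eqP e3]; case/eqP: ne; apply: gt_pattern_inj.
move: e1 e2 e3; rewrite /d; have [v1 [w1 [j1 [-> h1]]]] := pattern3P x.
have [v2 [w2 [j2 [-> h2]]]] := pattern3P y => /= e1 e2 e3.
by congr (_, _, _); lia.
Qed.

Lemma sum3nE (F : 'I_3 -> nat) : (\sum_i F i = F 0%R + F 1%R + F 2%R)%N.
Proof. exact: sum3E. Qed.

Theorem irrep3 : exists (M : 'M[C]_3 -> 'M[C]_n) (top : 'I_n),
  irrep_data M (@gt_wt mu 3) top /\ gt_pattern top = ((a, b), a).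
Proof.
have [|top etop] := @gt_patternP mu ((a, b), a)%N; first by rewrite mem_gt_patterns3 //; lia.
suff [M HM] : exists M : 'M[C]_3 -> 'M[C]_n, irrep_data M (@gt_wt mu 3) top by exists M, top.
apply: (@standard_irrep C 3 (a - b) (b - c) b n 0 2
  (fun x => std_alpha3 (gt_pattern x)) (fun x => std_beta3 (gt_pattern x))).
- move=> x; rewrite sum3nE /std_alpha3 /=.
  by have [v [w [j [-> h]]]] := pattern3P x => /=; lia.
- move=> x; rewrite sum3nE /std_beta3 /=.
  by have [v [w [j [-> h]]]] := pattern3P x => /=; lia.
- move=> al be; rewrite !sum3nE => ha hb.
  have [r Hr] := straighten3 ha hb; exists r => X hX.
  by rewrite monomial3E Hr.
- exact: std3_free.
- move=> x; rewrite monomial3E det1 !mxE /= !mulr0n !mulr1n rmorph0 rmorph1 !expr1n !mul1r !mulr1.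
  rewrite !expr0n -!natrM !mulnb; congr (nat_of_bool _)%:R.
  have -> : (x == top) = (gt_pattern x == ((a, b), a)).
    by rewrite -etop (inj_eq (@gt_pattern_inj mu)).
  rewrite /std_alpha3 /std_beta3 /=.
  have [v [w [j [-> h]]]] := pattern3P x; rewrite !xpair_eqE /=; lia.
- move=> i; rewrite etop /std_alpha3 /=; case: i => [[|[|[|//]]] ?] /=; lia.
- move=> i; rewrite etop /std_beta3 /=; case: i => [[|[|[|//]]] ?] /=; lia.
- move=> x i; rewrite /gt_wt /std_alpha3 /std_beta3.
  have [v [w [j [-> h]]]] := pattern3P x; case: i => [[|[|[|//]]] ?] /=; lia.
(* The weight [(a, b, c)] forces [j = a], hence [v = a], and then [w = b]. *)
- move=> x H; apply: gt_pattern_inj; have := H 0; have := H 1; have := H 2.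
  rewrite /gt_wt etop; have [v [w [j [-> h]]]] := pattern3P x => /= e2 e1 e0.
  by congr (_, _, _); lia.
Qed.
End Rank3.

(** * Standard monomials for U(2) *)

Section Rank2.
Variables (C : numClosedFieldType) (a b : nat).
Hypothesis ba : (b <= a)%N.
Let mu := [:: a; b].
Let n := size (gt_patterns mu).

Definition std_alpha2 (p : nat * nat * nat) (i : 'I_2) : nat :=
  if i == 0 then (p.2 - b)%N else (a - p.2)%N.

Lemma monomial2E e (al : 'I_2 -> nat) (X : 'M[C]_2) :
  monomial e 0 1 al (fun=> 0%N) X = X 0 0 ^+ al 0 * X 1 0 ^+ al 1 * \det X ^+ e.
Proof. by rewrite /monomial !prod2E !expr0 !mulr1. Qed.

Let std (x : 'I_n) (X : 'M[C]_2) : C :=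
  monomial b 0 1 (std_alpha2 (gt_pattern x)) (fun=> 0%N) X.

Lemma pattern2P (x : 'I_n) : exists j, gt_pattern x = ((a, b), j) /\ (b <= j <= a)%N.
Proof.
have := gt_pattern_mem x; case: (gt_pattern x) => -[v w] j.
by rewrite mem_gt_patterns2 // => /and3P[/eqP-> /eqP-> h]; exists j.
Qed.

(** A rotation, once [iu] normalises it, with first column proportional to [(x, 1)]: at this matrix
    the standard monomial of entry j is a common factor times [x ^ (j - b)]. *)
Definition frame2 (iu x : C) : 'M[C]_2 := \matrix_(i, k)
  match (i : nat), (k : nat) with
  | 0, 0 => x * iu | _, 0 => iu | 0, _ => - iu | _, _ => x * iu
  end.

Lemma frame2_unitary (iu x : C) : iu \is Num.real -> x \is Num.real ->
  iu ^+ 2 * (x ^+ 2 + 1) = 1 -> frame2 iu x \is unitarymx.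
Proof.
move=> riu rx hu.
have real i j : frame2 iu x i j \is Num.real.
  rewrite mxE; case: i => [[|[|//]] ?]; case: j => [[|[|//]] ?] /=;
  by rewrite ?(rpredM, rpredN).
apply/unitarymxP; have -> : (frame2 iu x) ^H = (frame2 iu x)^T.
  by apply/matrixP => i j; rewrite !mxE conj_Creal //; have := real j i; rewrite mxE.
apply/matrixP => i j; rewrite !mxE !big_ord_recl big_ord0 !mxE.
case: i => [[|[|//]] ?]; case: j => [[|[|//]] ?] /=; rewrite ?mulr0n ?mulr1n.
all: try by ring.
all: by rewrite -[RHS]hu; ring.
Qed.

Lemma std2_free (v : 'rV[C]_n) :
  (forall X, X \is unitarymx -> \sum_x v 0 x * std x X = 0) -> v = 0.
Proof.
move=> H; apply/rowP => y; rewrite [RHS]mxE.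
have : forall t : nat, (0 < t)%N -> \sum_x v 0 x * t%:R ^+ ((gt_pattern x).2 - b) = 0.
  move=> t t0; pose U : nat := (t ^ 2 + 1)%N.
  pose iu : C := (sqrtC U%:R)^-1.
  have riu : iu \is Num.real by rewrite realV ger0_real // sqrtC_ge0 ler0n.
  have iu2 : iu ^+ 2 * U%:R = 1 by rewrite exprVn sqrtCK mulVf // pnatr_eq0 /U; lia.
  have hX : frame2 iu t%:R \is unitarymx.
    by apply: frame2_unitary; rewrite ?realn // -[RHS]iu2 /U natrD natrX.
  have E x : std x (frame2 iu t%:R) =
     (iu ^+ (a - b) * \det (frame2 iu t%:R) ^+ b) * t%:R ^+ ((gt_pattern x).2 - b).
    rewrite /std monomial2E; set D := \det _ ^+ b; rewrite !mxE /std_alpha2 /=.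
    have [j [-> h]] := pattern2P x => /=.
    have -> : (a - b = (j - b) + (a - j))%N by lia.
    by rewrite exprMn exprD; ring.
  have := H _ hX; under eq_bigr do rewrite E mulrCA.
  rewrite -mulr_sumr => /eqP; rewrite mulf_eq0 => /orP[|/eqP//].
  rewrite mulf_eq0 => /orP[|/eqP e].
    have -> : (iu ^+ (a - b) == 0) = false.
      apply/negbTE/expf_neq0; apply: contra_eq_neq iu2 => ->.
      by rewrite expr0n mul0r eq_sym oner_neq0.
    by [].
  have : \det (frame2 iu t%:R) != 0 by rewrite -unitfE; exact: (unitarymx_unit hX).
  by move=> d0; have := expf_neq0 b d0; rewrite e eqxx.
move=> /power_sum_vanish/(_ ((gt_pattern y).2 - b)%N).
rewrite (bigD1 y) //= big1 ?addr0 // => x /andP[/eqP e1 ne].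
case/eqP: ne; apply: gt_pattern_inj; move: e1.
have [j [-> h]] := pattern2P x; have [j' [-> h']] := pattern2P y => /= e1.
by congr (_, _, _); lia.
Qed.

Lemma sum2nE (F : 'I_2 -> nat) : (\sum_i F i = F 0%R + F 1%R)%N.
Proof. by rewrite !big_ord_recl big_ord0 addn0; congr (_ + F _)%N; apply: val_inj. Qed.

Theorem irrep2 : exists (M : 'M[C]_2 -> 'M[C]_n) (top : 'I_n),
  irrep_data M (@gt_wt mu 2) top /\ gt_pattern top = ((a, b), a).
Proof.
have [|top etop] := @gt_patternP mu ((a, b), a)%N; first by rewrite mem_gt_patterns2 // !eqxx; lia.
suff [M HM] : exists M : 'M[C]_2 -> 'M[C]_n, irrep_data M (@gt_wt mu 2) top by exists M, top.
apply: (@standard_irrep C 2 (a - b) 0 b n 0 1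
  (fun x => std_alpha2 (gt_pattern x)) (fun x => fun=> 0%N)).
- move=> x; rewrite sum2nE /std_alpha2 /=.
  by have [j [-> h]] := pattern2P x => /=; lia.
- by move=> x; rewrite big1.
(* Without conjugated factors there is nothing to straighten: every monomial of the right degree is
   standard. *)
- move=> al be; rewrite !sum2nE => ha hb.
  have [|x ex] := @gt_patternP mu ((a, b), b + al 0%R)%N.
    by rewrite mem_gt_patterns2 // !eqxx; lia.
  exists (delta_mx 0 x) => X _.
  rewrite (bigD1 x) //= big1 ?addr0 => [|y ne]; last by rewrite mxE (negbTE ne) mul0r.
  rewrite mxE !eqxx mul1r ex monomial2E /std_alpha2 /=.
  rewrite /monomial !prod2E.
  have -> : be 0 = 0%N by lia.
  have -> : be 1 = 0%N by lia.
  rewrite !expr0 !mulr1; congr (_ ^+ _ * _ ^+ _ * _); lia.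
- exact: std2_free.
- move=> x; rewrite monomial2E det1 !mxE /= !mulr0n !mulr1n !expr1n !mul1r !mulr1.
  rewrite !expr0n; congr (nat_of_bool _)%:R.
  have -> : (x == top) = (gt_pattern x == ((a, b), a)).
    by rewrite -etop (inj_eq (@gt_pattern_inj mu)).
  rewrite /std_alpha2 /=.
  have [j [-> h]] := pattern2P x; rewrite !xpair_eqE /=; lia.
- move=> i; rewrite etop /std_alpha2 /=; case: i => [[|[|//]] ?] //=; lia.
- by move=> i; case: ifP.
- move=> x i; rewrite /gt_wt /std_alpha2.
  have [j [-> h]] := pattern2P x; case: i => [[|[|//]] ?] /=; lia.
- move=> x H; apply: gt_pattern_inj; have := H 0.
  rewrite /gt_wt etop; have [j [-> h]] := pattern2P x => /= e0.
  by congr (_, _, _); lia.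
Qed.
End Rank2.

(** * Invariants of the subgroups *)

Section RowSums.
Variable C : numClosedFieldType.
Variables (v w : nat).
Hypothesis wv : (w <= v)%N.
Let s := (v + w)%N.
Let r := iota w (v - w).+1.

(* d, a, z and az are the contributions of the pattern with bottom entry j to the
   characters on the cosets of 1, J, zeta and J zeta: their U(1)-averages for the
   diagonal cosets; J and J zeta are conjugate to diag(i, -i, 1), diag(-1, 1, 1). *)
Definition row_avg (K : subgroup_kind) (j : nat) : C :=
  let d := (j == s - j)%N%:R in
  let a := 'i ^+ j * (- 'i) ^+ (s - j) in
  let z := d * ('i ^+ j * 'i ^+ (s - j)) in
  let az := (- 1) ^+ j in
  match K with
  | KU1 => d
  | KH => (d + a) / 2
  | KH'4 => (d + z) / 2
  | KH4 => (d + a + z + az) / 4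
  end.

(** The only possible solution of [j = s - j] is the midpoint, which always lies in the row when s
    is even. *)
Lemma sum_diag (F : nat -> C) :
  \sum_(j <- r) (j == s - j)%N%:R * F j = if odd s then 0 else F s./2.
Proof.
have e j : j \in r -> (j == s - j)%N = (~~ odd s && (j == s./2)).
  by rewrite mem_iota /s => h; lia.
case: ifP => os.
  rewrite big1_seq // => j /andP[_ jr]; by rewrite e // os mul0r.
have h : s./2 \in r by rewrite mem_iota /s; lia.
rewrite (bigD1_seq _ h (iota_uniq _ _)) /= e // os eqxx mul1r big1_seq ?addr0 // => j /andP[ne jr].
by rewrite e // os (negbTE ne) mul0r.
Qed.

Lemma sum_row_diag : \sum_(j <- r) (j == s - j)%N%:R = (~~ odd s)%:R :> C.
Proof.
under eq_bigr do rewrite -[_%:R]mulr1.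
by rewrite (sum_diag (fun=> 1)); case: (odd s).
Qed.

Lemma sum_row_zeta : \sum_(j <- r) (j == s - j)%N%:R * ('i ^+ j * 'i ^+ (s - j)) =
  (~~ odd s)%:R * 'i ^+ s :> C.
Proof.
rewrite sum_diag; case: (boolP (odd s)) => os; rewrite ?mul0r // mul1r -exprD.
by congr (_ ^+ _); lia.
Qed.

Lemma imaginary_sq : 'i * 'i = -1 :> C. Proof. by rewrite -expr2 sqrCi. Qed.

(** A geometric sum in the eigenvalues ['i] and [- 'i] of J, whose difference [2 * 'i] can be
    cancelled. *)
Lemma sum_row_J : \sum_(j <- r) 'i ^+ j * (- 'i) ^+ (s - j) =
  'i ^+ (v - w) * (1 + (-1) ^+ (v - w)) / 2 :> C.
Proof.
have i0 : 2 * 'i != 0 :> C by rewrite mulf_neq0 ?neq0Ci ?pnatr_eq0.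
apply: (mulfI i0).
have -> : 2 * 'i = 'i - (- 'i) :> C by rewrite opprK mulr_natl mulr2n.
rewrite geometric_sum; last by rewrite /s; lia.
have -> : (w + (v - w).+1 = (v - w).+1 + w)%N by lia.
have -> : (s.+1 - ((v - w).+1 + w) = w)%N by rewrite /s; lia.
have -> : (s.+1 - w = (v - w).+1 + w)%N by rewrite /s; lia.
rewrite !exprD -!mulrA -exprMn ['i ^+ w * _]mulrCA -exprMn mulrN imaginary_sq opprK expr1n !mulr1.
by rewrite (exprNn _ (v - w).+1) !exprS; field.
Qed.

Lemma sum_row_zetaJ : \sum_(j <- r) (-1) ^+ j = ((-1) ^+ v + (-1) ^+ w) / 2 :> C.
Proof.
have n2 : -2 != 0 :> C by rewrite oppr_eq0 pnatr_eq0.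
apply: (mulfI n2); rewrite (_ : -2 = (-1) - 1); last by ring.
transitivity ((-1 - 1) * (\sum_(j <- r) (-1) ^+ j * 1 ^+ (s - j)) : C).
  by congr (_ * _); apply: eq_bigr => j _; rewrite expr1n mulr1.
rewrite geometric_sum; last by rewrite /s; lia.
have -> : (w + (v - w).+1 = v.+1)%N by lia.
by rewrite !expr1n exprS; field.
Qed.

Lemma expr_period4 (z : C) m k : z ^+ 4 = 1 -> z ^+ (4 * m + k) = z ^+ k.
Proof. by move=> e; rewrite exprD exprM e expr1n mul1r. Qed.

(** Once the coset sums are in closed form, both sides depend only on w and [v - w] modulo 4, which
    leaves sixteen cases for each group. *)
Lemma sum_row_avg K : \sum_(j <- r) row_avg K j = (row_mult K v w)%:R.
Proof.
have E : \sum_(j <- r) row_avg K j =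
   let d := (~~ odd s)%:R in
   let a := 'i ^+ (v - w) * (1 + (-1) ^+ (v - w)) / 2 in
   let z := (~~ odd s)%:R * 'i ^+ s in
   let az := ((-1) ^+ v + (-1) ^+ w) / 2 in
   match K with KU1 => d | KH => (d + a) / 2 | KH'4 => (d + z) / 2
   | KH4 => (d + a + z + az) / 4 end.
  rewrite /row_avg; case: K => /=.
  - exact: sum_row_diag.
  - by rewrite -mulr_suml big_split /= sum_row_diag sum_row_J.
  - by rewrite -mulr_suml big_split /= sum_row_diag sum_row_zeta.
  - by rewrite -mulr_suml !big_split /= sum_row_diag sum_row_J sum_row_zeta sum_row_zetaJ.
rewrite {}E /s.
have [d ev] : exists d, v = (w + d)%N by exists (v - w)%N; lia.
have -> : (v - w = d)%N by lia.
rewrite ev; have [m [k [-> hk]]] := divn4E d; have [m' [k' [-> hk']]] := divn4E w.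
have -> : (4 * m' + k' + (4 * m + k) + (4 * m' + k') = 4 * (m' + m + m') + (k' + k + k'))%N by lia.
have -> : (4 * m' + k' + (4 * m + k) = 4 * (m' + m) + (k' + k))%N by lia.
have h1 : (-1 : C) ^+ 4 = 1 by rewrite -signr_odd.
have h2 : ('i : C) ^+ 4 = 1 by rewrite (exprM _ 2 2) sqrCi -signr_odd.
rewrite !expr_period4 //.
have -> : row_mult K (4 * (m' + m) + (k' + k)) (4 * m' + k') = row_mult K (k' + k) k'.
  case: K => /=.
  - by congr (nat_of_bool _); lia.
  - by congr (nat_of_bool _); lia.
  - by congr (nat_of_bool _); lia.
  - by congr (nat_of_bool _ * nat_of_bool _)%N; lia.
have -> : odd (4 * (m' + m + m') + (k' + k + k')) = odd (k' + k + k') by lia.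
have i3 : ('i : C) * ('i * 'i) = - 'i by rewrite imaginary_sq mulrN1.
move: k k' hk hk' => [|[|[|[|//]]]] [|[|[|[|//]]]] _ _; case: K => /=;
rewrite ?(exprS, expr0) ?mulr1 ?(mulrN, mulNr, mulr1, mul1r, opprK, imaginary_sq, i3).
all: by rewrite /=; field.
Qed.
End RowSums.

Lemma matrix2_eq (T : Type) (A B : 'M[T]_2) :
  A 0 0 = B 0 0 -> A 0 1 = B 0 1 -> A 1 0 = B 1 0 -> A 1 1 = B 1 1 -> A = B.
Proof.
move=> ? ? ? ?; apply/matrixP => i j.
have h (k : 'I_2) : k = 0 \/ k = 1.
  by case: k => [[|[|//]] ?]; [left|right]; apply: val_inj.
by case: (h i) => ->; case: (h j) => ->.
Qed.

Lemma matrix3_eq (T : Type) (A B : 'M[T]_3) :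
  A 0 0 = B 0 0 -> A 0 1 = B 0 1 -> A 0 2 = B 0 2 ->
  A 1 0 = B 1 0 -> A 1 1 = B 1 1 -> A 1 2 = B 1 2 ->
  A 2 0 = B 2 0 -> A 2 1 = B 2 1 -> A 2 2 = B 2 2 -> A = B.
Proof.
move=> ? ? ? ? ? ? ? ? ?; apply/matrixP => i j.
have h (k : 'I_3) : [\/ k = 0, k = 1 | k = 2].
  by case: k => [[|[|[|//]]] ?]; [apply: Or31|apply: Or32|apply: Or33]; apply: val_inj.
by case: (h i) => ->; case: (h j) => ->.
Qed.

Lemma mulmx2E (C : comNzRingType) (A B : 'M[C]_2) i j :
  (A *m B) i j = A i 0 * B 0 j + A i 1 * B 1 j.
Proof. by rewrite mxE !big_ord_recl big_ord0 addr0; congr (_ + A i _ * B _ j); apply: val_inj. Qed.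

Lemma mulmx3E (C : comNzRingType) (A B : 'M[C]_3) i j :
  (A *m B) i j = A i 0 * B 0 j + A i 1 * B 1 j + A i 2 * B 2 j.
Proof. by rewrite mxE sum3E. Qed.

(** * The generators and their relations *)

Section Generators.
Variables (C : numClosedFieldType) (g : nat).

Definition u1_row (t : C) : 'rV[C]_g :=
  \row_(i < g) if (i == 0 :> nat)%N then t else if (i == 1 :> nat)%N then t^-1 else 1.
Definition u1_mx (t : C) : 'M[C]_g := diag_mx (u1_row t).
Definition j_mx : 'M[C]_g :=
  \matrix_(i < g, j < g)
    if ((i == 0 :> nat) && (j == 1 :> nat))%N then 1
    else if ((i == 1 :> nat) && (j == 0 :> nat))%N then -1
    else ((i == j) && (2 <= i)%N)%:R.
Definition z_row : 'rV[C]_g := \row_(i < g) if (i < 2)%N then 'i else 1.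
Definition z_mx : 'M[C]_g := diag_mx z_row.
Definition jd_row : 'rV[C]_g :=
  \row_(i < g) if (i == 0 :> nat)%N then 'i else if (i == 1 :> nat)%N then - 'i else 1.
(** Unitary matrix of eigenvectors of J, with block columns [(1, i)] and [(1, -i)] over the square
    root of 2. It commutes with zeta, which is scalar on this block, so it diagonalises J and
    [J zeta] simultaneously. *)
Definition jb_mx : 'M[C]_g :=
  \matrix_(i < g, j < g)
    if ((i < 2) && (j < 2))%N then
      (if (i == 0 :> nat)%N then 1 else if (j == 0 :> nat)%N then 'i else - 'i) / sqrtC 2
    else (i == j)%:R.

Lemma u1_torus t : `|t| = 1 -> is_torus (u1_row t).
Proof.
by move=> ht i; rewrite mxE; case: ifP => _ //; case: ifP => _; rewrite ?normr1 // normfV ht invr1.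
Qed.

Lemma z_torus : is_torus z_row.
Proof. by move=> i; rewrite mxE; case: ifP => _; rewrite ?normr1 ?normCi. Qed.

Lemma jd_torus : is_torus jd_row.
Proof.
by move=> i; rewrite mxE; case: ifP => _; [|case: ifP => _]; rewrite ?normrN ?normr1 ?normCi.
Qed.

Lemma z_u1 t : z_mx *m u1_mx t = u1_mx t *m z_mx.
Proof. by rewrite /z_mx /u1_mx diag_mxC. Qed.

Lemma u1_mxM s t : u1_mx s *m u1_mx t = u1_mx (s * t).
Proof.
rewrite /u1_mx mulmx_diag; congr diag_mx; apply/rowP => i; rewrite !mxE.
by case: ifP => _ //; case: ifP => _; rewrite ?mulr1 // invfM mulrC.
Qed.

End Generators.

Ltac entries hg :=
  destruct hg; subst; [apply: matrix2_eq; rewrite ?mulmx2E | apply: matrix3_eq; rewrite ?mulmx3E];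
  rewrite ?mxE /= ?(mulr0n, mulr1n).

Section GeneratorRelations.
Variables (C : numClosedFieldType).
Lemma j_u1 g (hg : g = 2%N \/ g = 3%N) t : j_mx C g *m @u1_mx C g t = @u1_mx C g t^-1 *m j_mx C g.
Proof. entries hg; rewrite ?invrK; try by ring. Qed.

(** Together with [z_sq] and [z_j], this makes J and zeta act as commuting involutions on the
    vectors fixed by U(1). *)
Lemma j_sq g (hg : g = 2%N \/ g = 3%N) : j_mx C g *m j_mx C g = @u1_mx C g (-1).
Proof. entries hg; rewrite ?invrN1; try by ring. Qed.

Lemma z_sq g (hg : g = 2%N \/ g = 3%N) : z_mx C g *m z_mx C g = @u1_mx C g (-1).
Proof. entries hg; rewrite ?invrN1 ?imaginary_sq; try by ring. Qed.

Lemma z_j g (hg : g = 2%N \/ g = 3%N) : z_mx C g *m j_mx C g = j_mx C g *m z_mx C g.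
Proof. entries hg; try by ring. Qed.

Lemma z_jb g (hg : g = 2%N \/ g = 3%N) : z_mx C g *m jb_mx C g = jb_mx C g *m z_mx C g.
Proof. entries hg; try by ring. Qed.

Lemma j_jb g (hg : g = 2%N \/ g = 3%N) : j_mx C g *m jb_mx C g = jb_mx C g *m diag_mx (jd_row C g).
Proof.
have h := imaginary_sq C.
entries hg; try by ring.
all: by transitivity (('i * 'i) / sqrtC 2 : C); [rewrite h; ring | ring].
Qed.

Lemma jb_unitary g (hg : g = 2%N \/ g = 3%N) : jb_mx C g \is unitarymx.
Proof.
have h := imaginary_sq C.
have r2 : (sqrtC 2 : C)^* = sqrtC 2 by rewrite conj_Creal // ger0_real // sqrtC_ge0 ler0n.
have e2 : (sqrtC 2 : C)^-1 * (sqrtC 2)^-1 = 1 / 2 by rewrite -invfM -expr2 sqrtCK mul1r.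
apply/unitarymxP; entries hg; rewrite ?(rmorphM, rmorphN, fmorphV, rmorph1, rmorph0) /= ?conjCi ?r2.
all: rewrite ?mul1r ?mul0r ?mulr0 ?mul1r ?addr0 ?add0r //.
all: try by ring.
all: try by rewrite e2; field.
all: transitivity (- ('i * 'i) * ((sqrtC 2)^-1 / sqrtC 2) * 2 : C); first by ring.
all: by rewrite h e2; field.
Qed.
End GeneratorRelations.

Definition split_row (C : numClosedFieldType) g (x y : C) : 'rV[C]_g :=
  \row_(i < g) if (i == 0 :> nat)%N then x else if (i == 1 :> nat)%N then y else 1.

Lemma z_rowE (C : numClosedFieldType) g : z_row C g = split_row g 'i 'i.
Proof. by apply/rowP => -[[|[|i]] ?]; rewrite !mxE. Qed.

Lemma split_row_torus (C : numClosedFieldType) g (x y : C) :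
  `|x| = 1 -> `|y| = 1 -> is_torus (split_row g x y).
Proof. by move=> hx hy i; rewrite mxE; case: ifP => // _; case: ifP => // _; rewrite normr1. Qed.

(** * The projector onto the invariants and its trace *)

Section Projector.
Variables (C : numClosedFieldType) (g : nat) (mu : seq nat).
Hypothesis hg : g = 2%N \/ g = 3%N.
Hypothesis mu_rows : forall v, v \in gt_rows mu -> (v.2 <= v.1)%N.
Let n := size (gt_patterns mu).
Variables (M : 'M[C]_g -> 'M[C]_n).
Hypothesis M1 : M 1%:M = 1%:M.
Hypothesis MM : forall A B, B \is unitarymx -> M (A *m B) = M A *m M B.
Hypothesis MD : forall t, is_torus t ->
  M (diag_mx t) = diag_mx (\row_b \prod_i t 0 i ^+ @gt_wt mu g b i).

Let w0 (b : 'I_n) := (gt_pattern b).2.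
Let w1 (b : 'I_n) := ((gt_pattern b).1.1 + (gt_pattern b).1.2 - (gt_pattern b).2)%N.

Lemma rep_split_row (x y : C) : `|x| = 1 -> `|y| = 1 ->
  M (diag_mx (split_row g x y)) = diag_mx (\row_b (x ^+ w0 b * y ^+ w1 b)).
Proof.
move=> hx hy; rewrite MD; last exact: split_row_torus.
congr diag_mx; apply/rowP => b; rewrite !mxE.
case: (hg) => eg; move: (b); rewrite {}eg => b'; rewrite ?prod2E ?prod3E !mxE /=.
  by [].
by rewrite expr1n mulr1.
Qed.

Let D0 : 'M[C]_n := diag_mx (\row_b (w0 b == w1 b)%:R).
Let a := M (j_mx C g).
Let z := M (z_mx C g).

Lemma u1_unitary (t : C) : `|t| = 1 -> u1_mx g t \is unitarymx.
Proof. by move=> ht; apply: diag_unitary; exact: u1_torus. Qed.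

Lemma z_unitary : z_mx C g \is unitarymx.
Proof. exact/diag_unitary/z_torus. Qed.

Lemma j_unitary : j_mx C g \is unitarymx.
Proof.
have e : j_mx C g = jb_mx C g *m diag_mx (jd_row C g) *m (jb_mx C g) ^H.
  by rewrite -j_jb // -mulmxA (unitarymxP (jb_unitary C hg)) mulmx1.
rewrite e !mul_unitarymx ?jb_unitary ?trmxC_unitary ?jb_unitary //.
exact/diag_unitary/jd_torus.
Qed.

Lemma rep_u1 (t : C) : `|t| = 1 -> M (u1_mx g t) = diag_mx (\row_b (t ^+ w0 b * t^-1 ^+ w1 b)).
Proof. by move=> ht; rewrite -rep_split_row // normfV ht invr1. Qed.

Lemma u1_weight (t : C) b : `|t| = 1 -> t ^+ w0 b * t^-1 ^+ w1 b = t ^ ((w0 b)%:Z - (w1 b)%:Z).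
Proof.
move=> ht; have t0 : t != 0 by rewrite -normr_gt0 ht ltr01.
by rewrite expfzDr // -exprnP -exprz_inv -exprnP.
Qed.

Lemma u1_zero_weight (t : C) : `|t| = 1 -> M (u1_mx g t) *m D0 = D0.
Proof.
move=> ht; rewrite rep_u1 // mulmx_diag; congr diag_mx; apply/rowP => b; rewrite !mxE u1_weight //.
by case: eqP => [->|_]; rewrite ?mulr0 // subrr expr0z mulr1.
Qed.

(** J inverts U(1), so it carries the U(1)-weight d to -d; an entry joining two weights with nonzero
    sum must vanish. *)
Lemma rep_j_entry_eq0 b c : ((w0 b)%:Z - (w1 b)%:Z + ((w0 c)%:Z - (w1 c)%:Z) != 0) -> a b c = 0.
Proof.
move=> ne; have [t ht tn] := unit_norm_power_neq1 C ne.
have t0 : t != 0 by rewrite -normr_gt0 ht ltr01.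
have ht' : `|t^-1| = 1 by rewrite normfV ht invr1.
have : (M (j_mx C g) *m M (u1_mx g t)) b c = (M (u1_mx g t^-1) *m M (j_mx C g)) b c.
  by rewrite -MM ?u1_unitary // j_u1 // MM // j_unitary.
rewrite !rep_u1 // mul_mx_diag mul_diag_mx mxE [RHS]mxE !mxE !u1_weight // => e.
apply/eqP; apply: contraR tn => an; rewrite -/a in e.
move: e; rewrite [RHS]mulrC => /(mulfI an) e.
by rewrite expfzDr // e exprz_inv -expfzDr // subrr expr0z.
Qed.

Lemma weight_diff_eq0 b : ((w0 b)%:Z - (w1 b)%:Z == 0) = (w0 b == w1 b).
Proof. by rewrite subr_eq0. Qed.

Lemma rep_j_comm : a *m D0 = D0 *m a.
Proof.
apply/matrixP => b c; rewrite mul_mx_diag mul_diag_mx [LHS]mxE [RHS]mxE !mxE.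
have [e|/rep_j_entry_eq0->] := eqVneq ((w0 b)%:Z - (w1 b)%:Z + ((w0 c)%:Z - (w1 c)%:Z)) 0; last first.
  by rewrite mul0r mulr0.
rewrite mulrC; congr (_%:R * _); congr nat_of_bool; rewrite -!weight_diff_eq0.
by move/eqP: e; rewrite addr_eq0 => /eqP->; rewrite oppr_eq0.
Qed.

Lemma rep_zeta_comm : z *m D0 = D0 *m z.
Proof.
have -> : z = diag_mx (\row_b \prod_i (z_row C g) 0 i ^+ @gt_wt mu g b i).
  by rewrite -MD //; exact: z_torus.
exact: diag_mxC.
Qed.

Lemma normN1 : `|(-1 : C)| = 1. Proof. by rewrite normrN1. Qed.

Lemma rep_j_sq : a *m (a *m D0) = D0.
Proof. by rewrite mulmxA -MM ?j_unitary // j_sq // u1_zero_weight ?normN1. Qed.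

Lemma rep_zeta_sq : z *m (z *m D0) = D0.
Proof. by rewrite mulmxA -MM ?z_unitary // z_sq // u1_zero_weight ?normN1. Qed.

Lemma rep_j_zeta_comm : a *m z = z *m a.
Proof. by rewrite -!MM ?z_unitary ?j_unitary // z_j. Qed.

Lemma zero_weight_fix (v : 'cV[C]_n) : (forall t : C, `|t| = 1 -> M (u1_mx g t) *m v = v) -> D0 *m v = v.
Proof.
move=> H; apply/matrixP => b j; rewrite (ord1 j) mul_diag_mx mxE mxE.
case: eqP => [|/eqP ne]; rewrite ?mul1r // mul0r.
rewrite -weight_diff_eq0 in ne; have [t ht tn] := unit_norm_power_neq1 C ne.
have /matrixP/(_ b 0) := H t ht; rewrite rep_u1 // mul_diag_mx mxE mxE u1_weight // => e.
apply/esym/eqP; apply: contraR tn => v0; apply/eqP/(mulIf v0); by rewrite e mul1r.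
Qed.

(** [D0] projects onto the vectors fixed by U(1); each formula averages over the coset
    representatives among [1], [J], [zeta], [J zeta] that belong to the group, applied after
    [D0]. *)
Definition invariant_projector (K : subgroup_kind) : 'M[C]_n :=
  match K with
  | KU1 => D0
  | KH => 2^-1 *: (D0 + a *m D0)
  | KH'4 => 2^-1 *: (D0 + z *m D0)
  | KH4 => 4^-1 *: (D0 + a *m D0 + z *m D0 + a *m (z *m D0))
  end.
Let E := invariant_projector.

Lemma half_sum m k (X : 'M[C]_(m, k)) : 2^-1 *: (X + X) = X.
Proof. by apply/matrixP => i j; rewrite !mxE; field. Qed.

Lemma projector_u1 K t : `|t| = 1 -> M (u1_mx g t) *m E K = E K.
Proof.
move=> ht; have u := u1_zero_weight ht.
have uaD : M (u1_mx g t) *m (a *m D0) = a *m D0 by rewrite rep_j_comm mulmxA u.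
have uzD : M (u1_mx g t) *m (z *m D0) = z *m D0 by rewrite rep_zeta_comm mulmxA u.
have uazD : M (u1_mx g t) *m (a *m (z *m D0)) = a *m (z *m D0).
  by rewrite rep_zeta_comm (mulmxA a) rep_j_comm !mulmxA u.
by case: K; rewrite /E /= -?scalemxAr ?mulmxDr ?u ?uaD ?uzD ?uazD.
Qed.

Lemma projector_j K : (K = KH \/ K = KH4) -> a *m E K = E K.
Proof.
have aazD : a *m (a *m (z *m D0)) = z *m D0.
  by rewrite !mulmxA -(mulmxA a a z) rep_j_zeta_comm (mulmxA a z) rep_j_zeta_comm -!mulmxA rep_j_sq.
case=> ->; rewrite /E /= -scalemxAr !mulmxDr rep_j_sq ?aazD; congr (_ *: _).
  by rewrite addrC.
by rewrite [a *m D0 + D0]addrC -!addrA; congr (_ + (_ + _)); rewrite addrC.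
Qed.

Lemma projector_z K : (K = KH'4 \/ K = KH4) -> z *m E K = E K.
Proof.
have zazD : z *m (a *m (z *m D0)) = a *m D0.
  by rewrite mulmxA -rep_j_zeta_comm -mulmxA rep_zeta_sq.
have zaD : z *m (a *m D0) = a *m (z *m D0) by rewrite mulmxA -rep_j_zeta_comm -mulmxA.
case=> ->; rewrite /E /= -scalemxAr !mulmxDr rep_zeta_sq ?zazD ?zaD; congr (_ *: _).
  by rewrite addrC.
by rewrite -!addrA addrC -!addrA addrCA; congr (_ + _); rewrite addrCA; congr (_ + _); rewrite addrC.
Qed.

Lemma projector_fix K (v : 'cV[C]_n) :
  (forall t : C, `|t| = 1 -> M (u1_mx g t) *m v = v) ->
  (K = KH \/ K = KH4 -> a *m v = v) -> (K = KH'4 \/ K = KH4 -> z *m v = v) -> E K *m v = v.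
Proof.
move=> /zero_weight_fix h0 ha hz; rewrite /E; case: K ha hz => /= ha hz.
- by [].
- by rewrite -scalemxAl mulmxDl -mulmxA h0 ha ?half_sum //; left.
- by rewrite -scalemxAl mulmxDl -mulmxA h0 hz ?half_sum //; left.
rewrite -scalemxAl !mulmxDl -!mulmxA h0 hz; last by right.
rewrite ha; last by right.
by apply/matrixP => i j; rewrite !mxE; field.
Qed.

Lemma sum_patterns (F : nat * nat * nat -> C) :
  \sum_(b < n) F (gt_pattern b) =
  \sum_(v <- gt_rows mu) \sum_(j <- iota v.2 (v.1 - v.2).+1) F (v, j).
Proof. by rewrite -(big_tnth _ _ (gt_patterns mu) predT F) big_allpairs_dep. Qed.

Lemma trace_rep_j_zero_weight : \tr (a *m D0) = \tr a.
Proof.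
apply: eq_bigr => b _; rewrite mul_mx_diag mxE mxE.
case: eqP => [_|/eqP ne]; first by rewrite mulr1.
by rewrite rep_j_entry_eq0 ?mul0r // -mulr2n mulrn_eq0 /= weight_diff_eq0.
Qed.

Lemma trace_rep_j_zeta_zero_weight : \tr (a *m (z *m D0)) = \tr (a *m z).
Proof.
have ez : z = diag_mx (\row_b ('i ^+ w0 b * 'i ^+ w1 b)).
  by rewrite /z /z_mx z_rowE rep_split_row ?normCi.
rewrite ez mulmx_diag; apply: eq_bigr => b _; rewrite !mul_mx_diag !mxE.
case: eqP => [_|/eqP ne]; first by rewrite mulr1.
by rewrite rep_j_entry_eq0 ?mul0r // -mulr2n mulrn_eq0 /= weight_diff_eq0.
Qed.

Lemma trace_conj (B X : 'M[C]_g) : B \is unitarymx -> X \is unitarymx ->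
  \tr (M (B *m X *m B ^H)) = \tr (M X).
Proof.
move=> hB hX; rewrite MM ?trmxC_unitary // MM // mxtrace_mulC mulmxA -MM //.
by rewrite unitaryV // M1 mul1mx.
Qed.

Lemma trace_rep_j : \tr a = \sum_b 'i ^+ w0 b * (- 'i) ^+ w1 b.
Proof.
have e : j_mx C g = jb_mx C g *m diag_mx (jd_row C g) *m (jb_mx C g) ^H.
  by rewrite -j_jb // -mulmxA (unitarymxP (jb_unitary C hg)) mulmx1.
rewrite /a e trace_conj ?jb_unitary //; last exact/diag_unitary/jd_torus.
rewrite (rep_split_row (x := 'i) (y := - 'i)) ?normrN ?normCi // mxtrace_diag.
by apply: eq_bigr => b _; rewrite mxE.
Qed.

Lemma trace_rep_j_zeta : \tr (a *m z) = \sum_b (-1) ^+ w0 b.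
Proof.
have e : j_mx C g *m z_mx C g =
    jb_mx C g *m diag_mx (split_row g (-1) 1) *m (jb_mx C g) ^H.
  have -> : diag_mx (split_row g (-1) 1) = diag_mx (jd_row C g) *m z_mx C g.
    rewrite mulmx_diag; congr diag_mx; apply/rowP => -[[|[|i]] ?]; rewrite !mxE /= ?imaginary_sq ?mulr1 //.
    by rewrite mulNr imaginary_sq opprK.
  rewrite mulmxA -j_jb // -(mulmxA (j_mx C g)) -z_jb // -!mulmxA.
  by rewrite (unitarymxP (jb_unitary C hg)) mulmx1.
rewrite -MM ?z_unitary // e trace_conj ?jb_unitary //; last first.
  by apply/diag_unitary/split_row_torus; rewrite ?normrN1 ?normr1.
rewrite rep_split_row ?normrN1 ?normr1 // mxtrace_diag.
by apply: eq_bigr => b _; rewrite mxE expr1n mulr1.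
Qed.

(** Pattern by pattern, the coset characters add up to [row_avg]; each row then contributes its
    multiplicity for U(2). *)
Lemma trace_projector K : \tr (E K) = (mult K mu)%:R.
Proof.
have ez : z = diag_mx (\row_b ('i ^+ w0 b * 'i ^+ w1 b)).
  by rewrite /z /z_mx z_rowE rep_split_row ?normCi.
have tD : \tr D0 = \sum_b (w0 b == w1 b)%:R.
  by rewrite mxtrace_diag; apply: eq_bigr => b _; rewrite mxE.
have tz : \tr (z *m D0) = \sum_b (w0 b == w1 b)%:R * ('i ^+ w0 b * 'i ^+ w1 b).
  by rewrite ez mulmx_diag mxtrace_diag; apply: eq_bigr => b _; rewrite !mxE mulrC.
transitivity (\sum_(b < n) row_avg C (gt_pattern b).1.1 (gt_pattern b).1.2 K (gt_pattern b).2).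
  rewrite /row_avg /E; case: K => /=.
  - exact: tD.
  - by rewrite mxtraceZ mxtraceD tD trace_rep_j_zero_weight trace_rep_j -big_split /= mulrC mulr_suml.
  - by rewrite mxtraceZ mxtraceD tD tz -big_split /= mulrC mulr_suml.
  - by rewrite mxtraceZ !mxtraceD tD tz trace_rep_j_zero_weight trace_rep_j trace_rep_j_zeta_zero_weight trace_rep_j_zeta
       -!big_split /= mulrC mulr_suml.
rewrite (sum_patterns (fun p => row_avg C p.1.1 p.1.2 K p.2)) /mult sumnE big_map natr_sum.
by apply: eq_big_seq => v /mu_rows h; exact: sum_row_avg.
Qed.
End Projector.

Local Open Scope classical_set_scope.
Local Open Scope ring_scope.

(** * Haar integrals *)

Section BoundedContinuous.
Variables (R : realType) (g : nat).
Local Notation C := (Cx R).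

(** Continuity on the whole matrix space gives Borel measurability, and a bound on unitary matrices
    gives integrability over a subgroup. *)
Definition bounded_continuous (f : 'M[C]_g -> C) :=
  continuous f /\ exists B : C, forall A, A \is unitarymx -> `|f A| <= B.

Lemma bc_cst c : bounded_continuous (fun=> c).
Proof. by split; [exact: cst_continuous | exists `|c|]. Qed.

(** The rows of a unitary matrix have norm 1, which bounds each entry. *)
Lemma bc_coord i j : bounded_continuous (fun A => A i j).
Proof.
split; first exact: coord_continuous.
exists 1 => A /unitarymxP /matrixP/(_ i i); rewrite mxE mxE eqxx mulr1n => e.
have : `|A i j| ^+ 2 <= 1.
  rewrite -e (bigD1 j) //= !mxE -normCK lerDl sumr_ge0 // => k _.
  by rewrite !mxE -normCK exprn_ge0.
by rewrite expr_le1.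
Qed.

Lemma bc_add f h : bounded_continuous f -> bounded_continuous h ->
  bounded_continuous (fun A => f A + h A).
Proof.
move=> [cf [B hB]] [ch [D hD]]; split; first by move=> x; exact: (continuousD (cf x) (ch x)).
by exists (B + D) => A hA; rewrite (le_trans (ler_normD _ _)) // lerD ?hB ?hD.
Qed.

Lemma bc_mul f h : bounded_continuous f -> bounded_continuous h ->
  bounded_continuous (fun A => f A * h A).
Proof.
move=> [cf [B hB]] [ch [D hD]]; split; first by move=> x; exact: (@cvgM C _ (nbhs x) _ f h (f x) (h x) (cf x) (ch x)).
by exists (B * D) => A hA; rewrite normrM ler_pM ?hB ?hD.
Qed.

Lemma conj_continuous : continuous (fun z : C => z^*).
Proof.
move=> z A /nbhs_ballP[e e0 H]; apply/nbhs_ballP; exists e => // t ht; apply: H.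
by move: ht; rewrite /ball /= -rmorphB norm_conjC.
Qed.

Lemma bc_conj f : bounded_continuous f -> bounded_continuous (fun A => (f A)^*).
Proof.
move=> [cf [B hB]]; split; last by exists B => A hA; rewrite norm_conjC hB.
move=> x; apply: (@continuous_comp _ _ _ f (fun z : C => z^*)); first exact: cf.
exact: conj_continuous.
Qed.

Lemma bc_sum (I : Type) (r : seq I) (P : pred I) (f : I -> 'M[C]_g -> C) :
  (forall i, bounded_continuous (f i)) -> bounded_continuous (fun A => \sum_(i <- r | P i) f i A).
Proof.
move=> H; elim: r => [|i r IH].
  by under eq_fun do rewrite big_nil; exact: bc_cst.
under eq_fun do rewrite big_cons; case: (P i) => //; exact: bc_add.
Qed.

Lemma bc_prod (I : Type) (r : seq I) (P : pred I) (f : I -> 'M[C]_g -> C) :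
  (forall i, bounded_continuous (f i)) -> bounded_continuous (fun A => \prod_(i <- r | P i) f i A).
Proof.
move=> H; elim: r => [|i r IH].
  by under eq_fun do rewrite big_nil; exact: bc_cst.
under eq_fun do rewrite big_cons; case: (P i) => //; exact: bc_mul.
Qed.

Lemma bc_exp f n : bounded_continuous f -> bounded_continuous (fun A => f A ^+ n).
Proof.
move=> H; elim: n => [|n IH]; first by under eq_fun do rewrite expr0; exact: bc_cst.
by under eq_fun do rewrite exprS; exact: bc_mul.
Qed.

Lemma bc_det : bounded_continuous (fun A => \det A).
Proof.
rewrite /determinant; apply: bc_sum => s; apply: bc_mul; first exact: bc_cst.
by apply: bc_prod => i; exact: bc_coord.
Qed.

Lemma continuous_near_ball (f : 'M[C]_g -> C) : continuous f -> forall A e, 0 < e ->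
  \forall B \near A, ball (f A) e (f B).
Proof.
move=> cf A e e0.
have q1 : nbhs (f A) (ball (f A) e) by apply/nbhs_ballP; exists e.
have := cf A _ q1; near_simpl; exact.
Qed.

Lemma mx_continuous n (M : 'M[C]_g -> 'M[C]_n) :
  (forall i j, continuous (fun A => M A i j)) -> continuous M.
Proof.
move=> H A S /nbhs_ballP[e e0 HS].
have K0 i j : \forall B \near A, ball (M A i j) e (M B i j).
  by have := @continuous_near_ball (fun A => M A i j) (H i j) A e e0; near_simpl.
have K1 i : \forall B \near A, forall j, ball (M A i j) e (M B i j).
  exact: (@filter_forall _ _ (fun j B => ball (M A i j) e (M B i j)) (nbhs A) _ (K0 i)).
have K2 : \forall B \near A, forall i j, ball (M A i j) e (M B i j).
  exact: (@filter_forall _ _ (fun i B => forall j, ball (M A i j) e (M B i j)) (nbhs A) _ K1).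
suff : \forall B \near A, S (M B) by near_simpl; exact.
by refine (filterS _ K2) => B hB; apply: HS; split.
Qed.

Lemma Re_continuous : continuous (fun z : C => complex.Re z : R).
Proof.
move=> z A /nbhs_ballP[e e0 H]; apply/nbhs_ballP; exists (e%:C)%C => [|t ht].
  by rewrite /= ltcR.
apply: H; move: ht; rewrite /ball /= -raddfB -ltcR => h; apply: le_lt_trans h.
exact: normc_ge_Re.
Qed.

Lemma normc_ge_Im (z : R[i]) : (`|complex.Im z|%:C <= `|z|)%C.
Proof. by case: z => a b; simpc; rewrite -sqrtr_sqr ler_wsqrtr // lerDr sqr_ge0. Qed.

Lemma Im_continuous : continuous (fun z : C => complex.Im z : R).
Proof.
move=> z A /nbhs_ballP[e e0 H]; apply/nbhs_ballP; exists (e%:C)%C => [|t ht].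
  by rewrite /= ltcR.
apply: H; move: ht; rewrite /ball /= -raddfB -ltcR => h; apply: le_lt_trans h.
exact: normc_ge_Im.
Qed.

Lemma continuous_borel_measurable (f : 'M[C]_g -> R) : continuous f ->
  measurable_fun [set: borel_mx R g] (f : borel_mx R g -> R).
Proof.
move=> /continuousP cf; apply: (measurability _ (RGenOpens.measurableE R)).
move=> _ [_ [a [b ->] <-]]; rewrite setTI; apply: sub_sigma_algebra.
exact/cf/interval_open.
Qed.

Lemma mulmx_continuous (h : 'M[C]_g) : continuous (fun A : 'M[C]_g => h *m A).
Proof.
apply: mx_continuous => i j.
have -> : (fun A : 'M[C]_g => (h *m A) i j) = (fun A => \sum_k h i k * A k j).
  by apply/funext => A; rewrite mxE.
have [] // : bounded_continuous (fun A => \sum_k h i k * A k j).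
by apply: bc_sum => k; apply: bc_mul; [exact: bc_cst | exact: bc_coord].
Qed.

Lemma bc_translate h f : h \is unitarymx -> bounded_continuous f ->
  bounded_continuous (fun A => f (h *m A)).
Proof.
move=> hh [cf [B hB]]; split; last by exists B => A hA; apply: hB; exact: mul_unitarymx.
move=> x; apply: (@continuous_comp _ _ _ (fun A : 'M[C]_g => h *m A) f); last exact: cf.
exact: mulmx_continuous.
Qed.

Lemma mulmx_borel_measurable (h : 'M[C]_g) :
  measurable_fun [set: borel_mx R g] (fun A : borel_mx R g => (h *m A : borel_mx R g)).
Proof.
apply: (@measurability _ _ (borel_mx R g) (borel_mx R g) setT (fun A => h *m A) (@open 'M[C]_g) erefl).
move=> _ [U oU <-]; rewrite setTI; apply: sub_sigma_algebra.
by have /continuousP := @mulmx_continuous h; apply.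
Qed.

Section HaarIntegral.
Variables (P : probability (borel_mx R g) R) (H : set 'M[C]_g).
Hypothesis mH : measurable (H : set (borel_mx R g)).
Hypothesis PH : P (H : set (borel_mx R g)) = 1%E.
Hypothesis invP : forall (h : 'M[C]_g) (A : set (borel_mx R g)), H h -> measurable A ->
    P [set h *m a | a in (A : set 'M[C]_g)] = P A.
Hypothesis HU : H `<=` @unitary_group R g.
Hypothesis Hmul : forall h A, H h -> H (h *m A) <-> H A.

Let part_integrable (F : C -> R) (f : 'M[C]_g -> C) : continuous F ->
  (forall z : C, (`|F z|%:C)%C <= `|z|) -> bounded_continuous f ->
  P.-integrable (H : set (borel_mx R g)) (EFin \o (fun A => F (f A))).
Proof.
move=> cF leF [cf [B hB]]; apply: measurable_bounded_integrable => //.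
- by rewrite /= PH ltry.
- apply: measurable_funTS; apply: continuous_borel_measurable => A.
  apply: (@continuous_comp _ _ _ f F); [exact: cf | exact: cF].
(* The order on complex numbers compares real parts, so a complex bound [B] yields the real bound
   [complex.Re B]. *)
exists (complex.Re B); split; first exact: num_real.
move=> M hM A HA /=; apply: ltW; apply: le_lt_trans hM.
have := le_trans (leF (f A)) (hB A (HU HA)).
by case: (B) => x y; rewrite lecE /= => /andP[].
Qed.

Lemma Re_integrable f : bounded_continuous f ->
  P.-integrable (H : set (borel_mx R g)) (EFin \o (fun A => complex.Re (f A))).
Proof. by apply: part_integrable; [exact: Re_continuous | move=> z; exact: normc_ge_Re]. Qed.

Lemma Im_integrable f : bounded_continuous f ->
  P.-integrable (H : set (borel_mx R g)) (EFin \o (fun A => complex.Im (f A))).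
Proof. by apply: part_integrable; [exact: Im_continuous | move=> z; exact: normc_ge_Im]. Qed.

Lemma eq_cintegral f h : (forall A, H A -> f A = h A) -> cintegral P H f = cintegral P H h.
Proof.
by move=> e; rewrite /cintegral; congr Complex; apply: eq_Rintegral => A; rewrite inE => /e ->.
Qed.

Lemma cintegralD f h : bounded_continuous f -> bounded_continuous h ->
  cintegral P H (fun A => f A + h A) = cintegral P H f + cintegral P H h.
Proof.
move=> bf bh; rewrite /cintegral.
transitivity (Complex
  (Rintegral P (H : set (borel_mx R g)) (fun A => complex.Re (f A) + complex.Re (h A)))
  (Rintegral P (H : set (borel_mx R g)) (fun A => complex.Im (f A) + complex.Im (h A)))).
  by congr Complex; apply: eq_Rintegral => A _; rewrite raddfD.
rewrite !RintegralD //; try exact: Re_integrable; try exact: Im_integrable.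
Qed.

Lemma cintegralZ c f : bounded_continuous f ->
  cintegral P H (fun A => c * f A) = c * cintegral P H f.
Proof.
move=> bf; rewrite /cintegral; case: c => a b.
transitivity (Complex
  (Rintegral P (H : set (borel_mx R g)) (fun A => a * complex.Re (f A) - b * complex.Im (f A)))
  (Rintegral P (H : set (borel_mx R g)) (fun A => a * complex.Im (f A) + b * complex.Re (f A)))).
  by congr Complex; apply: eq_Rintegral => A _; case: (f A).
have iZ (u : R) (F : 'M[C]_g -> R) : P.-integrable (H : set (borel_mx R g)) (EFin \o F) ->
    P.-integrable (H : set (borel_mx R g)) (EFin \o (fun A => u * F A)).
  move=> iF; rewrite (_ : _ \o _ = (fun A => u%:E * (EFin \o F) A)%E); first exact: integrableZl.
  by apply/funext => A; rewrite /= EFinM.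
rewrite RintegralB ?RintegralD ?RintegralZl //;
  by [exact: Re_integrable | exact: Im_integrable | apply: iZ; exact: Re_integrable
     | apply: iZ; exact: Im_integrable].
Qed.

Lemma cintegral_cst c : cintegral P H (fun=> c) = c.
Proof.
have cst (u : R) : Rintegral P (H : set (borel_mx R g)) (fun=> u) = u.
  by rewrite Rintegral_cst // [X in fine X](PH : _ = 1%E) mulr1.
by case: c => a b; rewrite /cintegral !cst.
Qed.

Lemma cintegral_sum (I : Type) (r : seq I) (Q : pred I) (f : I -> 'M[C]_g -> C) :
  (forall i, bounded_continuous (f i)) ->
  cintegral P H (fun A => \sum_(i <- r | Q i) f i A) = \sum_(i <- r | Q i) cintegral P H (f i).
Proof.
move=> bf; elim: r => [|i r IH].
  by rewrite big_nil; under eq_fun do rewrite big_nil; rewrite cintegral_cst.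
rewrite big_cons; under eq_fun do rewrite big_cons.
by case: (Q i); rewrite // cintegralD ?IH //; exact: bc_sum.
Qed.

(** Change of variables along left multiplication by h, which preserves both H and, by invariance,
    the measure. *)
Let Rintegral_translate (F : 'M[C]_g -> R) (h : 'M[C]_g) : H h -> continuous F ->
  P.-integrable (H : set (borel_mx R g)) (EFin \o (fun A => F (h *m A))) ->
  Rintegral P (H : set (borel_mx R g)) (fun A => F (h *m A)) =
  Rintegral P (H : set (borel_mx R g)) F.
Proof.
move=> hh cF iF; rewrite /Rintegral; congr fine.
pose phi (A : borel_mx R g) : borel_mx R g := h *m A.
have mphi : measurable_fun setT phi := mulmx_borel_measurable h.
have pre : phi @^-1` H = H :> set (borel_mx R g).
  by apply/seteqP; split=> A /= ; rewrite Hmul.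
have uh : h \in unitmx by apply: unitarymx_unit; exact: HU.
transitivity (\int[pushforward P phi]_(A in (H : set (borel_mx R g))) (F A)%:E)%E.
  rewrite integral_pushforward ?pre //.
  by apply/measurable_EFinP; exact: continuous_borel_measurable.
apply: eq_measure_integral => A mA _; rewrite /pushforward.
have mA' : measurable (phi @^-1` A) by rewrite -[X in measurable X]setTI; exact: mphi.
(* Invariance is stated for images: it is applied to the preimage of A, whose image is A again
   because h is invertible. *)
apply: etrans (esym (invP hh mA')) _; congr (P _); apply/seteqP; split=> [B [B' hB' <-] //|B hB].
by exists (invmx h *m B); rewrite /= /phi ?mulKVmx.
Qed.

Lemma cintegral_translate f h : H h -> bounded_continuous f ->
  cintegral P H (fun A => f (h *m A)) = cintegral P H f.
Proof.
move=> hh bf; have [cf _] := bf; have bfh := bc_translate (HU hh) bf; rewrite /cintegral; congr Complex.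
- apply: (Rintegral_translate (F := fun A => complex.Re (f A)) hh) => [A|]; last exact: Re_integrable.
  by apply: (@continuous_comp _ _ _ f (fun z : C => complex.Re z)); [exact: cf | exact: Re_continuous].
apply: (Rintegral_translate (F := fun A => complex.Im (f A)) hh) => [A|]; last exact: Im_integrable.
by apply: (@continuous_comp _ _ _ f (fun z : C => complex.Im z)); [exact: cf | exact: Im_continuous].
Qed.
End HaarIntegral.
End BoundedContinuous.

Lemma mulmx_delta_col (C : comNzRingType) n (E : 'M[C]_n) (i j : 'I_n) :
  (E *m (delta_mx j 0 : 'cV[C]_n)) i 0 = E i j.
Proof.
rewrite mxE (bigD1 j) //= mxE !eqxx mulr1 big1 ?addr0 // => k kj.
by rewrite mxE (negbTE kj) mulr0.
Qed.

(** A basis of W factors E as [B *m F] with [F *m B] the identity of size [\dim W], and the trace is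
    cyclic. *)
Lemma trace_projection (C : numClosedFieldType) n (E : 'M[C]_n) (W : {vspace 'cV[C]_n}) :
  (forall v : 'cV[C]_n, E *m v \in W) -> (forall w : 'cV[C]_n, w \in W -> E *m w = w) ->
  \tr E = (\dim W)%:R.
Proof.
move=> EW Efix; pose r := \dim W; pose X := vbasis W.
pose B : 'M[C]_(n, r) := \matrix_(i, j) (tnth X j) i 0.
pose F : 'M[C]_(r, n) := \matrix_(i, j) coord X i (E *m delta_mx j 0).
have EF : E = B *m F.
  apply/matrixP => i j; rewrite -[LHS](mulmx_delta_col E i j).
  rewrite {1}(coord_vbasis (EW (delta_mx j 0))) summxE [RHS]mxE; apply: eq_bigr => k _.
  by rewrite !mxE mulrC (tnth_nth 0).
have FB : F *m B = 1%:M.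
  apply/matrixP => i j; rewrite !mxE.
  transitivity (coord X i (E *m tnth X j)).
    rewrite [in RHS](_ : tnth X j = \sum_k (tnth X j) k 0 *: delta_mx k 0); last first.
      rewrite [LHS]matrix_sum_delta; apply: eq_bigr => k _; by rewrite big_ord1.
    rewrite mulmx_sumr linear_sum; apply: eq_bigr => k _ /=.
    by rewrite -scalemxAr linearZ /= !mxE mulrC.
  rewrite Efix; last by rewrite vbasis_mem // mem_tnth.
  by rewrite (tnth_nth 0) coord_free ?(basis_free (vbasisP W)) // eq_sym.
by rewrite EF mxtrace_mulC FB mxtrace1.
Qed.

Definition has_J (K : subgroup_kind) := match K with KH | KH4 => true | _ => false end.
Definition has_zeta (K : subgroup_kind) := match K with KH'4 | KH4 => true | _ => false end.

(** * The subgroups as unions of cosets of U(1) *)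

Section Cosets.
Variables (C : numClosedFieldType) (g : nat).
Hypothesis hg : g = 2%N \/ g = 3%N.

Lemma u1_mx1 : u1_mx g (1 : C) = 1%:M.
Proof.
apply/matrixP => i j; rewrite !mxE invr1; case: (i == j); rewrite ?mulr0n // !mulr1n.
by case: ifP => // _; case: ifP.
Qed.

Lemma u1_mxV (t : C) : `|t| = 1 -> invmx (u1_mx g t) = u1_mx g t^-1.
Proof.
move=> ht; have t0 : t != 0 by rewrite -normr_gt0 ht ltr01.
have hu := unitarymx_unit (u1_unitary g ht).
by rewrite -[RHS](mulKmx hu) u1_mxM mulfV // u1_mx1 mulmx1.
Qed.

Definition coset_rep (e f : bool) : 'M[C]_g :=
  (if e then j_mx C g else 1%:M) *m (if f then z_mx C g else 1%:M).

Definition in_cosets K (A : 'M[C]_g) :=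
  exists e f t, [/\ e ==> has_J K, f ==> has_zeta K, `|t| = 1 & A = coset_rep e f *m u1_mx g t].

(** Moving an element of U(1) to the right past J inverts it, and past zeta leaves it unchanged. *)
Lemma coset_u1 K (s : C) A : `|s| = 1 -> in_cosets K A -> in_cosets K (u1_mx g s *m A).
Proof.
move=> hs [e [f [t [he hf ht ->]]]].
have hV : `|s^-1| = 1 by rewrite normfV hs invr1.
exists e, f, ((if e then s^-1 else s) * t); split=> //.
  by rewrite normrM ht mulr1; case: (e).
rewrite -u1_mxM !mulmxA; congr (_ *m _); rewrite /coset_rep.
have comm (u : C) : u1_mx g u *m (if f then z_mx C g else 1%:M) =
    (if f then z_mx C g else 1%:M) *m u1_mx g u.
  by case: (f); rewrite ?z_u1 // mulmx1 mul1mx.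
rewrite -[RHS]mulmxA -comm !mulmxA; congr (_ *m _).
by case: (e); rewrite ?mulmx1 ?mul1mx // j_u1 // invrK.
Qed.

Lemma coset_j K A : has_J K -> in_cosets K A -> in_cosets K (j_mx C g *m A).
Proof.
move=> hJ [[] [f [t [he hf ht ->]]]].
  have -> : j_mx C g *m (coset_rep true f *m u1_mx g t) =
     u1_mx g (-1) *m (coset_rep false f *m u1_mx g t).
    by rewrite /coset_rep /= mul1mx !mulmxA j_sq.
  by apply: coset_u1; rewrite ?normrN1 //; exists false, f, t.
by exists true, f, t; split=> //; rewrite /coset_rep /= mul1mx !mulmxA.
Qed.

Lemma coset_zeta K A : has_zeta K -> in_cosets K A -> in_cosets K (z_mx C g *m A).
Proof.
move=> hZ [e [f [t [he hf ht ->]]]].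
have comm : z_mx C g *m (if e then j_mx C g else 1%:M) =
    (if e then j_mx C g else 1%:M) *m z_mx C g.
  by case: (e); rewrite ?z_j // mulmx1 mul1mx.
case: f hf => hf.
  have -> : z_mx C g *m (coset_rep e true *m u1_mx g t) =
     coset_rep e false *m u1_mx g (-1) *m u1_mx g t.
    by rewrite /coset_rep /= mulmx1 !mulmxA comm -(mulmxA _ (z_mx C g) (z_mx C g)) z_sq.
  rewrite -mulmxA u1_mxM; exists e, false, (-1 * t); split=> //.
  by rewrite normrM normrN1 ht mulr1.
exists e, true, t; split=> //; by rewrite /coset_rep /= mulmx1 !mulmxA comm.
Qed.

Lemma invmx_square (A : 'M[C]_g) : A \is unitarymx -> A *m A = u1_mx g (-1) ->
  invmx A = A *m u1_mx g (-1).
Proof.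
move=> hA e; rewrite -[RHS](mulKmx (unitarymx_unit hA)) (mulmxA A A) e u1_mxM mulrNN mulr1.
by rewrite u1_mx1 mulmx1.
Qed.

Lemma coset_1 K : in_cosets K 1%:M.
Proof.
exists false, false, 1; split=> //; first by rewrite normr1.
by rewrite /coset_rep /= !mul1mx u1_mx1.
Qed.

(** Membership in the cosets is not visibly closed under products and inverses. Stability of the
    cosets under left multiplication by A and its inverse is, and membership follows by taking B to
    be 1. *)
Definition coset_stable K (A : 'M[C]_g) :=
  A \is unitarymx /\ forall B, (in_cosets K B -> in_cosets K (A *m B)) /\
   (in_cosets K B -> in_cosets K (invmx A *m B)).

Lemma coset_stable_u1 K (t : C) : `|t| = 1 -> coset_stable K (u1_mx g t).
Proof.
move=> ht; split; first exact: u1_unitary.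
move=> B; split=> hB; first exact: coset_u1.
by rewrite u1_mxV //; apply: coset_u1; rewrite // normfV ht invr1.
Qed.

Lemma coset_stable_j K : has_J K -> coset_stable K (j_mx C g).
Proof.
have n1 : `|-1 : C| = 1 by rewrite normrN1.
move=> hJ; split; first exact: j_unitary.
move=> B; split=> hB; first exact: coset_j.
rewrite invmx_square ?j_unitary ?j_sq // -mulmxA; apply: coset_j => //; exact: coset_u1.
Qed.

Lemma coset_stable_zeta K : has_zeta K -> coset_stable K (z_mx C g).
Proof.
have n1 : `|-1 : C| = 1 by rewrite normrN1.
move=> hZ; split; first exact: z_unitary.
move=> B; split=> hB; first exact: coset_zeta.
rewrite invmx_square ?z_unitary ?z_sq // -mulmxA; apply: coset_zeta => //; exact: coset_u1.
Qed.

Lemma coset_stable1 K : coset_stable K 1%:M.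
Proof. by split; [exact: unitary1 | move=> B; rewrite invmx1 mul1mx]. Qed.

Lemma coset_stableM K A B : coset_stable K A -> coset_stable K B -> coset_stable K (A *m B).
Proof.
move=> [uA hA] [uB hB]; split; first exact: mul_unitarymx.
move=> D; split=> hD; first by rewrite -mulmxA; apply/(hA _).1/(hB _).1.
rewrite invmx_unitary ?mul_unitarymx // trmx_mul map_mxM -mulmxA.
by rewrite -!invmx_unitary //; apply/(hB _).2/(hA _).2.
Qed.

Lemma coset_stableV K A : coset_stable K A -> coset_stable K (invmx A).
Proof.
move=> [uA hA]; split; first by rewrite invmx_unitary // trmxC_unitary.
by move=> B; rewrite invmxK; split; [exact: (hA B).2 | exact: (hA B).1].
Qed.

Lemma unitary_inv (A : 'M[C]_g) : A \is unitarymx -> invmx A \is unitarymx.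
Proof. by move=> hA; rewrite invmx_unitary // trmxC_unitary. Qed.
End Cosets.

Section Subgroups.
Variables (R : realType).
Local Notation C := (Cx R).

(** A single induction principle for the four kinds, although [KU1] is not defined through
    generators. *)
Lemma subgroup_ind g K (Q : 'M[C]_g -> Prop) :
  (forall t : C, `|t| = 1 -> Q (u1_mx g t)) ->
  (has_J K -> Q (j_mx C g)) -> (has_zeta K -> Q (z_mx C g)) ->
  Q 1%:M -> (forall A B, Q A -> Q B -> Q (A *m B)) -> (forall A, Q A -> Q (invmx A)) ->
  forall A, @subgroup_of R g K A -> Q A.
Proof.
move=> hu hj hz h1 hm hi A; case: K hj hz => /= hj hz.
- by case=> t ht ->; exact: hu.
- elim=> {A} [A []|||] //; [by case=> t ht ->; exact: hu | by move=> ->; exact: hj | | ]; by [move=> *; exact: hm | move=> *; exact: hi].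
- elim=> {A} [A []|||] //; [by case=> t ht ->; exact: hu | by move=> ->; exact: hz | | ]; by [move=> *; exact: hm | move=> *; exact: hi].
elim=> {A} [A [[]|]|||] //; [by case=> t ht ->; exact: hu | by move=> ->; exact: hj | by move=> ->; exact: hz | | ]; by [move=> *; exact: hm | move=> *; exact: hi].
Qed.

Variables (g : nat).
Hypothesis hg : g = 2%N \/ g = 3%N.

Lemma subgroup_u1 K (t : C) : `|t| = 1 -> @subgroup_of R g K (u1_mx g t).
Proof.
by move=> ht; case: K => /=; [ | apply: generated_in; left | apply: generated_in; left
  | apply: generated_in; left; left]; exists t.
Qed.

Lemma subgroup_j K : has_J K -> @subgroup_of R g K (j_mx C g).
Proof. by case: K => //= _; apply: generated_in; [right | left; right]. Qed.

Lemma subgroup_zeta K : has_zeta K -> @subgroup_of R g K (z_mx C g).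
Proof. by case: K => //= _; apply: generated_in; right. Qed.

Lemma subgroup_unitary K A : @subgroup_of R g K A -> A \is unitarymx.
Proof.
elim/(@subgroup_ind g K) => [t ht|_|_||{}A B|{}A].
- exact: u1_unitary.
- exact: j_unitary.
- exact: z_unitary.
- exact: unitary1.
- exact: mul_unitarymx.
exact: unitary_inv.
Qed.

Lemma subgroup_mul K A B : @subgroup_of R g K A -> @subgroup_of R g K B ->
  @subgroup_of R g K (A *m B).
Proof.
case: K => /=; [|exact: generated_mul|exact: generated_mul|exact: generated_mul].
move=> [s hs ->] [t ht ->]; exists (s * t); first by rewrite normrM hs ht mulr1.
exact: u1_mxM.
Qed.

Lemma subgroup_inv K A : @subgroup_of R g K A -> @subgroup_of R g K (invmx A).
Proof.
case: K => /=; [|exact: generated_inv|exact: generated_inv|exact: generated_inv].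
move=> [t ht ->]; exists t^-1; first by rewrite normfV ht invr1.
exact: u1_mxV.
Qed.

Lemma subgroup_mulE K h A : @subgroup_of R g K h ->
  @subgroup_of R g K (h *m A) <-> @subgroup_of R g K A.
Proof.
move=> hh; split=> [hA|]; last exact: subgroup_mul.
by rewrite -[A](mulKmx (unitarymx_unit (subgroup_unitary hh))); apply: subgroup_mul => //; exact: subgroup_inv.
Qed.

Lemma subgroup_cosets K A : @subgroup_of R g K A <-> @in_cosets C g K A.
Proof.
split; last first.
  move=> [e [f [t [he hf ht ->]]]].
  have s1 : @subgroup_of R g K 1%:M by rewrite -u1_mx1; apply: subgroup_u1; rewrite normr1.
  apply: subgroup_mul; last exact: subgroup_u1.
  apply: subgroup_mul.
    by case: e he => //= he; exact: subgroup_j.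
  by case: f hf => //= hf; exact: subgroup_zeta.
move=> hA; have [_ /(_ 1%:M)[+ _]] : @coset_stable C g K A.
  move: A hA; apply: subgroup_ind.
  - exact: coset_stable_u1.
  - exact: coset_stable_j.
  - exact: coset_stable_zeta.
  - exact: coset_stable1.
  - exact: coset_stableM.
  - exact: coset_stableV.
by rewrite mulmx1; apply; exact: coset_1.
Qed.
End Subgroups.

Lemma gt_rows_le mu : sorted geq mu -> forall v, v \in gt_rows mu -> (v.2 <= v.1)%N.
Proof.
case: mu => [|a [|b [|c [|d mu]]]] //.
  by rewrite /= andbT => ba v; rewrite inE => /eqP ->.
move=> h v; rewrite /gt_rows => /allpairsP[[x y] []].
by rewrite !mem_iota => h1 h2 -> /=; move: h h1 h2 => /=; lia.
Qed.

Lemma sum_lt3 (F : 'I_3 -> 'I_3 -> int) :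
  \sum_(i < 3) \sum_(j < 3 | (i < j)%N) F i j = F 0 1 + F 0 2 + F 1 2.
Proof.
rewrite sum3E !(big_mkcond (fun j : 'I_3 => (_ < j)%N)) /= !sum3E /=.
by rewrite !addr0 !add0r.
Qed.

Lemma sum_lt2 (F : 'I_2 -> 'I_2 -> int) :
  \sum_(i < 2) \sum_(j < 2 | (i < j)%N) F i j = F 0 1.
Proof.
have sum2 (G : 'I_2 -> int) : \sum_i G i = G 0 + G 1.
  by rewrite !big_ord_recl big_ord0 addr0; congr (_ + G _); apply: val_inj.
rewrite sum2 !(big_mkcond (fun j : 'I_2 => (_ < j)%N)) /= !sum2 /=.
by rewrite !addr0 !add0r.
Qed.

Theorem irrep_exists (C : numClosedFieldType) g mu : g = 2%N \/ g = 3%N ->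
  size mu = g -> sorted geq mu ->
  exists (M : 'M[C]_g -> 'M[C]_(size (gt_patterns mu))) (top : 'I_(size (gt_patterns mu))),
  [/\ irrep_data M (@gt_wt mu g) top,
      forall i : 'I_g, @gt_wt mu g top i = nth 0%N mu i
    & forall b, weight_le (fun i : 'I_g => (@gt_wt mu g b i)%:Z) (fun i : 'I_g => (nth 0%N mu i)%:Z)].
Proof.
move=> hg; case: hg => -> {g}.
  case: mu => [|a [|b [|//]]] //= _; rewrite andbT => ba.
  have [M [top [HM et]]] := irrep2 C ba; exists M, top; split=> // [i|x].
    by rewrite /gt_wt et; case: i => [[|[|//]] ?] /=; lia.
  have [j [ex h]] := pattern2P ba x.
  exists (fun _ _ => (a - j)%N) => k; rewrite sum_lt2 /gt_wt ex.
  by case: k => [[|[|//]] ?] /=; lia.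
case: mu => [|a [|b [|c [|//]]]] //= _; rewrite andbT => /andP[ba cb].
have cba : (c <= b <= a)%N by rewrite cb ba.
have [M [top [HM et]]] := irrep3 C cba; exists M, top; split=> // [i|x].
  by rewrite /gt_wt et; case: i => [[|[|[|//]]] ?] /=; lia.
have [v [w [j [ex h]]]] := pattern3P cba x.
(* The difference of the weights is [a - j] times [e_0 - e_1] plus [a + b - v - w] times
   [e_1 - e_2], so simple roots suffice. *)
exists (fun i k => if (i == 0) && (k == 1) then (a - j)%N else if i == 1 then
  (a + (b + c) - (v + w) - c)%N else 0%N) => k; rewrite sum_lt3 /gt_wt ex /=.
by case: k => [[|[|[|//]]] ?] /=; lia.
Qed.

Lemma prod_prod_eq0 (D : idomainType) (I J : finType) (P : pred I) (Q : pred J)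
  (F : I -> J -> D) i j : P i -> Q j -> F i j = 0 ->
  \prod_(i | P i) \prod_(j | Q j) F i j = 0.
Proof. by move=> Pi Qj F0; rewrite (bigD1 i) //= (bigD1 j) //= F0 !mul0r. Qed.

(** * Multiplicities and character integrals *)

Section Assembly.
Variables (R : realType) (g : nat) (K : subgroup_kind).
Hypothesis hg : g = 2%N \/ g = 3%N.
Local Notation C := (Cx R).

Lemma bc_tensor_mx p q e i j : bounded_continuous (fun A : 'M[C]_g => @tensor_mx C g p q e A i j).
Proof.
under eq_fun do rewrite mxE.
apply: bc_mul; last exact/bc_exp/bc_det.
apply: bc_mul; apply: bc_prod => s; first exact: bc_coord.
exact/bc_conj/bc_coord.
Qed.

Lemma bc_mulmx m n k (F : 'M[C]_g -> 'M[C]_(m, n)) (G : 'M[C]_g -> 'M[C]_(n, k)) :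
  (forall i j, bounded_continuous (fun A => F A i j)) ->
  (forall i j, bounded_continuous (fun A => G A i j)) ->
  forall i j, bounded_continuous (fun A => (F A *m G A) i j).
Proof.
by move=> hF hG i j; under eq_fun do rewrite mxE; apply: bc_sum => l; exact: bc_mul.
Qed.

Lemma bc_irrep n (M : 'M[C]_g -> 'M[C]_n) wt top : irrep_data M wt top ->
  forall i j, bounded_continuous (fun A => M A i j).
Proof.
case=> _ _ _ _ [p [q [e [sigma [iota H]]]]] i j.
under eq_fun do rewrite H.
apply: bc_mulmx => {i j} [|i j]; last exact: bc_cst.
by apply: bc_mulmx => [i j|]; [exact: bc_cst | exact: bc_tensor_mx].
Qed.

Section Multiplicity.
Variables (mu : seq nat) (mu_dec : sorted geq mu).
Let n := size (gt_patterns mu).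
Variables (M : 'M[C]_g -> 'M[C]_n) (top : 'I_n).
Hypothesis HM : irrep_data M (@gt_wt mu g) top.

Let M1 : M 1%:M = 1%:M. Proof. by case: HM. Qed.
Let MM : forall A B, B \is unitarymx -> M (A *m B) = M A *m M B. Proof. by case: HM. Qed.
Let MD : forall t, is_torus t -> M (diag_mx t) = diag_mx (\row_b \prod_i t 0 i ^+ @gt_wt mu g b i).
Proof. by case: HM. Qed.
Let E : 'M[C]_n := invariant_projector M K.

Lemma projector_invariant A : @subgroup_of R g K A -> M A *m E = E.
Proof.
move=> hA; suff [] : A \is unitarymx /\ M A *m E = E by [].
move: A hA; apply: subgroup_ind.
- move=> t ht; split; first exact: u1_unitary.
  exact: (projector_u1 hg MM MD K ht).
- move=> hJ; split; first exact: j_unitary.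
  by apply: (projector_j hg MM MD); case: (K) hJ; [| left | | right].
- move=> hZ; split; first exact: z_unitary.
  by apply: (projector_z hg MM MD); case: (K) hZ; [| | left | right].
- by split; [exact: unitary1 | rewrite M1 mul1mx].
- move=> A B [uA eA] [uB eB]; split; first exact: mul_unitarymx.
  by rewrite MM // -mulmxA eB.
move=> A [uA eA]; split; first exact: unitary_inv.
by rewrite -{1}eA mulmxA -MM // mulVmx ?M1 ?mul1mx // unitarymx_unit.
Qed.

Lemma projector_fixes (v : 'cV[C]_n) :
  (forall A, @subgroup_of R g K A -> M A *m v = v) -> E *m v = v.
Proof.
move=> H; apply: (projector_fix hg MD).
- by move=> t ht; apply: H; exact: subgroup_u1.
- by move=> hK; apply: H; apply: subgroup_j; case: hK => ->.
by move=> hK; apply: H; apply: subgroup_zeta; case: hK => ->.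
Qed.

Definition invariants : {vspace 'cV[C]_n} := limg (linfun (mulmx E)).

Lemma invariantsP (v : 'cV[C]_n) : v \in invariants <->
  (forall A, @subgroup_of R g K A -> M A *m v = v).
Proof.
split=> [/memv_imgP[u _ ->] A hA|H]; first by rewrite lfunE /= mulmxA projector_invariant.
apply/memv_imgP; exists v; first exact: memvf.
by rewrite lfunE /= projector_fixes.
Qed.

(** Applied twice: to the explicit projector, whose trace is [mult K mu], and to the Haar average,
    whose trace is the integral of the character. The two matrices themselves are never compared. *)
Lemma trace_invariants (F : 'M[C]_n) :
  (forall A, @subgroup_of R g K A -> M A *m F = F) ->
  (forall v : 'cV[C]_n, (forall A, @subgroup_of R g K A -> M A *m v = v) -> F *m v = v) ->
  \tr F = (\dim invariants)%:R.
Proof.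
move=> MF Ffix; apply: trace_projection => v.
  by apply/invariantsP => A hA; rewrite mulmxA MF.
by move=> /invariantsP; exact: Ffix.
Qed.

Lemma dim_invariantsE : \dim invariants = mult K mu.
Proof.
have := trace_invariants projector_invariant projector_fixes.
rewrite (trace_projector hg (gt_rows_le mu_dec) M1 MM MD) => /eqP.
by rewrite eqr_nat => /eqP.
Qed.

Lemma invariants_multiplicity : dim_invariants M (@subgroup_of R g K) (mult K mu).
Proof. by exists invariants; [exact: dim_invariantsE | exact: invariantsP]. Qed.

Section Integral.
Variables (P : probability (borel_mx R g) R).
Hypothesis haarP : is_haar_probability (@subgroup_of R g K) P.
Hypothesis mH : measurable (@subgroup_of R g K : set (borel_mx R g)).
Let PH := haarP.1.
Let invP := haarP.2.

Lemma character_integral :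
  cintegral P (@subgroup_of R g K) (fun A => \tr (M A)) = (mult K mu)%:R.
Proof.
have bM := bc_irrep HM.
have HU : @subgroup_of R g K `<=` @unitary_group R g by move=> A; exact: subgroup_unitary.
pose F : 'M[C]_n := \matrix_(i, j) cintegral P (@subgroup_of R g K) (fun A => M A i j).
rewrite -dim_invariantsE -(@trace_invariants F).
- rewrite /mxtrace (cintegral_sum mH PH HU); last by move=> i; exact: bM.
  by apply: eq_bigr => i _; rewrite mxE.
(* By linearity [M h] moves under the integral, where it becomes a translation of the integrand,
   removed by invariance. *)
- move=> h hh; apply/matrixP => i j; rewrite [LHS]mxE [RHS]mxE.
  rewrite -(cintegral_translate mH PH invP HU (fun h A => @subgroup_mulE R g hg K h A) hh (bM i j)).
  under eq_bigr => k _ do rewrite mxE -(cintegralZ mH PH HU) //.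
  rewrite -(cintegral_sum mH PH HU) => [|k]; last by apply: bc_mul; [exact: bc_cst | exact: bM].
  by apply: eq_cintegral => A hA; rewrite MM ?mxE //; exact: (subgroup_unitary hg hA).
- move=> v hv; apply/matrixP => i j; rewrite (ord1 j) [LHS]mxE.
  under eq_bigr => k _ do rewrite mxE mulrC -(cintegralZ mH PH HU) //.
  rewrite -(cintegral_sum mH PH HU) => [|k]; last by apply: bc_mul; [exact: bc_cst | exact: bM].
  rewrite -[RHS](cintegral_cst mH PH); apply: eq_cintegral => A hA.
  by rewrite -[in RHS](hv A hA) mxE; apply: eq_bigr => k _; rewrite mulrC.
Qed.
End Integral.
End Multiplicity.

Lemma trace_diag_irrep mu (M : 'M[C]_g -> 'M[C]_(size (gt_patterns mu))) top (d : 'rV[C]_g) :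
  irrep_data M (@gt_wt mu g) top -> is_torus d ->
  \tr (M (diag_mx d)) = gt_char (fun i => d 0 i) mu.
Proof.
case=> _ _ MD _ _ hd; rewrite MD // mxtrace_diag /gt_char.
rewrite (big_tnth _ _ (gt_patterns mu)); apply: eq_bigr => b _.
by rewrite mxE; apply: eq_bigr.
Qed.

(** * Measurability of the subgroups *)

Section Measurable.

Lemma measurable_zero_set (f : 'M[C]_g -> C) : bounded_continuous f ->
  measurable ([set A | f A = 0] : set (borel_mx R g)).
Proof.
move=> [cf _].
have part (F : C -> R) : continuous F -> measurable ([set A | F (f A) = 0] : set (borel_mx R g)).
  move=> cF; have mF := @continuous_borel_measurable R g (fun A => F (f A))
    (fun A => @continuous_comp _ _ _ f F A (cf A) (cF (f A))).
  by have := mF measurableT [set 0] (measurable_set1 0); rewrite setTI.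
have -> : [set A | f A = 0] = [set A | complex.Re (f A) = 0] `&` [set A | complex.Im (f A) = 0].
  apply/seteqP; split=> [A /= ->//|A [/=]].
  by case: (f A) => a b /= -> ->.
by apply: measurableI; apply: part; [exact: Re_continuous | exact: Im_continuous].
Qed.

Lemma g_gt0 : (0 < g)%N. Proof. by case: hg => ->. Qed.
Let i0 : 'I_g := Ordinal g_gt0.

(* A sum of squared moduli: U(1), hence every coset of it, is the zero set of a
   single bounded continuous function. *)
Definition u1_defect (A : 'M[C]_g) : C :=
  (\sum_i \sum_j (A i j - diag_mx (split_row g (A i0 i0) (A i0 i0)^*) i j) *
     (A i j - diag_mx (split_row g (A i0 i0) (A i0 i0)^*) i j)^*) +
  (A i0 i0 * (A i0 i0)^* - 1) * (A i0 i0 * (A i0 i0)^* - 1)^*.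

Lemma bc_u1_defect : bounded_continuous u1_defect.
Proof.
have bsub f h : @bounded_continuous R g f -> @bounded_continuous R g h ->
    bounded_continuous (fun A => f A - h A).
  move=> bf bh; under eq_fun do rewrite -mulN1r.
  by apply: bc_add => //; apply: bc_mul => //; exact: bc_cst.
have b0 := @bc_coord R g i0 i0; have bc0 := bc_conj b0.
have D i j : bounded_continuous (fun A : 'M[C]_g => diag_mx (split_row g (A i0 i0) (A i0 i0)^*) i j).
  under eq_fun do rewrite !mxE.
  case: (i == j); last by under eq_fun do rewrite mulr0n; exact: bc_cst.
  under eq_fun do rewrite mulr1n.
  by case: (nat_of_ord i == 0%N) => //; case: (nat_of_ord i == 1%N) => //; exact: bc_cst.
apply: bc_add.
  apply: bc_sum => i; apply: bc_sum => j.
  by apply: bc_mul; [|apply: bc_conj]; apply: bsub => //; exact: bc_coord.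
by apply: bc_mul; [|apply: bc_conj]; (apply: bsub; [exact: bc_mul | exact: bc_cst]).
Qed.

Lemma u1_defect0 A : u1_defect A = 0 <-> exists2 t : C, `|t| = 1 & A = u1_mx g t.
Proof.
split=> [/eqP|[t ht ->]]; last first.
  have e0 : u1_mx g t i0 i0 = t by rewrite !mxE eqxx mulr1n.
  have tt : t * t^* = 1 by rewrite -normCK ht expr1n.
  have tV : t^-1 = t^* by rewrite invC_norm ht expr1n invr1 mul1r.
  rewrite /u1_defect e0 tt subrr mul0r addr0 big1 // => i _; rewrite big1 // => j _.
  by rewrite /u1_mx /u1_row tV subrr mul0r.
rewrite /u1_defect paddr_eq0; first last.
- by rewrite -normCK exprn_ge0.
- by apply: sumr_ge0 => i _; apply: sumr_ge0 => j _; rewrite -normCK exprn_ge0.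
have sq (z : C) : z * z^* = 0 -> z = 0.
  by move/eqP; rewrite mulf_eq0 conjC_eq0 orbb => /eqP.
move=> /andP[h1 /eqP/sq/eqP]; rewrite subr_eq0 => /eqP tt.
have tn : `|A i0 i0| = 1.
  by apply/eqP; rewrite -(@pexpr_eq1 _ _ 2) ?normr_ge0 // normCK tt.
have tV : (A i0 i0)^-1 = (A i0 i0)^* by rewrite invC_norm tn expr1n invr1 mul1r.
exists (A i0 i0) => //; apply/matrixP => i j; rewrite /u1_mx /u1_row tV.
move: h1; rewrite psumr_eq0 => [/allP/(_ i (mem_index_enum i))|k _]; last first.
  by apply: sumr_ge0 => l _; rewrite -normCK exprn_ge0.
rewrite /= psumr_eq0 => [/allP/(_ j (mem_index_enum j))|l _]; last by rewrite -normCK exprn_ge0.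
by move=> /= /eqP/sq/eqP; rewrite subr_eq0 => /eqP.
Qed.

Lemma coset_rep_unitary e f : @coset_rep C g e f \is unitarymx.
Proof.
by apply: mul_unitarymx; [case: e | case: f]; rewrite ?unitary1 ?j_unitary ?z_unitary.
Qed.

(** H is a finite union of cosets, and a union of zero sets is the zero set of a product.
    Integration over H needs this, and it is not part of [is_haar_probability]. *)
Lemma subgroup_measurable : measurable (@subgroup_of R g K : set (borel_mx R g)).
Proof.
pose F (A : 'M[C]_g) : C := \prod_(e : bool | e ==> has_J K) \prod_(f : bool | f ==> has_zeta K)
  u1_defect ((coset_rep C g e f) ^H *m A).
have bF : bounded_continuous F.
  apply: bc_prod => e; apply: bc_prod => f; apply: bc_translate; last exact: bc_u1_defect.
  by rewrite trmxC_unitary; exact: coset_rep_unitary.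
rewrite (_ : @subgroup_of R g K = [set A | F A = 0]); first exact: measurable_zero_set.
apply/seteqP; split=> A /=.
  move=> /(subgroup_cosets hg)[e [f [t [he hf ht ->]]]].
  apply: (@prod_prod_eq0 C _ _ (fun e => e ==> has_J K) (fun f => f ==> has_zeta K)
    (fun e f => u1_defect ((coset_rep C g e f) ^H *m _)) _ _ he hf); apply/u1_defect0; exists t => //.
  by rewrite mulmxA unitaryV ?coset_rep_unitary // mul1mx.
move=> /eqP; rewrite prodf_seq_eq0 => /hasP[e _ /andP[he]].
rewrite prodf_seq_eq0 => /hasP[f _ /andP[hf /eqP/u1_defect0[t ht eA]]].
apply/(subgroup_cosets hg); exists e, f, t; split=> //; rewrite -eA mulmxA.
by rewrite (unitarymxP (coset_rep_unitary e f)) mul1mx.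
Qed.
End Measurable.
End Assembly.

(** * Expansion of the integrand in characters *)

Section Diagonalization.
Variables (C : numClosedFieldType) (g : nat).

Lemma unitary_diagonalization (A : 'M[C]_g) : A \is unitarymx ->
  exists (Q : 'M[C]_g) (d : 'rV[C]_g),
  [/\ Q \is unitarymx, is_torus d & A = Q *m diag_mx d *m Q ^H].
Proof.
move=> hA; have hP := spectral_unitarymx A.
have /orthomx_spectralP eA : A \is normalmx.
  by apply/normalmxP; rewrite unitaryV // (unitarymxP hA).
exists ((spectralmx A) ^H), (spectral_diag A); rewrite trmxC_unitary trmxCK; split=> //; last first.
  by rewrite -invmx_unitary.
have hd : diag_mx (spectral_diag A) \is unitarymx.
  have -> : diag_mx (spectral_diag A) = spectralmx A *m A *m (spectralmx A) ^H.
    rewrite {3}eA invmx_unitary // !mulmxA (unitarymxP hP) mul1mx -mulmxA (unitarymxP hP).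
    by rewrite mulmx1.
  by rewrite !mul_unitarymx // trmxC_unitary.
move=> i; have /matrixP/(_ i i) := unitarymxP hd.
rewrite mul_diag_mx !mxE eqxx !mulr1n -normCK => e.
by apply/eqP; rewrite -(@pexpr_eq1 _ _ 2) ?normr_ge0 // e.
Qed.

Lemma det_one_plus (Q : 'M[C]_g) (d : 'rV[C]_g) (x : C) : Q \is unitarymx ->
  \det (1%:M + x *: (Q *m diag_mx d *m Q ^H)) = \prod_j (1 + x * d 0 j).
Proof.
move=> hQ.
have -> : 1%:M + x *: (Q *m diag_mx d *m Q ^H) =
   Q *m diag_mx (\row_j (1 + x * d 0 j)) *m Q ^H.
  have -> : diag_mx (\row_j (1 + x * d 0 j)) = 1%:M + x *: diag_mx d.
    apply/matrixP => i j; rewrite !mxE; case: (i == j); rewrite ?mulr1n ?mulr0n //.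
    by rewrite mulr0 addr0.
  by rewrite mulmxDr mulmx1 mulmxDl (unitarymxP hQ) -scalemxAr -scalemxAl.
rewrite !det_mulmx mulrAC -det_mulmx (unitarymxP hQ) det1 mul1r det_diag.
by apply: eq_bigr => j _; rewrite mxE.
Qed.
End Diagonalization.

(** The torus acts diagonally, so any nonzero coordinate b of a weight vector identifies its weight
    with that of the pattern b; dominance then only concerns patterns. *)
Lemma irrep_highest_weight (R : realType) g mu (M : 'M[Cx R]_g -> 'M[Cx R]_(size (gt_patterns mu)))
  (top : 'I_(size (gt_patterns mu))) :
  irrep_data M (@gt_wt mu g) top -> (forall i : 'I_g, @gt_wt mu g top i = nth 0%N mu i) ->
  (forall b, weight_le (fun i : 'I_g => (@gt_wt mu g b i)%:Z) (fun i : 'I_g => (nth 0%N mu i)%:Z)) ->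
  is_highest_weight M (fun i : 'I_g => (nth 0%N mu i)%:Z).
Proof.
move=> [_ _ MD _ _] wtop dom; split.
  exists (delta_mx top 0).
    by apply/eqP => /matrixP/(_ top 0); rewrite !mxE !eqxx => /eqP; rewrite oner_eq0.
  move=> t ht; rewrite MD //; apply/matrixP => b j; rewrite mul_diag_mx !mxE.
  case: eqP => [->|_]; last by rewrite !mulr0.
  by congr (_ * _); apply: eq_bigr => i _; rewrite wtop.
move=> nu [v v0 hv].
have [b vb] : exists b, v b 0 != 0.
  by case/matrix0Pn: v0 => b [j]; rewrite (ord1 j) => vb; exists b.
have e : (fun i : 'I_g => (@gt_wt mu g b i)%:Z) =1 nu.
  apply: (@torus_char_inj (Cx R) g) => t ht; apply: (mulIf vb).
  have /matrixP/(_ b 0) := hv t ht.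
  by rewrite MD // mul_diag_mx !mxE.
have [c hc] := dom b; exists c => k; rewrite -e; exact: hc.
Qed.

Lemma transposed_part_dec m g (lam : {ffun 'I_m -> 'I_g.+1}) :
  size (transposed_part lam) = g /\ sorted geq (transposed_part lam).
Proof.
have sz : size (transposed_part lam) = g by rewrite size_mkseq.
split=> //; apply/(path.sortedP 0%N) => i; rewrite sz => hi.
have e k : (k < g)%N -> nth 0%N (transposed_part lam) k = conj_part lam (nth (Ordinal hi) (enum 'I_g) k).
  by move=> hk; rewrite transposed_part_codom codomE (nth_map (Ordinal hi)) ?size_enum_ord.
rewrite !e ?(ltnW hi) //.
have /nonincrP := conj_part_nonincr lam; apply.
by rewrite !nth_enum_ord ?(ltnW hi).
Qed.

Lemma det_product_expansion (C : numClosedFieldType) g (A : 'M[C]_g) m (x : 'I_m -> C)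
  (chi : {ffun 'I_m -> 'I_g.+1} -> 'M[C]_g -> C) : g = 2%N \/ g = 3%N ->
  A \is unitarymx ->
  (forall lam (Q : 'M[C]_g) (d : 'rV[C]_g), Q \is unitarymx -> is_torus d ->
     chi lam (Q *m diag_mx d *m Q ^H) = gt_char (fun i => d 0 i) (transposed_part lam)) ->
  \prod_(i < m) \det (1%:M + x i *: A) =
  \sum_(lam : {ffun 'I_m -> 'I_g.+1} | is_partition lam)
     ssyt_sum (fun i => lam i) x * chi lam A.
Proof.
move=> hg /unitary_diagonalization[Q [d [hQ hd ->]]] hchi.
under eq_bigr do rewrite det_one_plus //.
rewrite (dual_cauchy_gt (fun i => d 0 i) x hg).
by apply: eq_bigr => lam _; rewrite hchi.
Qed.

(** Keeps three facts about the character and hides the dimension of its representation, which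
    depends on [mu]; a family of characters indexed by [lam] can then be chosen in one type. *)
Lemma character_exists (R : realType) g K (P : probability (borel_mx R g) R) mu :
  g = 2%N \/ g = 3%N -> is_haar_probability (@subgroup_of R g K) P ->
  size mu = g -> sorted geq mu ->
  exists chi : 'M[Cx R]_g -> Cx R,
  [/\ bounded_continuous chi,
      forall (Q : 'M[Cx R]_g) (d : 'rV[Cx R]_g), Q \is unitarymx -> is_torus d ->
        chi (Q *m diag_mx d *m Q ^H) = gt_char (fun i => d 0 i) mu
    & cintegral P (@subgroup_of R g K) chi = (mult K mu)%:R].
Proof.
move=> hg haarP smu dmu; have [M [top [HM _ _]]] := irrep_exists (Cx R) hg smu dmu.
have [M1 MM MD _ _] := HM; exists (fun A => \tr (M A)); split.
- by apply: bc_sum => i; exact: (bc_irrep HM).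
- by move=> Q d hQ hd; rewrite (trace_conj M1 MM hQ (diag_unitary hd)) (trace_diag_irrep HM hd).
exact: (character_integral hg dmu HM haarP (@subgroup_measurable R g K hg)).
Qed.

Theorem integral_identity (R : realType) g K (P : probability (borel_mx R g) R) m
  (x : 'I_m -> Cx R) : g = 2%N \/ g = 3%N -> is_haar_probability (@subgroup_of R g K) P ->
  cintegral P (@subgroup_of R g K)
            (fun gamma => \prod_(i < m) \det (1%:M + x i *: gamma))
          = \sum_(lam : {ffun 'I_m -> 'I_g.+1} | is_partition lam)
              (mult K (transposed_part lam))%:R * schur (fun i => lam i : nat) x.
Proof.
move=> hg haarP.
have /fin_all_exists[chi hchi] : forall lam : {ffun 'I_m -> 'I_g.+1},
  exists chi : 'M[Cx R]_g -> Cx R,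
  [/\ bounded_continuous chi,
      forall (Q : 'M[Cx R]_g) (d : 'rV[Cx R]_g), Q \is unitarymx -> is_torus d ->
        chi (Q *m diag_mx d *m Q ^H) = gt_char (fun i => d 0 i) (transposed_part lam)
    & cintegral P (@subgroup_of R g K) chi = (mult K (transposed_part lam))%:R].
  by move=> lam; have [s d] := transposed_part_dec lam; exact: character_exists.
have mH := @subgroup_measurable R g K hg; have HU := @subgroup_unitary R g hg K.
have bchi lam : bounded_continuous (chi lam) by have [] := hchi lam.
transitivity (cintegral P (@subgroup_of R g K)
  (fun A => \sum_(lam : {ffun 'I_m -> 'I_g.+1} | is_partition lam)
     ssyt_sum (fun i => lam i) x * chi lam A)).
  apply: eq_cintegral => A /HU hA; apply: det_product_expansion => // lam.
  by have [] := hchi lam.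
rewrite (cintegral_sum mH haarP.1 HU) => [|lam]; last by apply: bc_mul => //; exact: bc_cst.
apply: eq_bigr => lam _; rewrite (cintegralZ mH haarP.1 HU) // mulrC.
by have [_ _ ->] := hchi lam.
Qed.

Theorem mainTheorem1 (R : realType) (g : nat) (hg : g = 2%N \/ g = 3%N)
    (K : subgroup_kind) :
  exists mult : seq nat -> nat,
  [/\ (* mult mu is the multiplicity for the highest weight mu *)
      forall mu : seq nat, size mu = g -> sorted geq mu ->
        trivial_multiplicity (@subgroup_of R g K) mu (mult mu),

      (* the integral identity *)
      forall (m : nat) (P : probability (borel_mx R g) R),
        (1 <= m)%N -> is_haar_probability (@subgroup_of R g K) P ->
        forall x : 'I_m -> Cx R,
          cintegral P (@subgroup_of R g K)
            (fun gamma => \prod_(i < m) \det (1%:M + x i *: gamma))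
          = \sum_(lam : {ffun 'I_m -> 'I_g.+1} | is_partition lam)
              (mult (transposed_part lam))%:R * schur (fun i => lam i : nat) x,

      (* (1) *)
      g = 2%N -> forall a b : nat, (b <= a)%N ->
        mult [:: a; b] =
          match K with
          | KU1 => (a == b %[mod 2])%N
          | KH => (a == b %[mod 4])%N
          | KH'4 => (a + b == 0 %[mod 4])%N
          | KH4 => ((a + b == 0 %[mod 4]) * (a == b %[mod 4]))%N
          end,

      (* (2) *)
      g = 3%N -> forall a b k : nat, (b <= a)%N ->
        let z := (a - b)%N in
        let c := Num.ceil (((z + 1) * (b + 1))%N%:R / 2 : rat) in
        (K = KU1 -> (mult [:: a + k; b + k; k]%N)%:Z = c) /\
        (K = KH -> (mult [:: a + k; b + k; k]%N)%:R
                     = 1 / 2 * (c%:~R + (tau_tab z b)%:~R) :> rat)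

    & (* (3) *)
      g = 3%N -> forall (a b k : nat) (eps : bool), (eps <= b <= a)%N ->
        let z := (a - b)%N in
        let b' := (b - eps)%N in
        let mu := [:: a + 2 * k; b + 2 * k; eps + 2 * k]%N in
        (K = KH'4 -> (mult mu)%:R
           = (((z + 1) * (b' + 1))%N%:R + (kappa_tab eps z b')%:~R) / 4 :> rat) /\
        (K = KH4 -> (mult mu)%:R
           = ((b' * z)%N%:R + (pair_dot (eta_tab eps z b') (b', z))%:R
              + (xi_tab eps z b')%:~R) / 8 :> rat)].
Proof.
exists (mult K); split.
- move=> mu smu dmu; have [M [top [HM wtop dom]]] := irrep_exists (Cx R) hg smu dmu.
  have [M1 MM MD Mirr _] := HM.
  exists (size (gt_patterns mu)), M; split.
  + split; [exact: M1 | by move=> A B _ hB; exact: MM | ].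
    apply: continuous_subspaceT; apply: mx_continuous => i j.
    by have [] := bc_irrep HM i j.
  + by split; [exact: leq_ltn_trans (leq0n _) (ltn_ord top) | exact: Mirr].
  + exact: irrep_highest_weight HM wtop dom.
  exact: (@invariants_multiplicity R g K hg mu dmu M top HM).
- move=> m P _ haarP x; exact: integral_identity.
- by move=> _ a b _; rewrite mult2E; case: (K).
- by move=> _ a b k; exact: mult_formula2.
by move=> _ a b k eps; exact: mult_formula3.
Qed.
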